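(* Let $q$ be a power of a prime $p$, $n\ge2$, $s\ge2$ integers, $\sigma$ a generator of $\mathrm{Gal}(\mathbb F_{q^n}/\mathbb F_q)$, and $F\in\mathbb F_q[Y]$ a monic irreducible polynomial of degree $s$ such that $(n,s,F)\ne(2,2,Y^2-\nu)$ for every $\nu\in\mathbb F_q^\times$. Let $\mathbb S(F)$ be the cyclic semifield associated with $F$. Then $$|\mathrm{Aut}(\mathbb S(F))|=|\mathcal H_F|\,n\,\frac{(q^s-1)(q^n-1)^2}{q-1}.$$
   Context: $R=\mathbb F_{q^n}[X;\sigma]$ is the skew polynomial ring with $X\alpha=\sigma(\alpha)X$. Let $f\in R$ be a monic irreducible right divisor of the central element $F(X^n)$ (it has degree $s$). The cyclic semifield $\mathbb S(F)$ is the set of skew polynomials of degree at most $s-1$ with the usual addition and multiplication $a\circ b:=ab\bmod_r f$, where $ab\bmod_r f$ is the remainder $\rho$ in $ab=cf+\rho$, $\deg\rho<s$ (up to isotopy it depends only on $F$ and $\sigma$; equivalently, its spread set is the set of classes of skew polynomials of degree at most $s-1$ in $R/RF(X^n)\cong M_n(\mathbb F_{q^s})$). The autotopism group of a finite semifield $(\mathcal S,+,\star)$ of characteristic $p$ is $$\mathrm{Aut}(\mathcal S):=\{(f,g,h)\in\mathrm{GL}_{\mathbb F_p}(\mathcal S)^3: f(a\star b)=g(a)\star h(b)\text{ for all }a,b\in\mathcal S\}.$$ Let $\mathbb F=\mathbb F_{q^s}$ and $u_F\in\mathbb F$ a root of $F$. $\mathcal H_F^+:=\{\rho\in\mathrm{Aut}_{\mathbb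 F_p}(\mathbb F):\rho(u_F)=\lambda u_F\text{ for some }\lambda\in\mathbb F_q^\times\}$; for $n=2$, $\mathcal H_F^-:=\{\rho\in\mathrm{Aut}_{\mathbb F_p}(\mathbb F):\rho(u_F)=\lambda u_F^{-1}\text{ for some }\lambda\in\mathbb F_q^\times\}$. Finally $\mathcal H_F:=\mathcal H_F^+$ if $n>2$ and $\mathcal H_F:=\mathcal H_F^+\cup\mathcal H_F^-$ if $n=2$. *)

(* Defs.v *)
From HB Require Import structures.
From mathcomp Require Import all_boot all_order all_fingroup all_algebra.
From mathcomp Require Import all_solvable all_field.

Set Implicit Arguments.
Unset Strict Implicit.
Unset Printing Implicit Defensive.

Import GRing.Theory.
Local Open Scope ring_scope.

(* The skew polynomial ring L[X; sigma]: the additive group of {poly L}, with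
   coefficients written on the left and the multiplication determined by
   'X * a = sigma a * 'X (see skewX_skewC below). *)
Definition skewpoly (L : nzRingType) (sigma : {rmorphism L -> L}) : Type :=
  {poly L}.

Section SkewPoly.

Variables (L : nzRingType) (sigma : {rmorphism L -> L}).

HB.instance Definition _ := GRing.Zmodule.on (skewpoly sigma).

Implicit Types a b c : {poly L}.

(* 'X^i times b is sigma^i(b) 'X^i, where sigma acts on coefficients. *)
Definition skewX_mul (i : nat) b : {poly L} :=
  (\poly_(j < size b) iter i sigma b`_j) * 'X^i.

Definition skew_mul a b : {poly L} :=
  \sum_(i < size a) a`_i *: skewX_mul i b.

Local Notation "a ** b" := (skew_mul a b) (at level 40, left associativity).

Lemma iter_sigma0 i : iter i sigma 0 = 0.
Proof. by elim: i => //= i ->; rewrite rmorph0. Qed.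

Lemma iter_sigmaD i x y : iter i sigma (x + y) = iter i sigma x + iter i sigma y.
Proof. by elim: i => //= i ->; rewrite rmorphD. Qed.

Lemma iter_sigmaM i x y : iter i sigma (x * y) = iter i sigma x * iter i sigma y.
Proof. by elim: i => //= i ->; rewrite rmorphM. Qed.

Lemma iter_sigma1 i : iter i sigma 1 = 1.
Proof. by elim: i => //= i ->; rewrite rmorph1. Qed.

Lemma coef_skewX_mul i b k :
  (skewX_mul i b)`_k = if (k < i)%N then 0 else iter i sigma b`_(k - i).
Proof.
rewrite coefMXn; case: ltnP => // _; rewrite coef_poly.
by case: ltnP => // le_b; rewrite nth_default // iter_sigma0.
Qed.

Lemma skew_mul_widen m a b : (size a <= m)%N ->
  a ** b = \sum_(i < m) a`_i *: skewX_mul i b.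
Proof.
move=> le_am; rewrite /skew_mul.
rewrite (big_ord_widen m (fun i => a`_i *: skewX_mul i b)) //.
rewrite big_mkcond; apply: eq_bigr => i _; case: ltnP => // le_ai.
by rewrite nth_default // scale0r.
Qed.

Lemma skew_mulDl : left_distributive skew_mul +%R.
Proof.
move=> a b c; pose m := maxn (size a) (size b).
rewrite (@skew_mul_widen m (a + b)) ?size_polyD //.
rewrite (@skew_mul_widen m a) ?leq_maxl // (@skew_mul_widen m b) ?leq_maxr //.
by rewrite -big_split; apply: eq_bigr => i _; rewrite coefD scalerDl.
Qed.

Lemma skewX_mulD i : {morph skewX_mul i : b c / b + c}.
Proof.
move=> b c; apply/polyP => k; rewrite coefD !coef_skewX_mul.
by case: ltnP => _; rewrite ?addr0 // coefD iter_sigmaD.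
Qed.

Lemma skew_mulDr : right_distributive skew_mul +%R.
Proof.
move=> a b c; rewrite /skew_mul -big_split; apply: eq_bigr => i _.
by rewrite skewX_mulD scalerDr.
Qed.

Lemma skew_mul0l b : 0 ** b = 0.
Proof. by rewrite /skew_mul size_poly0 big_ord0. Qed.

Lemma skewX_mul0 i : skewX_mul i 0 = 0.
Proof. by apply: (addrI (skewX_mul i 0)); rewrite -skewX_mulD !addr0. Qed.

Lemma skew_mul0r a : a ** 0 = 0.
Proof. by apply: (addrI (a ** 0)); rewrite -skew_mulDr !addr0. Qed.

Lemma skew_mul_monom x i b : (x *: 'X^i) ** b = x *: skewX_mul i b.
Proof.
rewrite (@skew_mul_widen i.+1) ?(leq_trans (size_scale_leq _ _)) ?size_polyXn //.
rewrite big_ord_recr /= big1 ?add0r => [|j _]; rewrite coefZ coefXn.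
  by rewrite eqxx mulr1.
by rewrite ltn_eqF // mulr0 scale0r.
Qed.

Lemma skewX_mul_monom i x j :
  skewX_mul i (x *: 'X^j) = iter i sigma x *: 'X^(i + j).
Proof.
apply/polyP => k; rewrite coef_skewX_mul !coefZ !coefXn; case: ltnP => [lt_ki | le_ik].
  by rewrite ltn_eqF ?mulr0 // ltn_addr.
rewrite -[(k - i == j)%N](eqn_add2l i) subnKC //.
by case: eqP => _; rewrite ?mulr1 // !mulr0 iter_sigma0.
Qed.

Lemma skew_poly_ind (P : {poly L} -> Prop) :
    P 0 -> (forall a b, P a -> P b -> P (a + b)) ->
  (forall x i, P (x *: 'X^i)) -> forall a, P a.
Proof.
move=> P0 PD PM a; rewrite -[a]coefK poly_def.
by apply: big_ind => // i _; apply: PM.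
Qed.

Lemma skew_mulA : associative skew_mul.
Proof.
move=> a b c; elim/skew_poly_ind: a => [|a a' IH IH'|x i].
- by rewrite !skew_mul0l.
- by rewrite !skew_mulDl IH IH'.
elim/skew_poly_ind: b => [|b b' IH IH'|y j].
- by rewrite skew_mul0l skew_mul0r skew_mul0l.
- by rewrite skew_mulDr !skew_mulDl skew_mulDr IH IH'.
elim/skew_poly_ind: c => [|c c' IH IH'|z k].
- by rewrite !skew_mul0r.
- by rewrite !skew_mulDr IH IH'.
rewrite !skew_mul_monom !skewX_mul_monom !scalerA skew_mul_monom.
rewrite !(skew_mul_monom, skewX_mul_monom, scalerA).
by rewrite iter_sigmaM iterD addnA mulrA.
Qed.

Lemma skew_mul1l : left_id 1 skew_mul.
Proof.
move=> b; rewrite -[1](scale1r ('X^0 : {poly L})) skew_mul_monom scale1r.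
by apply/polyP => k; rewrite coef_skewX_mul subn0.
Qed.

Lemma skew_mul1r : right_id 1 skew_mul.
Proof.
move=> a; elim/skew_poly_ind: a => [|a a' IH IH'|x i].
- exact: skew_mul0l.
- by rewrite skew_mulDl IH IH'.
rewrite -[1](scale1r ('X^0 : {poly L})) skew_mul_monom skewX_mul_monom.
by rewrite iter_sigma1 scale1r addn0.
Qed.

HB.instance Definition _ := GRing.Zmodule_isNzRing.Build (skewpoly sigma)
  skew_mulA skew_mul1l skew_mul1r skew_mulDl skew_mulDr (oner_neq0 {poly L}).

Definition skewC (x : L) : skewpoly sigma := x%:P.
Definition skewX : skewpoly sigma := ('X : {poly L}).

Lemma mul_monomE x i y j (a b : skewpoly sigma) :
    a = (x *: 'X^i : {poly L}) -> b = (y *: 'X^j : {poly L}) ->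
  a * b = ((x * iter i sigma y) *: 'X^(i + j) : {poly L}).
Proof.
by move=> -> ->; rewrite /GRing.mul /= skew_mul_monom skewX_mul_monom scalerA.
Qed.

Lemma skewCE x : skewC x = (x *: 'X^0 : {poly L}).
Proof. by rewrite /skewC -alg_polyC. Qed.

Lemma skewXE : skewX = (1 *: 'X^1 : {poly L}).
Proof. by rewrite scale1r. Qed.

Lemma skewX_skewC x : skewX * skewC x = skewC (sigma x) * skewX.
Proof.
rewrite (mul_monomE skewXE (skewCE x)) (mul_monomE (skewCE _) skewXE) /=.
by rewrite mul1r mulr1.
Qed.

Lemma skew_monomE x d : skewC x * skewX ^+ d = (x *: 'X^d : {poly L}).
Proof.
have XE : skewX ^+ d = (1 *: 'X^d : {poly L}).
  elim: d => [|d IH]; first by rewrite expr0 scale1r.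
  by rewrite exprS (mul_monomE skewXE IH) /= rmorph1 mul1r.
by rewrite (mul_monomE (skewCE x) XE) mulr1.
Qed.

(* The remainder of g in the division g = c * f + r with size r < size f, for
   f monic; see skew_rmodP. The fuel k bounds the number of division steps. *)
Fixpoint skew_rmod_rec (f : skewpoly sigma) (k : nat) (g : skewpoly sigma) :
    skewpoly sigma :=
  if (size (g : {poly L}) < size (f : {poly L}))%N then g else
  if k is k'.+1 then
    let d := (size (g : {poly L}) - size (f : {poly L}))%N in
    skew_rmod_rec f k' (g - skewC (lead_coef (g : {poly L})) * skewX ^+ d * f)
  else g.

Definition skew_rmod (g f : skewpoly sigma) : skewpoly sigma :=
  skew_rmod_rec f (size (g : {poly L})) g.

Lemma skew_rmodP (g f : skewpoly sigma) : (f : {poly L}) \is monic ->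
  exists2 c : skewpoly sigma, g = c * f + skew_rmod g f &
    (size (skew_rmod g f : {poly L}) < size (f : {poly L}))%N.
Proof.
move=> monf; rewrite /skew_rmod.
have f_gt0 : (0 < size (f : {poly L}))%N by rewrite size_poly_gt0 monic_neq0.
have: (size (g : {poly L}) <= size (g : {poly L}))%N by [].
move: {2 3 4}(size (g : {poly L})) => m.
elim: m g => [|m IH] g le_gm /=.
  move: (le_gm); rewrite leqn0 => /eqP ->; rewrite f_gt0.
  by exists 0; rewrite ?mul0r ?add0r // (leq_ltn_trans le_gm).
case: ltnP => [lt_gf | le_fg]; first by exists 0; rewrite ?mul0r ?add0r.
set d := (size _ - size _)%N; set h := skewC _ * _.
have [|c Ec ltc] := IH (g - h * f).
  have Eh : h * f = lead_coef (g : {poly L}) *: skewX_mul d f.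
    by rewrite /h skew_monomE /GRing.mul /= skew_mul_monom.
  have g_gt0 := leq_trans f_gt0 le_fg.
  apply/leq_sizeP => j le_mj; rewrite coefB Eh coefZ coef_skewX_mul.
  have [lt_jg | le_gj] := ltnP j (size (g : {poly L})).
    have Ej : j = (size (g : {poly L})).-1.
      by apply/eqP; rewrite eqn_leq -ltnS prednK // lt_jg /= -ltnS prednK //
        (leq_trans le_gm).
    have -> : (j < d)%N = false.
      by rewrite Ej /d ltnNge -subn1 leq_sub2l.
    have -> : (j - d = (size (f : {poly L})).-1)%N.
      by rewrite Ej /d -subn1 subnAC subKn ?subn1.
    have := monicP monf; rewrite lead_coefE => ->.
    by rewrite iter_sigma1 mulr1 Ej subrr.
  rewrite (nth_default _ le_gj) sub0r; case: ltnP => [_ | le_dj].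
    by rewrite mulr0 oppr0.
  rewrite [f`_ _]nth_default ?iter_sigma0 ?mulr0 ?oppr0 //.
  by rewrite -(subKn le_fg) leq_sub2r.
by exists (c + h) => //; rewrite mulrDl addrAC -Ec subrK.
Qed.

End SkewPoly.

Arguments skewpoly {L} sigma.
Arguments skewC {L} sigma x.
Arguments skewX {L} sigma.


Section Ring.

Variable R : nzRingType.

Definition ring_unit (x : R) : Prop := exists y, y * x = 1 /\ x * y = 1.

Definition irreducible_elt (x : R) : Prop :=
  [/\ x <> 0, ~ ring_unit x &
      forall y z, x = y * z -> ring_unit y \/ ring_unit z].

Definition right_divisor (x y : R) : Prop := exists z, y = z * x.

End Ring.

Section Autotopism.

Variables (p : nat) (S : finZmodType) (mul : S -> S -> S).

(* For S of characteristic p, the scalar c in F_p acts as c-fold addition. *)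
Definition Fp_linear (g : {perm S}) : bool :=
  [forall a, forall b, g (a + b) == g a + g b] &&
  [forall c : 'F_p, forall a, g (a *+ c) == g a *+ c].

Definition autotopisms : {set {perm S} * {perm S} * {perm S}} :=
  [set t : {perm S} * {perm S} * {perm S} |
    let: (f, g, h) := t in
    [&& Fp_linear f, Fp_linear g, Fp_linear h &
        [forall a, forall b, f (mul a b) == mul (g a) (h b)]]].

End Autotopism.

Section CyclicSemifield.

Variables (K : finFieldType) (L : fieldExtType K).
Variables (n : nat) (sigma : gal_of {: finvect_type L}).

Definition gal_rmorphism : {rmorphism finvect_type L -> finvect_type L} :=
  gal_repr sigma.

Local Notation R := (skewpoly gal_rmorphism).

(* F(X^n), with F in K[Y] viewed over L. *)
Definition skew_eval_Xn (F : {poly K}) : R :=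
  \sum_(i < size F) skewC gal_rmorphism (F`_i)%:A *
    skewX gal_rmorphism ^+ (n * i).

(* npolyp s is the truncation to degree < s; when f has degree s it acts as the
   identity on remainders by f. *)
Definition cyclic_mul (s : nat) (f : R)
    (a b : {poly_s (finvect_type L)}) : {poly_s (finvect_type L)} :=
  npolyp s (skew_rmod ((a : R) * (b : R)) f : {poly finvect_type L}).

End CyclicSemifield.

Section StabilizerSets.

Variables (p : nat) (K : finFieldType) (E : fieldExtType K).
Hypothesis pcharK : p \in [pchar K].

Lemma pchar_ext : p \in [pchar (finvect_type E)].
Proof. by rewrite pchar_lalg. Qed.

Definition absolute_field : splittingFieldType 'F_p := pPrimeCharType pchar_ext.

Definition AutFp : {set gal_of {: absolute_field}} := 'Gal({: absolute_field} / 1)%g.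

Definition Hplus (u : finvect_type E) : {set gal_of {: absolute_field}} :=
  [set rho in AutFp |
    [exists lambda : K, (lambda != 0) &&
      ((rho (u : absolute_field) : finvect_type E) == lambda *: u)]].

Definition Hminus (u : finvect_type E) : {set gal_of {: absolute_field}} :=
  [set rho in AutFp |
    [exists lambda : K, (lambda != 0) &&
      ((rho (u : absolute_field) : finvect_type E) == lambda *: u^-1)]].

Definition HF (n : nat) (u : finvect_type E) : {set gal_of {: absolute_field}} :=
  if n == 2 then Hplus u :|: Hminus u else Hplus u.

End StabilizerSets.

(* Main.v *)
(* The algebra R/RF(X^n) acts faithfully on V = R/Rf, because every two-sided
   ideal of R containing F(X^n) is generated by a central polynomial. By Schur,
   Wedderburn and Jacobson density, the commutant of this action is the field
   E = K[X^n]/(F), and comparing cardinalities gives deg f = s.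

   An autotopism (phi, gamma, eta) satisfies phi o a = gamma(a) o eta for the
   operators a of degree < s. Writing L-scalars on either side of a, one finds
   that gamma and eta are semilinear over L; then the (L,L)-bimodule
   W = gamma(polynomials of degree < s - 1) has codimension 1. If W contains 1,
   then eta o X = x X o eta for a scalar x; otherwise n = 2 and
   X o eta o X = x o eta. In both cases eta is semilinear over E for an
   automorphism rho with rho u = k u or rho u = k / u, where k = N(x) is in K,
   that is, rho lies in H_F. Every rho in H_F occurs: twisting the action by rho
   gives again a module over R/RF(X^n), which is isomorphic to V (Skolem-Noether),
   and the norm L^* -> K^* is onto.

   There remain the autotopisms with eta E-linear. The exceptional polynomials F
   are those with n = 2 and u^2 in K, for which k / u may fix u. Otherwise
   Hilbert 90 gives eta = y X^j eps with y in L^*, j < n, eps in E^*, and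
   phi = z eta with z in L^*; the parameters (z, y, j, eps) are determined up to
   (y, eps) -> (k y, eps / k) with k in K^*. *)

Require Import Defs.
From HB Require Import structures.
From mathcomp Require Import all_boot all_order all_fingroup all_algebra.
From mathcomp Require Import all_solvable all_field.
From mathcomp Require Import zify ring.

Set Implicit Arguments.
Unset Strict Implicit.
Unset Printing Implicit Defensive.

Import GRing.Theory.
Local Open Scope ring_scope.

(** * Arithmetic of skew polynomials *)

(** Operator identities on V are converted into identities of skew polynomials, where degrees can be
    compared. This is valid for sizes up to [n * s], that is, below the degree of F(X^n); a product
    of two polynomials of degree < s fits because n >= 2. It pins down gamma, at first a mere
    additive bijection: whatever multiplies X^(s-1) into a polynomial of degree < s is a constant.
    Two facts on finite fields link the three fields. The map [sigma] is a power map [x ^+ Q0],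
    hence commutes with every ring endomorphism of L that eta induces. An automorphism rho of E is a
    power of Frobenius, and the same exponent defines companions of rho on K and on L; the companion
    on L is what allows the action of R to be twisted by rho. R/RF(X^n) is never identified with a
    matrix ring: only the number |L|^(n s) of its elements enters, through evaluation on a basis of
    V over the commutant. Where a map has to be onto, this mostly comes from injectivity and
    cardinalities. *)

Section SkewCoefficients.

Variables (L : fieldType) (sigma : {rmorphism L -> L}).
Local Notation R := (skewpoly sigma).
Local Notation C := (skewC sigma).
Local Notation X := (skewX sigma).
Implicit Types a b c : R.

Definition skcoef a (i : nat) : L := (a : {poly L})`_i.
Definition sksize (a : R) : nat := size (a : {poly L}).
Arguments sksize _%_ring_scope.

Lemma skcoefP a b : (forall i, skcoef a i = skcoef b i) -> a = b.
Proof. by move=> eq_ab; apply/polyP. Qed.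

Lemma skcoef0 i : skcoef 0 i = 0.
Proof. exact: coef0. Qed.

Lemma skcoefD a b i : skcoef (a + b) i = skcoef a i + skcoef b i.
Proof. exact: coefD. Qed.

Lemma skcoefN a i : skcoef (- a) i = - skcoef a i.
Proof. exact: coefN. Qed.

Lemma skcoefB a b i : skcoef (a - b) i = skcoef a i - skcoef b i.
Proof. by rewrite skcoefD skcoefN. Qed.

Lemma skcoefC x i : skcoef (C x) i = if i == 0%N then x else 0.
Proof. exact: coefC. Qed.

Lemma skcoef_sum I r (P : pred I) (h : I -> R) i :
  skcoef (\sum_(j <- r | P j) h j) i = \sum_(j <- r | P j) skcoef (h j) i.
Proof. exact: (big_morph (skcoef^~ i) (fun a b => skcoefD a b i) (skcoef0 i)). Qed.

Lemma skcoef_mul a b k :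
  skcoef (a * b) k = \sum_(i < k.+1) skcoef a i * iter i sigma (skcoef b (k - i)).
Proof.
pose m := maxn (size (a : {poly L})) k.+1.
rewrite /skcoef /GRing.mul /= (@skew_mul_widen _ _ m) ?leq_maxl // coef_sum.
rewrite [RHS](big_ord_widen m
  (fun i => a`_i * iter i sigma b`_(k - i))) ?leq_maxr //.
rewrite [RHS]big_mkcond; apply: eq_bigr => i _.
rewrite coefZ coef_skewX_mul ltnS ltnNge.
by case: leqP; rewrite //= mulr0.
Qed.

Lemma sksize_leqP a m :
  reflect (forall i, (m <= i)%N -> skcoef a i = 0) (sksize a <= m)%N.
Proof. exact: leq_sizeP. Qed.

Lemma skcoef_nil a i : (sksize a <= i)%N -> skcoef a i = 0.
Proof. exact: nth_default. Qed.

Lemma sksize_eq0 a : (sksize a == 0)%N = (a == 0).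
Proof. exact: size_poly_eq0. Qed.

Lemma sksize0 : sksize 0 = 0%N.
Proof. exact: size_poly0. Qed.

Lemma sksizeD a b m :
  (sksize a <= m)%N -> (sksize b <= m)%N -> (sksize (a + b)%R <= m)%N.
Proof.
move=> /sksize_leqP sa /sksize_leqP sb; apply/sksize_leqP => i mi.
by rewrite skcoefD sa ?sb ?addr0.
Qed.

Lemma sksizeB a b m :
  (sksize a <= m)%N -> (sksize b <= m)%N -> (sksize (a - b)%R <= m)%N.
Proof.
move=> sa /sksize_leqP sb; apply: sksizeD => //; apply/sksize_leqP => i mi.
by rewrite skcoefN sb ?oppr0.
Qed.

Lemma sklead_neq0 a : a != 0 -> skcoef a (sksize a).-1 != 0.
Proof. by move=> nz_a; have := lead_coef_eq0 (a : {poly L}); rewrite lead_coefE => ->. Qed.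

Lemma sksize_gt a i : skcoef a i != 0 -> (i < sksize a)%N.
Proof. by apply: contraR; rewrite -leqNgt => /skcoef_nil->. Qed.

Lemma sksizeC_leq x : (sksize (C x) <= 1)%N.
Proof. by apply/sksize_leqP => -[|i]; rewrite ?skcoefC. Qed.

Lemma sksize_leq1 a : (sksize a <= 1)%N -> a = C (skcoef a 0).
Proof.
move=> sa; apply: skcoefP => -[|i]; rewrite skcoefC //=.
by apply: skcoef_nil; apply: leq_trans sa _.
Qed.

Lemma iter_sigma_eq0 i x : (iter i sigma x == 0) = (x == 0).
Proof. by elim: i => //= i; rewrite fmorph_eq0. Qed.

(** The top coefficient of the product is the leading coefficient of [a] times a sigma-power of that
    of [b]; it is nonzero because field endomorphisms are injective. *)
Lemma sksize_mul a b : a != 0 -> b != 0 -> sksize (a * b) = (sksize a + sksize b).-1.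
Proof.
move=> nz_a nz_b; set m := (sksize a).-1; set k := (sksize b).-1.
have Ea : sksize a = m.+1 by rewrite prednK // lt0n sksize_eq0.
have Eb : sksize b = k.+1 by rewrite prednK // lt0n sksize_eq0.
rewrite Ea Eb addSn addnS /=; apply/eqP; rewrite eqn_leq; apply/andP; split.
  apply/sksize_leqP => i lt_i; rewrite skcoef_mul big1 // => j _.
  case: (leqP (sksize a) j) => [le_aj | lt_ja].
    by rewrite skcoef_nil ?mul0r.
  rewrite [X in iter _ _ X]skcoef_nil ?iter_sigma0 ?mulr0 // Eb.
  have le_jm : (j <= m)%N by rewrite -ltnS -Ea.
  rewrite leq_subRL; first by apply: leq_trans lt_i; rewrite addnS ltnS leq_add2r.
  by rewrite (leq_trans le_jm) // (leq_trans _ lt_i) // leqW ?leq_addr.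
rewrite ltnNge; apply/negP => /sksize_leqP/(_ _ (leqnn _)).
rewrite skcoef_mul (bigD1 (Ordinal (leq_addr k m : (m < (m + k).+1)%N))) //=.
rewrite big1 => [|j neq_j]; last first.
  have neq : (j : nat) != m by apply: contra neq_j => /eqP Ej; apply/eqP/val_inj.
  case: (ltngtP j m) neq => [lt_jm | lt_mj | //] _; last first.
    by rewrite skcoef_nil ?mul0r // Ea.
  rewrite [X in iter _ _ X]skcoef_nil ?iter_sigma0 ?mulr0 // Eb.
  by rewrite ltn_subRL ltn_add2r.
rewrite addr0 addKn => /eqP; rewrite mulf_eq0 iter_sigma_eq0.
by rewrite (negPf (sklead_neq0 nz_a)) (negPf (sklead_neq0 nz_b)).
Qed.

Lemma skmul_eq0 a b : (a * b == 0) = (a == 0) || (b == 0).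
Proof.
apply/eqP/orP => [ab0 | [] /eqP->]; rewrite ?mulr0 ?mul0r //.
case: (eqVneq a 0) => [_|nz_a]; first by left.
case: (eqVneq b 0) => [_|nz_b]; first by right.
have := sksize_mul nz_a nz_b; rewrite ab0 sksize0.
have : (0 < sksize a)%N by rewrite lt0n sksize_eq0.
have : (0 < sksize b)%N by rewrite lt0n sksize_eq0.
by case: (sksize a) (sksize b) => // i [] // j; rewrite addSn addnS.
Qed.

Lemma skmulIr c : c != 0 -> injective (fun a => a * c).
Proof.
move=> nz_c a b /eqP; rewrite -subr_eq0 -mulrBl skmul_eq0 (negPf nz_c) orbF.
by rewrite subr_eq0 => /eqP.
Qed.

Lemma skcoef_Cl x a i : skcoef (C x * a) i = x * skcoef a i.
Proof.
rewrite skcoef_mul big_ord_recl subn0 big1 ?addr0 => [|j _]; last by rewrite skcoefC /= mul0r.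
by rewrite skcoefC.
Qed.

Lemma skcoef_Cr x a i : skcoef (a * C x) i = skcoef a i * iter i sigma x.
Proof.
rewrite skcoef_mul big_ord_recr /= subnn skcoefC /= big1 ?add0r // => j _.
by rewrite skcoefC subn_eq0 leqNgt ltn_ord /= iter_sigma0 mulr0.
Qed.

Lemma skcoefXn m i : skcoef (X ^+ m) i = (i == m)%:R.
Proof.
have -> : X ^+ m = C 1 * X ^+ m by rewrite [C 1](_ : _ = 1) ?mul1r.
by rewrite skew_monomE /skcoef coefZ mul1r coefXn.
Qed.

Lemma skcoef_Xnl m a k :
  skcoef (X ^+ m * a) k = if (k < m)%N then 0 else iter m sigma (skcoef a (k - m)).
Proof.
rewrite skcoef_mul; case: ltnP => [lt_km | le_mk].
  rewrite big1 // => j _; rewrite skcoefXn ltn_eqF ?mul0r //.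
  by rewrite (leq_trans (ltn_ord j)).
rewrite (bigD1 (Ordinal (le_mk : (m < k.+1)%N))) //= skcoefXn eqxx mul1r.
rewrite big1 ?addr0 // => j neq_j; rewrite skcoefXn.
have [Ej | _] := eqVneq (j : nat) m; last by rewrite mul0r.
by case/eqP: neq_j; apply: val_inj.
Qed.

Lemma skcoef_Xnr m a k :
  skcoef (a * X ^+ m) k = if (k < m)%N then 0 else skcoef a (k - m).
Proof.
rewrite skcoef_mul; case: ltnP => [lt_km | le_mk].
  rewrite big1 // => j _; rewrite skcoefXn ltn_eqF ?iter_sigma0 ?mulr0 //.
  by rewrite (leq_ltn_trans (leq_subr _ _)).
have lt_k : (k - m < k.+1)%N by rewrite ltnS leq_subr.
rewrite (bigD1 (Ordinal lt_k)) //= skcoefXn subKn // eqxx iter_sigma1 mulr1.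
rewrite big1 ?addr0 // => j neq_j; rewrite skcoefXn.
have [Ej | _] := eqVneq (k - j)%N m; last by rewrite iter_sigma0 mulr0.
by case/eqP: neq_j; apply: val_inj; rewrite /= -Ej subKn // -ltnS.
Qed.

Lemma skcoef_Xl a k : skcoef (X * a) k = if k is k'.+1 then sigma (skcoef a k') else 0.
Proof. by rewrite -[X]expr1 skcoef_Xnl; case: k => //= k; rewrite subSS subn0. Qed.

Lemma skcoef_Xr a k : skcoef (a * X) k = if k is k'.+1 then skcoef a k' else 0.
Proof. by rewrite -[X]expr1 skcoef_Xnr; case: k => //= k; rewrite subSS subn0. Qed.

Lemma sksizeXn m : sksize (X ^+ m) = m.+1.
Proof.
apply/eqP; rewrite eqn_leq; apply/andP; split.
  by apply/sksize_leqP => i lt_i; rewrite skcoefXn gtn_eqF.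
by apply: sksize_gt; rewrite skcoefXn eqxx oner_neq0.
Qed.

Lemma sksize1 : sksize 1 = 1%N.
Proof. by rewrite -[1](expr0 X) sksizeXn. Qed.

Lemma skXn_neq0 m : X ^+ m != 0.
Proof. by rewrite -sksize_eq0 sksizeXn. Qed.

Lemma skX_neq0 : X != 0.
Proof. by rewrite -[X]expr1 skXn_neq0. Qed.

Lemma sksizeX : sksize X = 2%N.
Proof. by rewrite -[X]expr1 sksizeXn. Qed.

Fact skewC_is_zmod_morphism : zmod_morphism C.
Proof. by move=> x y; apply: skcoefP => i; rewrite skcoefB !skcoefC; case: eqP; rewrite ?subr0. Qed.

Fact skewC_is_monoid_morphism : monoid_morphism C.
Proof.
split=> [|x y]; first by [].
by apply: skcoefP => i; rewrite skcoef_Cl !skcoefC; case: eqP; rewrite ?mulr0.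
Qed.

HB.instance Definition _ := GRing.isZmodMorphism.Build L R C skewC_is_zmod_morphism.
HB.instance Definition _ := GRing.isMonoidMorphism.Build L R C skewC_is_monoid_morphism.

Lemma skewC_inj : injective C.
Proof. by move=> x y /(congr1 (skcoef^~ 0%N)); rewrite !skcoefC. Qed.

Lemma skexpand a : a = \sum_(i < sksize a) C (skcoef a i) * X ^+ i.
Proof.
apply: skcoefP => k; rewrite skcoef_sum.
under eq_bigr => i _ do rewrite skcoef_Cl skcoefXn.
case: (ltnP k (sksize a)) => [lt_k | le_k].
  rewrite (bigD1 (Ordinal lt_k)) //= eqxx mulr1 big1 ?addr0 // => j neq_j.
  have [Ej | _] := eqVneq k (j : nat); last by rewrite mulr0.
  by case/eqP: neq_j; apply: val_inj.
rewrite skcoef_nil // big1 // => j _; rewrite gtn_eqF ?mulr0 //.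
exact: leq_trans le_k.
Qed.

Lemma skexpand_leq a m : (sksize a <= m)%N -> a = \sum_(i < m) C (skcoef a i) * X ^+ i.
Proof.
move=> le_am; rewrite {1}[a]skexpand.
rewrite (big_ord_widen m (fun i => C (skcoef a i) * X ^+ i)) // big_mkcond.
by apply: eq_bigr => i _; case: ltnP => // le_ai; rewrite skcoef_nil // rmorph0 mul0r.
Qed.

Lemma skX_C x : X * C x = C (sigma x) * X.
Proof. exact: skewX_skewC. Qed.

Lemma skXn_C m x : X ^+ m * C x = C (iter m sigma x) * X ^+ m.
Proof.
elim: m => [|m IH]; first by rewrite !expr0 mul1r mulr1.
by rewrite exprS -mulrA IH mulrA skX_C -mulrA.
Qed.

Lemma skew_div a b : b != 0 -> exists q r : R, a = q * b + r /\ (sksize r < sksize b)%N.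
Proof.
move=> nz_b; pose l := skcoef b (sksize b).-1.
have nz_l : l != 0 by apply: sklead_neq0.
pose b1 : R := C l^-1 * b.
have Eb1 : b = C l * b1 by rewrite mulrA -rmorphM mulfV // rmorph1 mul1r.
have nz_Cl : C l^-1 != 0 by rewrite -(rmorph0 C) (inj_eq skewC_inj) invr_eq0.
have szC : sksize (C l^-1) = 1%N.
  by apply/eqP; rewrite eqn_leq sksizeC_leq lt0n sksize_eq0.
have sz_b1 : sksize b1 = sksize b by rewrite sksize_mul // szC.
have mon_b1 : (b1 : {poly L}) \is monic.
  apply/monicP; rewrite lead_coefE.
  by rewrite -[RHS](mulVf nz_l) -(skcoef_Cl l^-1 b) -[_.-1]/((sksize b1).-1) sz_b1.
have [q Eq lt_r] := skew_rmodP a mon_b1.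
exists (q * C l^-1), (skew_rmod a b1).
by rewrite -mulrA -/b1 -sz_b1.
Qed.

End SkewCoefficients.

Arguments skcoef {L sigma} a i.
Arguments sksize {L sigma} a%_ring_scope.

(* Wedderburn's little theorem for a ring carried by a subset Z of a finite
   abelian group. *)
Section FiniteDomain.

Variables (V : finZmodType) (Z : pred V) (mul : V -> V -> V) (e : V).
Hypotheses (Z0 : Z 0) (ZB : forall x y, Z x -> Z y -> Z (x - y)).
Hypotheses (Ze : Z e) (ZM : forall x y, Z x -> Z y -> Z (mul x y)).
Hypothesis mulA : forall x y z, Z x -> Z y -> Z z -> mul x (mul y z) = mul (mul x y) z.
Hypothesis mul1x : forall x, Z x -> mul e x = x.
Hypothesis mulx1 : forall x, Z x -> mul x e = x.
Hypothesis mulDl : forall x y z, mul (x + y) z = mul x z + mul y z.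
Hypothesis mulDr : forall x y z, mul x (y + z) = mul x y + mul x z.
Hypothesis e_neq0 : e != 0.
Hypothesis mul_eq0 : forall x y, Z x -> Z y -> mul x y = 0 -> x = 0 \/ y = 0.

Local Notation T := {x : V | Z x}.

Let ZN x : Z x -> Z (- x).
Proof. by move=> Zx; rewrite -sub0r; apply: ZB. Qed.

Let ZD x y : Z x -> Z y -> Z (x + y).
Proof. by move=> Zx Zy; rewrite -[y]opprK; apply: ZB => //; apply: ZN. Qed.

Let zT : T := exist (fun v => is_true (Z v)) 0 Z0.
Let oT (x : T) : T := exist (fun v => is_true (Z v)) _ (ZN (svalP x)).
Let aT (x y : T) : T := exist (fun v => is_true (Z v)) _ (ZD (svalP x) (svalP y)).
Let eT : T := exist (fun v => is_true (Z v)) e Ze.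
Let mT (x y : T) : T := exist (fun v => is_true (Z v)) _ (ZM (svalP x) (svalP y)).

Lemma finite_domain_mulC x y : Z x -> Z y -> mul x y = mul y x.
Proof.
have aA : associative aT by move=> a b c; apply: val_inj; apply: addrA.
have aC : commutative aT by move=> a b; apply: val_inj; apply: addrC.
have a0 : left_id zT aT by move=> a; apply: val_inj; apply: add0r.
have aN : left_inverse zT oT aT by move=> a; apply: val_inj; apply: addNr.
pose T1 : zmodType := HB.pack T (GRing.isZmodule.Build T aA aC a0 aN).
have mA : @associative T1 mT.
  by move=> a b c; apply: val_inj; exact: (mulA (svalP (a : T)) (svalP (b : T)) (svalP (c : T))).
have m1 : @left_id T1 T1 eT mT by move=> a; apply: val_inj; exact: (mul1x (svalP (a : T))).
have m2 : @right_id T1 T1 eT mT by move=> a; apply: val_inj; exact: (mulx1 (svalP (a : T))).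
have mDl : @left_distributive T1 T1 mT +%R by move=> a b c; apply: val_inj; apply: mulDl.
have mDr : @right_distributive T1 T1 mT +%R by move=> a b c; apply: val_inj; apply: mulDr.
have e0 : eT != 0 :> T1 by apply: contra e_neq0 => /eqP/(congr1 val)/= ->.
pose T2 : finNzRingType := HB.pack T1 (Finite.on T)
  (GRing.Zmodule_isNzRing.Build T1 mA m1 m2 mDl mDr e0).
have dom (a b : T2) : a * b = 0 -> a = 0 \/ b = 0.
  move/(congr1 val) => /= ab0; have [a0'|b0'] := mul_eq0 (svalP (a : T)) (svalP (b : T)) ab0.
    by left; apply: val_inj.
  by right; apply: val_inj.
have regr (a : T2) : a != 0 -> injective ( *%R a).
  move=> nz_a b c /eqP; rewrite -subr_eq0 -mulrBr => /eqP/dom[/eqP|/eqP].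
    by rewrite (negPf nz_a).
  by rewrite subr_eq0 => /eqP.
(* [finDomain_mulrC] is stated for unit rings, so an inverse is extracted from finiteness: left
   multiplication by a nonzero element is injective, hence hits 1. *)
pose iv (a : T2) : T2 := if a == 0 then 0 else odflt 0 [pick b | a * b == 1].
have mV : {in [pred a : T2 | a != 0], right_inverse (1 : T2) iv *%R}.
  move=> a nz_a; rewrite /iv (negPf nz_a); case: pickP => [b /eqP // | no].
  by have := no (invF (regr a nz_a) 1); rewrite f_invF eqxx.
have mV' : {in [pred a : T2 | a != 0], left_inverse (1 : T2) iv *%R}.
  move=> a nz_a; have nz_v : iv a != 0.
    apply/eqP => iv0; have := mV a nz_a; rewrite iv0 mulr0 => /esym/eqP.
    by rewrite oner_eq0.
  by apply: (regr a nz_a); rewrite mulrA mV // mul1r mulr1.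
have unV (a b : T2) : b * a = 1 /\ a * b = 1 -> a != 0.
  by case=> _ ab1; apply/eqP => a0'; move/eqP: ab1; rewrite a0' mul0r eq_sym oner_eq0.
have iv0 : {in [predC [pred a : T2 | a != 0]], iv =1 id}.
  by move=> a; rewrite !inE negbK /iv => /eqP->; rewrite eqxx.
pose mixV := GRing.NzRing_hasMulInverse.Build T2 mV' mV unV iv0.
pose T3 : finUnitRingType := HB.pack (T2 : Type) T2 mixV.
have domT : GRing.integral_domain_axiom T3.
  by move=> a b ab0; case: (dom a b ab0) => ->; rewrite eqxx ?orbT.
move=> Zx Zy; have := finDomain_mulrC domT (exist _ x Zx) (exist _ y Zy).
by move/(congr1 val).
Qed.

End FiniteDomain.

(** * Modules over the skew polynomial ring *)

Section Action.

Variables (L : fieldType) (sigma : {rmorphism L -> L}).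
Local Notation R := (skewpoly sigma).

(** Kept as a predicate on a function rather than as a canonical structure, since the standard
    action of R and its twists live on the same group V. *)
Record skew_action (V : zmodType) (act : R -> V -> V) : Prop := SkewAction {
  sactDl : forall a b v, act (a + b) v = act a v + act b v;
  sactDr : forall a v w, act a (v + w) = act a v + act a w;
  sactM : forall a b v, act (a * b) v = act a (act b v);
  sact1 : forall v, act 1 v = v }.

Variables (V : zmodType) (act : R -> V -> V).
Hypothesis actV : skew_action act.

Lemma sact0l v : act 0 v = 0.
Proof. by apply: (addrI (act 0 v)); rewrite -sactDl // !addr0. Qed.

Lemma sact0r a : act a 0 = 0.
Proof. by apply: (addrI (act a 0)); rewrite -sactDr // !addr0. Qed.

Lemma sactNl a v : act (- a) v = - act a v.
Proof. by apply: (addrI (act a v)); rewrite -sactDl // !subrr sact0l. Qed.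

Lemma sactNr a v : act a (- v) = - act a v.
Proof. by apply: (addrI (act a v)); rewrite -sactDr // !subrr sact0r. Qed.

Lemma sactBl a b v : act (a - b) v = act a v - act b v.
Proof. by rewrite sactDl // sactNl. Qed.

Lemma sactBr a v w : act a (v - w) = act a v - act a w.
Proof. by rewrite sactDr // sactNr. Qed.

Lemma sact_suml I r (P : pred I) (h : I -> R) v :
  act (\sum_(i <- r | P i) h i) v = \sum_(i <- r | P i) act (h i) v.
Proof. exact: (big_morph (act^~ v) (fun a b => sactDl actV a b v) (sact0l v)). Qed.

Lemma sact_sumr I r (P : pred I) (h : I -> V) a :
  act a (\sum_(i <- r | P i) h i) = \sum_(i <- r | P i) act a (h i).
Proof. exact: (big_morph (act a) (sactDr actV a) (sact0r a)). Qed.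

Lemma sactC_inj x : x != 0 -> injective (act (skewC sigma x)).
Proof.
move=> nz_x v w /(congr1 (act (skewC sigma x^-1))).
by rewrite -!sactM // -rmorphM mulVf // rmorph1 !sact1.
Qed.

End Action.

(** * The simple module R/Rf *)

Section CyclicModule.

Variables (L : finFieldType) (sigma : {rmorphism L -> L}).
Local Notation R := (skewpoly sigma).
Local Notation C := (skewC sigma).
Local Notation X := (skewX sigma).
Variables (f : R) (r : nat).
Hypotheses (f_monic : (f : {poly L}) \is monic) (szf : sksize f = r.+1).
Local Notation V := {poly_r L}.

Definition vpoly (v : V) : R := (v : {poly L}).
Definition rmod (a : R) : V := npolyp r (skew_rmod a f : {poly L}).
(** R/Rf with classes represented by remainders. For [a] of degree < r this is the semifield
    product, so an autotopism becomes a relation between operators. *)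
Definition cyc_act (a : R) (v : V) : V := rmod (a * vpoly v).

Lemma sksize_vpoly v : (sksize (vpoly v) <= r)%N.
Proof. exact: size_npoly. Qed.

Lemma vpoly_inj : injective vpoly.
Proof. exact: val_inj. Qed.

Lemma vpolyD v w : vpoly (v + w) = vpoly v + vpoly w.
Proof. by []. Qed.

Lemma vpolyB v w : vpoly (v - w) = vpoly v - vpoly w.
Proof. by []. Qed.

Lemma vpoly0 : vpoly 0 = 0.
Proof. by []. Qed.

Definition npol (a : R) : V := npolyp r (a : {poly L}).

Lemma vpolyK : cancel vpoly npol.
Proof. by move=> v; apply: val_inj; apply: npolypK; apply: size_npoly. Qed.

Lemma npolK a : (sksize a <= r)%N -> vpoly (npol a) = a.
Proof. exact: npolypK. Qed.

Lemma rmodP a : exists c, a = c * f + vpoly (rmod a).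
Proof.
have [c Ec lt_c] := skew_rmodP a f_monic; exists c.
by rewrite /rmod /vpoly npolypK // -ltnS -szf.
Qed.

Lemma f_neq0 : f != 0.
Proof. by rewrite -sksize_eq0 szf. Qed.

Lemma rmod_uniq a c v : a = c * f + vpoly v -> rmod a = v.
Proof.
move=> Ea; have [d Ed] := rmodP a; apply: vpoly_inj; apply/eqP.
have E : (c - d) * f = vpoly (rmod a) - vpoly v.
  have Ed' : c * f + vpoly v = d * f + vpoly (rmod a) by rewrite -Ea.
  by apply/eqP; rewrite mulrBl subr_eq addrAC eq_sym subr_eq addrC Ed'.
have := sksize_vpoly (rmod a - v); rewrite vpolyB -E.
case: (eqVneq (c - d) 0) => [cd0 _ | nz_cd].
  by rewrite -subr_eq0 -E cd0 mul0r.
rewrite sksize_mul ?f_neq0 // szf addnS /= leqNgt -[X in (X < _)%N]add0n ltn_add2r.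
by rewrite lt0n sksize_eq0 nz_cd.
Qed.

Lemma rmod_vpoly v : rmod (vpoly v) = v.
Proof. by apply: (@rmod_uniq _ 0); rewrite mul0r add0r. Qed.

Lemma rmodMf a : rmod (a * f) = 0.
Proof. by apply: (@rmod_uniq _ a); rewrite vpoly0 addr0. Qed.

Lemma rmodD a b : rmod (a + b) = rmod a + rmod b.
Proof.
have [c Ec] := rmodP a; have [d Ed] := rmodP b.
by apply: (@rmod_uniq _ (c + d)); rewrite {1}Ec {1}Ed vpolyD mulrDl addrACA.
Qed.

Lemma rmodM a b : rmod (a * vpoly (rmod b)) = rmod (a * b).
Proof.
by have [c Ec] := rmodP b; rewrite {2}Ec mulrDr rmodD mulrA rmodMf add0r.
Qed.

Lemma cyc_action : skew_action cyc_act.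
Proof.
split=> [a b v | a v w | a b v | v]; rewrite /cyc_act.
- by rewrite mulrDl rmodD.
- by rewrite vpolyD mulrDr rmodD.
- by rewrite rmodM mulrA.
- by rewrite mul1r rmod_vpoly.
Qed.

Lemma cyc_rmod a b : cyc_act a (rmod b) = rmod (a * b).
Proof. exact: rmodM. Qed.

(** Euclid's algorithm by division on the right: [d] generates the left ideal Ra + Rb. *)
Lemma skew_bezout (a b : R) : exists d x y a' b' : R,
  [/\ d = x * a + y * b, a = a' * d & b = b' * d].
Proof.
have [m] := ubnP (sksize b); elim: m a b => // m IH a b; rewrite ltnS => le_b.
have [-> | nz_b] := eqVneq b 0.
  by exists a, 1, 0, 1, 0; rewrite mul1r mulr0 addr0 mul0r.
have [q [t [Ea lt_t]]] := skew_div a nz_b.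
have [d [x [y [b' [t' [Ed Eb Et]]]]]] := IH b t (leq_trans lt_t le_b).
exists d, y, (x - y * q), (q * b' + t'), b'; split=> //.
  by rewrite Ed Ea mulrDr mulrBl mulrA [RHS]addrC addrA subrK.
by rewrite mulrDl -mulrA -Eb -Et.
Qed.

Hypothesis f_irr : irreducible_elt f.

Lemma unit_sksize (a : R) : ring_unit a -> sksize a = 1%N.
Proof.
case=> b [ba1 _]; have nz_ba : b * a != 0 by rewrite ba1 oner_neq0.
move: nz_ba; rewrite skmul_eq0 negb_or => /andP[nz_b nz_a].
have := sksize_mul nz_b nz_a; rewrite ba1 sksize1.
have : (0 < sksize a)%N by rewrite lt0n sksize_eq0.
have : (0 < sksize b)%N by rewrite lt0n sksize_eq0.
lia.
Qed.

Lemma degf_gt0 : (0 < r)%N.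
Proof.
rewrite lt0n; apply/negP => /eqP r0; case: f_irr => _ nu _; apply: nu.
have sf : (sksize f <= 1)%N by rewrite szf r0.
have Ef := sksize_leq1 sf; have nz : skcoef f 0 != 0.
  by apply/negP => /eqP f0; have := f_neq0; rewrite Ef f0 rmorph0 eqxx.
exists (C (skcoef f 0)^-1); by rewrite Ef -!rmorphM skcoefC eqxx mulVf ?mulfV.
Qed.

Lemma vpoly_one : vpoly (rmod 1) = 1.
Proof. by rewrite -[X in rmod X](@npolK 1) ?rmod_vpoly ?npolK // sksize1 degf_gt0. Qed.

Lemma vone_neq0 : rmod 1 != 0.
Proof.
apply/negP => /eqP/(congr1 vpoly); rewrite vpoly_one vpoly0.
by apply/eqP; rewrite oner_neq0.
Qed.

Lemma cyc_one a : cyc_act a (rmod 1) = rmod a.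
Proof. by rewrite cyc_rmod mulr1. Qed.

Lemma cyc_vone v : cyc_act (vpoly v) (rmod 1) = v.
Proof. by rewrite cyc_one rmod_vpoly. Qed.

(** Let [d] generate Rv + Rf, with f = b' d. If b' is a unit then deg d = deg f > deg v, although
    [d] divides v on the right. So [d] is a unit, and the Bezout relation modulo f inverts v. *)
Lemma cyc_simple v : v != 0 -> exists a, cyc_act a v = rmod 1.
Proof.
move=> nz_v; have [d [x [y [a' [b' [Ed Ev Ef]]]]]] := skew_bezout (vpoly v) f.
have nz_v' : vpoly v != 0 by apply: contra nz_v => /eqP v0; apply/eqP/vpoly_inj.
case: f_irr => _ _ /(_ _ _ Ef) [/unit_sksize sb | [e [ed1 _]]].
  have nz_d : d != 0 by apply: contra nz_v' => /eqP d0; rewrite Ev d0 mulr0.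
  have nz_a : a' != 0 by apply: contra nz_v' => /eqP a0; rewrite Ev a0 mul0r.
  have nz_b : b' != 0 by rewrite -sksize_eq0 sb.
  have := sksize_mul nz_b nz_d; rewrite -Ef sb szf => Es.
  have := sksize_vpoly v; rewrite Ev sksize_mul //.
  have : (0 < sksize a')%N by rewrite lt0n sksize_eq0.
  lia.
by exists (e * x); rewrite /cyc_act -ed1 Ed mulrDr !mulrA rmodD rmodMf addr0.
Qed.

End CyclicModule.

Arguments vpoly {L sigma r} v.
Arguments npol {L sigma r} a.
Arguments rmod {L sigma} f r a.
Arguments cyc_act {L sigma} f {r} a v.
Arguments sksize_vpoly {L sigma r} v.
Arguments vpoly_inj {L sigma r} [x1 x2].

Section TwistedPowers.

Variables (L : finFieldType) (sigma : {rmorphism L -> L}).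
Local Notation R := (skewpoly sigma).
Local Notation C := (skewC sigma).
Local Notation X := (skewX sigma).

(** For [i = n] this is the norm from L to K; the partial products are the coefficients in the
    powers of the operator [C x * X]. *)
Definition skew_norm (i : nat) (x : L) : L := \prod_(j < i) iter j sigma x.

Lemma skew_normS i x : skew_norm i.+1 x = x * sigma (skew_norm i x).
Proof. by rewrite /skew_norm big_ord_recl rmorph_prod. Qed.

Lemma skew_norm_neq0 i x : x != 0 -> skew_norm i x != 0.
Proof.
move=> nz_x; elim: i => [|i IH]; first by rewrite /skew_norm big_ord0 oner_neq0.
by rewrite skew_normS mulf_neq0 // fmorph_eq0.
Qed.

Lemma skew_powCX i x : (C x * X) ^+ i = C (skew_norm i x) * X ^+ i.
Proof.
elim: i => [|i IH]; first by rewrite /skew_norm big_ord0 !expr0 rmorph1 mulr1.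
by rewrite exprS IH mulrA -(mulrA (C x)) skX_C skew_normS rmorphM !mulrA -mulrA -exprS.
Qed.

Lemma skX_twist (a : R) : exists b : R,
  [/\ X * a = b * X, (sksize b <= sksize a)%N & forall i, skcoef b i = sigma (skcoef a i)].
Proof.
pose b : R := \poly_(i < sksize a) sigma (skcoef a i).
have Eb i : skcoef b i = sigma (skcoef a i).
  rewrite /skcoef coef_poly; case: ltnP => // le_ai.
  by rewrite -[_`_i]/(skcoef a i) skcoef_nil ?rmorph0.
exists b; split=> //; last exact: size_poly.
by apply: skcoefP => -[|i]; rewrite skcoef_Xl skcoef_Xr ?Eb.
Qed.

Lemma npolD s (a b : R) : npol (a + b) = npol a + npol b :> {poly_s L}.
Proof.
apply: val_inj; apply/polyP => i; rewrite coefD !coef_npolyp coefD.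
by case: ifP; rewrite ?addr0.
Qed.

End TwistedPowers.

Section SemilinearScalars.

Variables (L : finFieldType) (sigma : {rmorphism L -> L}) (V : zmodType).
Local Notation R := (skewpoly sigma).
Local Notation C := (skewC sigma).
Variables (act : R -> V -> V) (eta : V -> V) (t : L -> L).
Hypotheses (actV : skew_action act) (V_neq0 : exists v : V, v != 0).
Hypothesis etaD : forall v w, eta (v + w) = eta v + eta w.
Hypotheses (eta_inj : injective eta).
Hypothesis eta_t : forall x v, eta (act (C x) v) = act (C (t x)) (eta v).

Lemma sact_scalar_inj x y v : v != 0 -> act (C x) v = act (C y) v -> x = y.
Proof.
move=> nz_v /eqP; rewrite -subr_eq0 -(sactBl actV) -rmorphB => /eqP xy0.
apply/eqP; rewrite -subr_eq0; apply: contraLR nz_v => nz_xy; rewrite negbK.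
by apply/eqP; apply: (sactC_inj actV nz_xy); rewrite xy0 (sact0r actV).
Qed.

Let eta0 : eta 0 = 0.
Proof. by apply: (addrI (eta 0)); rewrite -etaD !addr0. Qed.

Let exv : exists2 v, v != 0 & eta v != 0.
Proof. by have [v nz_v] := V_neq0; exists v; rewrite // -eta0 (inj_eq eta_inj). Qed.

(** Here [t] is a bare function known only through eta. A scalar is determined by its effect on one
    nonzero vector, so the module laws force the laws of a field automorphism on [t]. *)
Lemma semilinD x y : t (x + y) = t x + t y.
Proof.
have [v _ nz_v] := exv; apply: sact_scalar_inj nz_v _.
by rewrite -eta_t !rmorphD !(sactDl actV) etaD !eta_t.
Qed.

Lemma semilinM x y : t (x * y) = t x * t y.
Proof.
have [v _ nz_v] := exv; apply: sact_scalar_inj nz_v _.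
by rewrite -eta_t !rmorphM !(sactM actV) !eta_t.
Qed.

Lemma semilin1 : t 1 = 1.
Proof.
have [v _ nz_v] := exv; apply: sact_scalar_inj nz_v _.
by rewrite -eta_t !rmorph1 !(sact1 actV).
Qed.

Lemma semilin_inj : injective t.
Proof.
move=> x y txy; have [v nz_v _] := exv; apply: sact_scalar_inj nz_v _.
by apply: eta_inj; rewrite !eta_t txy.
Qed.

Lemma semilinX x i : t (x ^+ i) = t x ^+ i.
Proof. by elim: i => [|i IH]; rewrite ?semilin1 // !exprS semilinM IH. Qed.

Lemma semilin_surj y : exists x, t x = y.
Proof. by exists (invF semilin_inj y); rewrite f_invF. Qed.

End SemilinearScalars.

(* A scalar action l and an operator x with x l_y = l_(sigma y) x make V an
   R-module. *)
Section OperatorAction.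

Variables (L : fieldType) (sigma : {rmorphism L -> L}) (V : zmodType).
Local Notation R := (skewpoly sigma).
Variables (l : L -> V -> V) (x : V -> V).
Hypotheses (lDl : forall y z v, l (y + z) v = l y v + l z v)
  (lDr : forall y v w, l y (v + w) = l y v + l y w)
  (lM : forall y z v, l (y * z) v = l y (l z v)) (l1 : forall v, l 1 v = v)
  (xD : forall v w, x (v + w) = x v + x w)
  (xl : forall y v, x (l y v) = l (sigma y) (x v)).

Definition op_act (a : R) (v : V) : V :=
  \sum_(i < sksize a) l (skcoef a i) (iter i x v).

Let l0 v : l 0 v = 0.
Proof. by apply: (addrI (l 0 v)); rewrite -lDl !addr0. Qed.

Let x0 : x 0 = 0.
Proof. by apply: (addrI (x 0)); rewrite -xD !addr0. Qed.

Let ly0 y : l y 0 = 0.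
Proof. by apply: (addrI (l y 0)); rewrite -lDr !addr0. Qed.

Lemma op_act_widen m a v : (sksize a <= m)%N ->
  op_act a v = \sum_(i < m) l (skcoef a i) (iter i x v).
Proof.
move=> le_am; rewrite /op_act (big_ord_widen m (fun i => l (skcoef a i) (iter i x v))) //.
rewrite big_mkcond; apply: eq_bigr => i _; case: ltnP => // le_ai.
by rewrite skcoef_nil // l0.
Qed.

Lemma op_actC y v : op_act (skewC sigma y) v = l y v.
Proof. by rewrite (op_act_widen _ (sksizeC_leq _ _)) big_ord1 skcoefC. Qed.

Lemma op_actX v : op_act (skewX sigma) v = x v.
Proof.
rewrite (@op_act_widen 2) ?sksizeX // !big_ord_recl big_ord0 addr0 /=.
by rewrite -[skewX _]expr1 !skcoefXn /= l0 add0r l1.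
Qed.

Lemma op_act_action : skew_action op_act.
Proof.
have itD i v w : iter i x (v + w) = iter i x v + iter i x w.
  by elim: i => //= i ->; rewrite xD.
have itl i y v : iter i x (l y v) = l (iter i sigma y) (iter i x v).
  by elim: i => //= i ->; rewrite xl.
have aDl a b v : op_act (a + b) v = op_act a v + op_act b v.
  pose m := maxn (sksize a) (sksize b).
  rewrite !(@op_act_widen m) ?leq_maxl ?leq_maxr //; last first.
    by apply: sksizeD; rewrite ?leq_maxl ?leq_maxr.
  by rewrite -big_split; apply: eq_bigr => i _; rewrite skcoefD lDl.
have aDr a v w : op_act a (v + w) = op_act a v + op_act a w.
  by rewrite /op_act -big_split; apply: eq_bigr => i _; rewrite itD lDr.
have a1 v : op_act 1 v = v by rewrite -(rmorph1 (skewC sigma)) op_actC l1.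
split=> // a b v.
have a0 w : op_act 0 w = 0 by apply: (addrI (op_act 0 w)); rewrite -aDl !addr0.
have aC y c w : op_act (skewC sigma y * c) w = l y (op_act c w).
  rewrite (@op_act_widen (sksize c)); last first.
    by apply/sksize_leqP => i le_i; rewrite skcoef_Cl skcoef_nil ?mulr0.
  rewrite /op_act (big_morph (l y) (lDr y) (ly0 y)).
  by apply: eq_bigr => i _; rewrite skcoef_Cl lM.
have aX c w : op_act (skewX sigma * c) w = x (op_act c w).
  rewrite (@op_act_widen (sksize c).+1); last first.
    by apply/sksize_leqP => -[|i] le_i; rewrite skcoef_Xl // skcoef_nil ?rmorph0.
  rewrite big_ord_recl skcoef_Xl l0 add0r /op_act (big_morph x xD x0).
  by apply: eq_bigr => i _; rewrite skcoef_Xl xl.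
have aXi i c w : op_act (skewX sigma ^+ i * c) w = iter i x (op_act c w).
  by elim: i => [|i IH]; rewrite ?expr0 ?mul1r // exprS -mulrA aX IH.
rewrite {1}[a]skexpand mulr_suml.
rewrite (big_morph (op_act^~ v) (fun a b => aDl a b v) (a0 v)).
by apply: eq_bigr => i _; rewrite -mulrA aC aXi.
Qed.

End OperatorAction.

(** * The cyclic algebra R/RF(X^n) *)

Section CyclicAlgebra.

Variables (K L : finFieldType) (kappa : {rmorphism K -> L}).
Variables (sigma : {rmorphism L -> L}) (n : nat).
Hypothesis n_gt1 : (1 < n)%N.
Hypothesis sigma_fixK : forall c, sigma (kappa c) = kappa c.
Hypothesis sigma_fixed : forall x, sigma x = x -> exists c, x = kappa c.
Hypothesis sigma_n : forall x, iter n sigma x = x.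
Hypothesis sigma_order : forall i, (forall x, iter i sigma x = x) -> (n %| i)%N.

Local Notation R := (skewpoly sigma).
Local Notation C := (skewC sigma).
Local Notation X := (skewX sigma).
Implicit Types (a b : R) (P Q : {poly K}).

Let n_gt0 : (0 < n)%N := ltnW n_gt1.

Lemma iter_sigma_fixK i c : iter i sigma (kappa c) = kappa c.
Proof. by elim: i => //= i ->. Qed.

Lemma iter_sigma_mod i x : iter i sigma x = iter (i %% n) sigma x.
Proof.
rewrite {1}(divn_eq i n) addnC iterD; congr iter.
by elim: (i %/ n)%N => // j IH; rewrite mulSn iterD IH sigma_n.
Qed.

Lemma iter_sigma_dvd i x : (n %| i)%N -> iter i sigma x = x.
Proof. by rewrite iter_sigma_mod => /eqP->. Qed.

Lemma iter_sigma_inj i : injective (iter i sigma).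
Proof. by elim: i => //= i IH x y /fmorph_inj/IH. Qed.

Lemma iter_sigma_eqmod i j :
  (forall x, iter i sigma x = iter j sigma x) -> i = j %[mod n].
Proof.
wlog le_ij : i j / (i <= j)%N.
  by move=> W E; case: (leqP i j) => [/W-> // | /ltnW/W->].
move=> E; apply/esym/eqP; rewrite eqn_mod_dvd //; apply: sigma_order => x.
by apply: (@iter_sigma_inj i); rewrite -iterD subnKC.
Qed.

Fact Xn_comm : commr_rmorph (C \o kappa) (X ^+ n).
Proof. by move=> c; rewrite /GRing.comm /= skXn_C iter_sigma_fixK. Qed.

(** The substitution Y -> X^n, whose image is the centre of R: [cpoly_central] and [cpoly_of_comm]
    give the two inclusions. *)
Definition cpoly : {rmorphism {poly K} -> R} := horner_morph Xn_comm.

Lemma cpolyC c : cpoly c%:P = C (kappa c).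
Proof. exact: (horner_morphC Xn_comm). Qed.

Lemma cpolyX : cpoly 'X = X ^+ n.
Proof. exact: (horner_morphX Xn_comm). Qed.

Lemma cpolyE P : cpoly P = \sum_(i < size P) C (kappa P`_i) * X ^+ (n * i).
Proof.
rewrite -{1}[P]coefK poly_def rmorph_sum; apply: eq_bigr => i _.
by rewrite -mul_polyC rmorphM rmorphXn cpolyC cpolyX -exprM.
Qed.

Lemma skcoef_cpoly P i :
  skcoef (cpoly P) i = if (n %| i)%N then kappa P`_(i %/ n) else 0.
Proof.
rewrite cpolyE skcoef_sum.
under eq_bigr => j _ do rewrite skcoef_Cl skcoefXn.
case: ifPn => [/dvdnP[k ->] | ndvd_i]; last first.
  rewrite big1 // => j _; case: eqP ndvd_i => [->|_ _]; last by rewrite mulr0.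
  by rewrite dvdn_mulr.
rewrite mulnK //; case: (ltnP k (size P)) => [lt_k | le_k].
  rewrite (bigD1 (Ordinal lt_k)) //= mulnC eqxx mulr1 big1 ?addr0 // => j neq_j.
  have [Ej | _] := eqVneq (n * k)%N (n * j)%N; last by rewrite mulr0.
  case/eqP: neq_j; apply: val_inj; apply/eqP.
  by rewrite /= -(eqn_pmul2l n_gt0) Ej.
rewrite nth_default // rmorph0 big1 // => j _; rewrite mulnC eqn_pmul2l //.
by rewrite gtn_eqF ?mulr0 // (leq_trans (ltn_ord j)).
Qed.

Lemma cpoly_central P a : cpoly P * a = a * cpoly P.
Proof.
have CE x : cpoly P * C x = C x * cpoly P.
  apply: skcoefP => i; rewrite skcoef_Cl skcoef_Cr skcoef_cpoly.
  by case: ifP => [dv_i|_]; rewrite ?(mulr0, mul0r) // iter_sigma_dvd // mulrC.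
have XE : cpoly P * X = X * cpoly P.
  apply: skcoefP => -[|i]; rewrite skcoef_Xl skcoef_Xr //= skcoef_cpoly.
  by case: ifP; rewrite ?rmorph0 ?sigma_fixK.
have XnE i : cpoly P * X ^+ i = X ^+ i * cpoly P.
  by elim: i => [|i IH]; [by rewrite mulr1 mul1r | by rewrite exprS mulrA XE -!mulrA IH].
rewrite [a]skexpand mulr_sumr mulr_suml; apply: eq_bigr => i _.
by rewrite mulrA CE -mulrA XnE mulrA.
Qed.

Lemma sksize_cpoly P : P != 0 -> sksize (cpoly P) = (n * (size P).-1).+1.
Proof.
move=> nz_P; apply/eqP; rewrite eqn_leq; apply/andP; split.
  apply/sksize_leqP => i lt_i; rewrite skcoef_cpoly; case: ifP => // /dvdnP[k Ei].
  rewrite Ei mulnK // nth_default ?rmorph0 //.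
  by move: lt_i; rewrite Ei mulnC ltn_pmul2r // prednK // size_poly_gt0.
apply: sksize_gt; rewrite skcoef_cpoly dvdn_mulr // mulKn // fmorph_eq0.
by rewrite -lead_coefE lead_coef_eq0.
Qed.

Lemma cpoly_eq0 P : (cpoly P == 0) = (P == 0).
Proof.
apply/eqP/eqP => [P0 | ->]; last exact: rmorph0.
by apply/eqP/contraT => /sksize_cpoly; rewrite P0 sksize0.
Qed.

Lemma cpoly_inj : injective cpoly.
Proof. by move=> P Q /eqP; rewrite -subr_eq0 -rmorphB cpoly_eq0 subr_eq0 => /eqP. Qed.

Lemma skewC_eq_cpoly x P : C x = cpoly P -> exists c, x = kappa c.
Proof.
move=> E; exists P`_0; have := congr1 (skcoef^~ 0%N) E.
by rewrite skcoefC skcoef_cpoly dvdn0 div0n.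
Qed.

(* Commuting with the scalars forces the support into multiples of n, commuting
   with X forces the coefficients into K. *)
Lemma cpoly_of_comm a :
  (forall x, a * C x = C x * a) -> a * X = X * a -> exists P, a = cpoly P.
Proof.
move=> aC aX; have fix_a i : sigma (skcoef a i) = skcoef a i.
  by have := congr1 (skcoef^~ i.+1) aX; rewrite skcoef_Xl skcoef_Xr.
have supp i : skcoef a i != 0 -> (n %| i)%N.
  move=> nz; apply: sigma_order => x; apply: (mulfI nz).
  by have := congr1 (skcoef^~ i) (aC x); rewrite skcoef_Cl skcoef_Cr => ->; exact: mulrC.
have exc i : exists c, skcoef a i == kappa c.
  by have [c Ec] := sigma_fixed (fix_a i); exists c; apply/eqP.
exists (\poly_(i < sksize a) xchoose (exc (n * i)%N)).
apply: skcoefP => i; rewrite skcoef_cpoly; case: ifPn => [/dvdnP[k ->] | ndvd]; last first.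
  by apply/eqP; apply: contraR ndvd => /supp.
rewrite mulnK // coef_poly mulnC; case: ltnP => [_ | le_k].
  exact/eqP/(xchooseP (exc (n * k)%N)).
by rewrite rmorph0 skcoef_nil // (leq_trans le_k) // leq_pmull.
Qed.

Variables (F : {poly K}) (s : nat).
Hypotheses (F_monic : F \is monic) (F_irr : irreducible_poly F).
Hypotheses (s_gt1 : (1 < s)%N) (szF : size F = s.+1).

Lemma irred_coef0_neq0 : F`_0 != 0.
Proof.
apply/negP => /eqP F0.
have dvX : 'X %| F by rewrite -['X]subr0 -polyC0 dvdp_XsubCl rootE horner_coef0 F0.
have := F_irr.2 'X; rewrite size_polyX => /(_ isT dvX) /eqp_size.
by rewrite size_polyX szF; case: (s) s_gt1 => [|[]].
Qed.

Lemma sksize_cF : sksize (cpoly F) = (n * s).+1.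
Proof. by rewrite sksize_cpoly ?monic_neq0 // szF. Qed.

(** * Two-sided ideals containing F(X^n) *)

Section TwoSidedIdeal.

Variable J : pred R.
Hypothesis JD : forall a b, J a -> J b -> J (a + b).
Hypothesis JMl : forall a b, J b -> J (a * b).
Hypothesis JMr : forall a b, J a -> J (a * b).
Hypotheses (JF : J (cpoly F)) (J1 : ~~ J 1).

Let JB a b : J a -> J b -> J (a - b).
Proof. by move=> Ja Jb; apply: JD => //; rewrite -mulN1r; apply: JMl. Qed.

(* A monic t of least degree in J satisfies t x = sigma^(deg t)(x) t and
   t X = X t. Its constant term is nonzero since F(0) is, so n divides deg t and
   t is a central polynomial P(X^n) with P | F. *)
Lemma two_sided_ideal a : J a -> exists c, a = c * cpoly F.
Proof.
have nzF : F != 0 by apply: monic_neq0.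
have exJ : exists m, [exists t : {poly_m L}, ((t : {poly L}) != 0) && J (t : {poly L})].
  exists (sksize (cpoly F)); apply/existsP.
  exists (NPoly (leqnn _ : (cpoly F : {poly L}) \is a poly_of_size _)).
  by apply/andP; split; [have := cpoly_eq0 F; rewrite (negPf nzF) => /negbT | ].
case: (ex_minnP exJ) => m /existsP[t0 /andP[nz_t0 Jt0]] min_m.
have small b : J b -> (sksize b < m)%N -> b = 0.
  move=> Jb lt_b; apply/eqP; apply: contraLR lt_b => nz_b; rewrite -leqNgt.
  apply: min_m; apply/existsP.
  by exists (NPoly (leqnn _ : (b : {poly L}) \is a poly_of_size _)); apply/andP.
pose tt : R := (t0 : {poly L}).
have sz_t0 : sksize tt = m.
  apply/eqP; rewrite eqn_leq [X in X && _]size_npoly leqNgt; apply/negP => lt.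
  by case/eqP: nz_t0; apply: (small tt).
pose l := skcoef tt m.-1.
have nz_l : l != 0 by rewrite /l -sz_t0 sklead_neq0.
pose t : R := C l^-1 * tt.
have Jt : J t by apply: JMl.
have m_gt0 : (0 < m)%N by rewrite -sz_t0 lt0n sksize_eq0.
have nz_t : t != 0.
  by rewrite skmul_eq0 negb_or nz_t0 andbT -(rmorph0 C) (inj_eq (@skewC_inj _ _)) invr_eq0.
have t_lead : skcoef t m.-1 = 1 by rewrite skcoef_Cl mulVf.
have sz_t : sksize t = m.
  apply/eqP; rewrite eqn_leq; apply/andP; split; last first.
    by rewrite -[m in X in (X <= _)%N](prednK m_gt0); apply: sksize_gt; rewrite t_lead oner_neq0.
  apply/sksize_leqP => i le_i; rewrite skcoef_Cl skcoef_nil ?mulr0 //.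
  by rewrite sz_t0.
have dv b : J b -> exists c, b = c * t.
  move=> Jb; have [c [r [Eb lt_r]]] := skew_div b nz_t.
  exists c; rewrite Eb (small r) ?addr0 //; last by rewrite -sz_t.
  have -> : r = b - c * t by rewrite Eb addrC addKr.
  by apply: JB => //; apply: JMl.
have t_scal x : t * C x = C (iter m.-1 sigma x) * t.
  apply/eqP; rewrite -subr_eq0; apply/eqP; apply: small.
    by apply: JB; [apply: JMr | apply: JMl].
  rewrite -[X in (_ < X)%N](prednK m_gt0) ltnS.
  apply/sksize_leqP => i; rewrite leq_eqVlt => /orP[/eqP<- | lt_i].
    by rewrite skcoefB skcoef_Cl skcoef_Cr t_lead mul1r mulr1 subrr.
  rewrite skcoefB skcoef_Cl skcoef_Cr (@skcoef_nil _ _ t) ?(mulr0, mul0r) ?subr0 //.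
  by rewrite sz_t -(prednK m_gt0).
have supp i : skcoef t i != 0 -> i = m.-1 %[mod n].
  move=> nz; apply: iter_sigma_eqmod => x; apply: (mulfI nz).
  by have := congr1 (skcoef^~ i) (t_scal x); rewrite skcoef_Cl skcoef_Cr => ->; exact: mulrC.
have t_X : t * X = X * t.
  apply/eqP; rewrite -subr_eq0; apply/eqP; apply: small.
    by apply: JB; [apply: JMr | apply: JMl].
  rewrite -[X in (_ < X)%N](prednK m_gt0) ltnS.
  apply/sksize_leqP => -[|i]; rewrite skcoefB skcoef_Xl skcoef_Xr ?subrr // leq_eqVlt.
  case/orP=> [/eqP Ei | lt_i]; last first.
    rewrite ltnS in lt_i; move: lt_i; rewrite leq_eqVlt => /orP[/eqP<- | lt_i].
      by rewrite t_lead rmorph1 subrr.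
    rewrite skcoef_nil ?rmorph0 ?subrr // sz_t -(prednK m_gt0) //.
  (* The coefficient left over sits just below the leading one. Were it nonzero, two consecutive
     degrees would be congruent modulo n, impossible for n > 1. *)
  have [-> | /supp] := eqVneq (skcoef t i) 0; first by rewrite rmorph0 subrr.
  rewrite Ei -addn1 -[in LHS](addn0 i) => /eqP; rewrite eqn_modDl mod0n.
  by rewrite modn_small.
have [z EF] := dv _ JF.
have t0_neq0 : skcoef t 0 != 0.
  apply: contra irred_coef0_neq0 => /eqP t00; have := congr1 (skcoef^~ 0%N) EF.
  rewrite skcoef_cpoly dvdn0 div0n skcoef_mul big_ord1 subnn t00 iter_sigma0 mulr0.
  by move/eqP; rewrite fmorph_eq0.
have m_dvd : (n %| m.-1)%N by have /esym/eqP := supp _ t0_neq0; rewrite mod0n.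
have [P EP] : exists P, t = cpoly P.
  by apply: cpoly_of_comm t_X => x; rewrite t_scal iter_sigma_dvd.
have nz_P : P != 0 by rewrite -cpoly_eq0 -EP.
(* Divisibility in R descends to K[Y]: otherwise the image of [F %% P] would be a nonzero multiple
   of the image of P, of smaller degree. *)
have dvPF : P %| F.
  rewrite /dvdp; apply: contraT => nz_r.
  have Er : (z - cpoly (F %/ P)) * cpoly P = cpoly (F %% P).
    by rewrite mulrBl -rmorphM -EP -EF -rmorphB {1}(divp_eq F P) addrC addKr.
  have nz_q : z - cpoly (F %/ P) != 0.
    by apply: contra nz_r => /eqP q0; move: Er; rewrite q0 mul0r => /esym/eqP; rewrite cpoly_eq0.
  have := sksize_mul nz_q (_ : cpoly P != 0); rewrite cpoly_eq0 => /(_ nz_P).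
  rewrite Er !sksize_cpoly // addnS /= => Es.
  have lt1 : ((size P).-1 <= (size (F %% P)%R).-1)%N.
    rewrite -(leq_pmul2l n_gt0) -ltnS Es -[X in (X < _)%N]add0n -addSn leq_add2r.
    by rewrite lt0n sksize_eq0.
  have := ltn_modp F P; rewrite nz_P => lt2.
  have sr : (0 < size (F %% P)%R)%N by rewrite size_poly_gt0.
  by move: lt1; rewrite leqNgt; case/negP; rewrite -ltnS !prednK // (leq_trans _ lt2).
have nsz1 : size P != 1%N.
  apply: contra J1 => /size_poly1P[c nz_c Ec].
  have := JMl (C (kappa c^-1)) Jt; rewrite EP Ec cpolyC -rmorphM -rmorphM mulVf //.
  by rewrite !rmorph1.
have /eqpP[[c1 c2] /= /andP[nz1 nz2] Ec] := F_irr.2 P nsz1 dvPF.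
move=> Ja; have [d Ed] := dv a Ja; exists (d * C (kappa (c2 / c1))).
rewrite Ed EP -mulrA -cpolyC -rmorphM; congr (_ * cpoly _).
by rewrite mul_polyC -[c2 / c1]mulrC -scalerA -Ec scalerA mulVf ?scale1r.
Qed.

End TwoSidedIdeal.

Section FaithfulAction.

Variables (V : finZmodType) (act : R -> V -> V).
Hypothesis actV : skew_action act.
Hypothesis actF : forall v, act (cpoly F) v = 0.
Hypothesis V_neq0 : exists v : V, v != 0.

Lemma sact_ker a : (forall v, act a v = 0) -> exists c, a = c * cpoly F.
Proof.
move=> a0; pose J (b : R) := [forall v, act b v == 0].
have JP b : reflect (forall v, act b v = 0) (J b) by apply: (iffP forallP) => h v; apply/eqP.
apply: (two_sided_ideal (J := J)).
- by move=> b c /JP b0 /JP c0; apply/JP => v; rewrite sactDl // b0 c0 addr0.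
- by move=> b c /JP c0; apply/JP => v; rewrite sactM // c0 sact0r.
- by move=> b c /JP b0; apply/JP => v; rewrite sactM // b0.
- exact/JP.
- have [v nz_v] := V_neq0; apply/negP => /JP/(_ v).
  by rewrite sact1 // => /eqP; apply/negP.
- exact/JP.
Qed.

(** An operator vanishing on V is a multiple of F(X^n), so it is 0 or has size above [n * s]. *)
Lemma sact_faithful a : (sksize a <= n * s)%N -> (forall v, act a v = 0) -> a = 0.
Proof.
move=> sz_a /sact_ker[c Ea]; apply/eqP; apply: contraLR sz_a => nz_a.
have nz_c : c != 0 by apply: contra nz_a => /eqP c0; rewrite Ea c0 mul0r.
rewrite Ea sksize_mul // -?sksize_eq0 ?sksize_cF // addnS /= -ltnNge -addn1 addnC.
by rewrite leq_add2r lt0n sksize_eq0.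
Qed.

Lemma sact_inj a b : (sksize a <= n * s)%N -> (sksize b <= n * s)%N ->
  (forall v, act a v = act b v) -> a = b.
Proof.
move=> sa sb eq_ab; apply/eqP; rewrite -subr_eq0; apply/eqP.
by apply: sact_faithful => [|v]; [apply: sksizeB | rewrite sactBl // eq_ab subrr].
Qed.

(* F(X^n) = F(0) + (...) X^n is zero on V while F(0) is invertible. *)
Lemma sactX_inj : injective (act X).
Proof.
move=> v w /eqP; rewrite -subr_eq0 -sactBr // => /eqP Xvw.
apply/eqP; rewrite -subr_eq0; apply/eqP; move: (v - w) Xvw => z Xz {v w}.
have : act (cpoly F) z = 0 by apply: actF.
rewrite cpolyE szF big_ord_recl muln0 expr0 mulr1 sactDl // sact_suml // big1 => [|i _].
  rewrite addr0 -[RHS](sact0r actV (C (kappa F`_0))).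
  by move/(sactC_inj actV); apply; rewrite fmorph_eq0 irred_coef0_neq0.
have ni : (0 < n * bump 0 i)%N by rewrite muln_gt0 (ltnW n_gt1).
by rewrite -(prednK ni) exprSr mulrA sactM // Xz sact0r.
Qed.

End FaithfulAction.

Hypothesis cardL : #|L| = (#|K| ^ n)%N.

(** * The commutant of the action on R/Rf, and the degree of f *)

Section Commutant.

Variables (f : R) (r : nat).
Hypotheses (f_monic : (f : {poly L}) \is monic) (szf : sksize f = r.+1).
Hypotheses (f_irr : irreducible_elt f) (f_dvd : right_divisor f (cpoly F)).
Local Notation V := {poly_r L}.
Local Notation act := (cyc_act f (r:=r)).
Local Notation e := (rmod f r 1).
Implicit Types (v w x y z : V).

Let actV : skew_action act := cyc_action f_monic szf.

Lemma cyc_F v : act (cpoly F) v = 0.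
Proof.
have [g Eg] := f_dvd.
by rewrite /cyc_act cpoly_central // Eg mulrA rmodMf.
Qed.

Let e_neq0 : e != 0. Proof. exact: vone_neq0. Qed.
Let Vneq0 : exists v : V, v != 0. Proof. by exists e. Qed.

Lemma cyc_inj a b : (sksize a <= n * s)%N -> (sksize b <= n * s)%N ->
  (forall v, act a v = act b v) -> a = b.
Proof. exact: (sact_inj actV cyc_F Vneq0). Qed.

(* An operator of the commutant is determined by its value z at e = 1 mod f,
   which is any z killed by f: it maps v to (vpoly v) z. *)
Let Z : pred V := fun z => act f z == 0.

Let ZP z : reflect (act f z = 0) (Z z). Proof. exact: eqP. Qed.

(** Reduction modulo f discards a term c f, which kills z; hence right multiplication by z is well
    defined on classes and R-linear. *)
Let Zact a v z : Z z -> act (vpoly (act a v)) z = act a (act (vpoly v) z).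
Proof.
move=> /ZP Zz; have [c Ec] := rmodP f_monic szf (a * vpoly v).
rewrite -(sactM actV) [in RHS]Ec (sactDl actV) (sactM actV) Zz.
by rewrite (sact0r actV) add0r.
Qed.

Let act_e v : act (vpoly v) e = v. Proof. exact: cyc_vone. Qed.

Let act_f_e : act f e = 0.
Proof. by rewrite cyc_one // -[X in rmod _ _ X]mul1r rmodMf. Qed.

Let Ze : Z e. Proof. exact/ZP. Qed.

Let ZB x y : Z x -> Z y -> Z (x - y).
Proof. by move=> /ZP Zx /ZP Zy; apply/ZP; rewrite (sactBr actV) Zx Zy subrr. Qed.

Let Z0 : Z 0. Proof. by apply/ZP; rewrite (sact0r actV). Qed.

Let ZM x y : Z x -> Z y -> Z (act (vpoly x) y).
Proof. by move=> /ZP Zx Zy; apply/ZP; rewrite -Zact // Zx vpoly0 (sact0l actV). Qed.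

Let Zeact y : Z y -> act (vpoly e) y = y.
Proof. by move=> Zy; rewrite -[e](sact1 actV) Zact // vpoly_one // !(sact1 actV). Qed.

(** Schur's lemma: if x is nonzero, some a sends x to [e], so x y = 0 gives y = e y = a (x y) =
    0. *)
Let Z_ann x y : Z y -> y != 0 -> act (vpoly x) y = 0 -> x = 0.
Proof.
move=> Zy nz_y xy0; apply/eqP; apply: contraLR nz_y => nz_x; rewrite negbK.
have [a Ea] := cyc_simple f_monic szf f_irr nz_x.
by have := Zact a x Zy; rewrite xy0 (sact0r actV) Ea Zeact // => ->.
Qed.

Let Z_comm x y : Z x -> Z y -> act (vpoly x) y = act (vpoly y) x.
Proof.
apply: (finite_domain_mulC (mul := fun x y => act (vpoly x) y) (e := e)) => //.
- by move=> x' y' z' Zx Zy Zz; rewrite Zact.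
- by move=> x' y' z'; rewrite vpolyD (sactDl actV).
- by move=> x' y' z'; rewrite (sactDr actV).
- move=> x' y' Zx Zy xy0; have [->|nz_y] := eqVneq y' 0; first by right.
  by left; apply: Z_ann xy0.
Qed.

Let Z_inv y : Z y -> y != 0 -> exists2 y', Z y' & act (vpoly y) y' = e.
Proof.
move=> Zy nz_y; have [a Ea] := cyc_simple f_monic szf f_irr nz_y.
have Ea' : act (vpoly (act a e)) y = e by rewrite Zact // Zeact.
have Zae : Z (act a e).
  by apply/ZP; apply: (Z_ann Zy nz_y); rewrite Zact // Ea'.
by exists (act a e) => //; rewrite -Z_comm.
Qed.

(** Span over the commutant, whose element z sends v to [act (vpoly v) z]; [zfree] is the matching
    linear independence. *)
Fixpoint zspan (vs : seq V) : {set V} :=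
  if vs is v :: vs' then [set act (vpoly v) z + w | z in Z, w in zspan vs']
  else [set 0].

Fixpoint zfree (vs : seq V) : bool :=
  if vs is v :: vs' then (v \notin zspan vs') && zfree vs' else true.

Let zspan_sub vs w w' : w \in zspan vs -> w' \in zspan vs -> w - w' \in zspan vs.
Proof.
elim: vs w w' => [|v vs IH] w w' /=; first by rewrite !inE => /eqP-> /eqP->; rewrite subr0.
case/imset2P=> z u Zz su -> /imset2P[z' u' Zz' su' ->].
apply/imset2P; exists (z - z') (u - u'); rewrite ?IH //; first exact: ZB.
by rewrite (sactBr actV) opprD addrACA.
Qed.

Let zspan0 vs : 0 \in zspan vs.
Proof.
elim: vs => [|v vs IH] /=; rewrite ?inE //; apply/imset2P.
by exists 0 0; rewrite ?Z0 ?(sact0r actV) ?addr0 //; apply: Z0.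
Qed.

Let zspan_add vs w w' : w \in zspan vs -> w' \in zspan vs -> w + w' \in zspan vs.
Proof.
by move=> sw sw'; rewrite -[w']opprK; apply: zspan_sub => //; rewrite -sub0r zspan_sub.
Qed.

Let zspanM vs w z : Z z -> w \in zspan vs -> act (vpoly w) z \in zspan vs.
Proof.
move=> Zz; elim: vs w => [|v vs IH] w /=.
  by rewrite !inE => /eqP->; rewrite vpoly0 (sact0l actV).
case/imset2P=> z' u Zz' su ->; apply/imset2P.
exists (act (vpoly z') z) (act (vpoly u) z); rewrite ?IH //; first exact: ZM.
by rewrite vpolyD (sactDl actV) Zact.
Qed.

Let zspan_cons v vs w : w \in zspan vs -> w \in zspan (v :: vs).
Proof.
move=> sw; apply/imset2P; exists 0 w; rewrite ?(sact0r actV) ?add0r //; exact: Z0.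
Qed.

Let zspan_head v vs z : Z z -> act (vpoly v) z \in zspan (v :: vs).
Proof. by move=> Zz; apply/imset2P; exists z 0; rewrite ?zspan0 ?addr0. Qed.

Let zspan_ann a vs w : {in vs, forall v, act a v = 0} -> w \in zspan vs -> act a w = 0.
Proof.
elim: vs w => [|v vs IH] w av0 /=; first by rewrite inE => /eqP->; rewrite (sact0r actV).
case/imset2P=> z u Zz su ->; rewrite (sactDr actV) -Zact // av0 ?mem_head //.
rewrite vpoly0 (sact0l actV) add0r IH // => v' sv'; apply: av0.
by rewrite inE sv' orbT.
Qed.

(* If a0 kills vs but not v, normalise it to a1 with a1 v = e. Either a1 w is not
   in Z, and f a1 separates w from v :: vs, or a1 w is in Z and the induction
   hypothesis applies to w - v (a1 w). *)
Let density vs w : w \notin zspan vs ->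
  exists2 a, {in vs, forall v, act a v = 0} & act a w != 0.
Proof.
elim: vs w => [|v vs IH] w /=.
  by rewrite inE => nz_w; exists 1; rewrite ?(sact1 actV).
move=> nsw; have nsw' : w \notin zspan vs by apply: contra nsw; apply: zspan_cons.
have [sv | /IH[a0 a0vs nz_a0v]] := boolP (v \in zspan vs).
  have [a avs nz_aw] := IH _ nsw'; exists a => // v'; rewrite inE => /orP[/eqP-> | /avs //].
  exact: zspan_ann sv.
have [b Eb] := cyc_simple f_monic szf f_irr nz_a0v.
pose a1 := b * a0; have a1v : act a1 v = e by rewrite (sactM actV).
have a1vs : {in vs, forall v', act a1 v' = 0}.
  by move=> v' sv'; rewrite (sactM actV) a0vs // (sact0r actV).
have [Zz | nZz] := boolP (Z (act a1 w)); last first.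
  exists (f * a1); last by rewrite (sactM actV).
  move=> v'; rewrite inE (sactM actV) => /orP[/eqP-> | /a1vs->].
    by rewrite a1v act_f_e.
  by rewrite (sact0r actV).
have nsd : w - act (vpoly v) (act a1 w) \notin zspan vs.
  apply: contra nsw => sd; rewrite -[w](subrK (act (vpoly v) (act a1 w))).
  by apply: (@zspan_add (v :: vs)); [apply: zspan_cons | apply: zspan_head].
have [c cvs nz_c] := IH _ nsd.
exists (c - vpoly (act c v) * a1).
  move=> v'; rewrite inE (sactBl actV) (sactM actV) => /orP[/eqP-> | sv'].
    by rewrite a1v act_e subrr.
  by rewrite cvs // a1vs // (sact0r actV) subrr.
by rewrite (sactBl actV) (sactM actV) Zact // -(sactBr actV).
Qed.

(** As in Newton interpolation: the value at the new vector v is corrected by an operator that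
    vanishes on [vs] and sends v to [e]. *)
Let interpolation vs (g : V -> V) : zfree vs ->
  exists a, {in vs, forall v, act a v = g v}.
Proof.
elim: vs => [|v vs IH] /=; first by exists 0.
case/andP=> nsv /IH[a Ea]; have [a0 a0vs nz_a0v] := density nsv.
have [b Eb] := cyc_simple f_monic szf f_irr nz_a0v.
exists (a + vpoly (g v - act a v) * (b * a0)) => v'.
rewrite inE (sactDl actV) !(sactM actV) => /orP[/eqP-> | sv'].
  by rewrite Eb act_e addrC subrK.
by rewrite a0vs // !(sact0r actV) addr0 Ea.
Qed.

Let card_zspan vs : zfree vs -> #|zspan vs| = (#|Z| ^ size vs)%N.
Proof.
elim: vs => [|v vs IH] /=; first by rewrite cards1.
case/andP=> nsv /IH Ec; rewrite expnS -Ec.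
have -> : [set act (vpoly v) z + w | z in Z, w in zspan vs] =
    (fun p : V * V => act (vpoly v) p.1 + p.2) @: setX [set z | Z z] (zspan vs).
  apply/setP => u; apply/imset2P/imsetP => [[z w Zz sw ->] | [[z w] /setXP[/= Zz sw] ->]].
    by exists (z, w) => //; apply/setXP; rewrite inE.
  by exists z w => //; rewrite inE in Zz.
rewrite card_in_imset ?cardsX ?cardsE //.
move=> [z w] [z' w'] /setXP[/= Zz sw] /setXP[/= Zz' sw'] Ezw.
move: Zz Zz'; rewrite !inE => Zz Zz'.
have Ed : act (vpoly v) (z - z') = w' - w.
  by apply/eqP; rewrite (sactBr actV) subr_eq addrAC eq_sym subr_eq addrC Ezw addrC.
have [Ez | nz] := eqVneq (z - z') 0.
  move/eqP: (Ez); rewrite subr_eq0 => /eqP->.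
  by move/eqP: Ed; rewrite Ez (sact0r actV) eq_sym subr_eq0 => /eqP->.
have [y Zy Ey] := Z_inv (ZB Zz Zz') nz; case/negP: nsv.
rewrite -[v]act_e -Ey -Zact ?ZB // Ed; apply: zspanM => //.
exact: zspan_sub.
Qed.

Let zbasis : exists2 vs, zfree vs & zspan vs = setT.
Proof.
have W m vs : (#|V| - #|zspan vs| < m)%N -> zfree vs -> exists2 vs, zfree vs & zspan vs = setT.
  elim: m vs => // m IH vs lt_m fr.
  have [full | ] := boolP [forall v, v \in zspan vs].
    by exists vs => //; apply/setP => v; rewrite inE (forallP full).
  rewrite negb_forall => /existsP[v nsv]; apply: (IH (v :: vs)); last by apply/andP.
  have lt_c : (#|zspan vs| < #|zspan (v :: vs)|)%N.
    apply: proper_card; apply/properP; split; first by apply/subsetP => w; apply: zspan_cons.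
    by exists v => //; have := zspan_head v vs Ze; rewrite act_e.
  have le_c : (#|zspan (v :: vs)| <= #|V|)%N by apply: max_card.
  rewrite -ltnS (leq_trans _ lt_m) // ltnS ltn_sub2l //.
  exact: leq_trans le_c.
by apply: (W _ [::] (ltnSn _)).
Qed.

Let reduce a : exists2 b, (sksize b <= n * s)%N & forall v, act a v = act b v.
Proof.
have nzF : cpoly F != 0 by rewrite cpoly_eq0 ?monic_neq0.
have [q [b [-> lt_b]]] := skew_div a nzF; exists b.
  by rewrite -ltnS -sksize_cF.
by move=> v; rewrite (sactDl actV) (sactM actV) cyc_F (sact0r actV) add0r.
Qed.

Let central_action a : (forall b v, act a (act b v) = act b (act a v)) ->
  exists P, forall v, act a v = act (cpoly P) v.
Proof.
have [b sz_b Eb] := reduce a => comm; suff [P EP] : exists P, b = cpoly P.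
  by exists P => v; rewrite Eb EP.
have bC (x : L) : b * C x = C x * b.
  apply: cyc_inj; rewrite //.
  - by apply/sksize_leqP => i le_i; rewrite skcoef_Cr skcoef_nil ?mul0r ?(leq_trans sz_b).
  - by apply/sksize_leqP => i le_i; rewrite skcoef_Cl skcoef_nil ?mulr0 ?(leq_trans sz_b).
  by move=> v; rewrite !(sactM actV) -!Eb comm.
have supp i : skcoef b i != 0 -> (n %| i)%N.
  move=> nz; apply: sigma_order => x0; apply: (mulfI nz).
  by have := congr1 (skcoef^~ i) (bC x0); rewrite skcoef_Cl skcoef_Cr => ->; exact: mulrC.
(* Comparing [b * X] with [X * b] must stay within the bound of faithfulness. A top degree n s - 1
   is excluded because the support of [b] lies in the multiples of n. *)
have sz_b' : (sksize b < n * s)%N.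
  rewrite ltn_neqAle sz_b andbT; apply/negP => /eqP Es.
  have nz_b : b != 0 by rewrite -sksize_eq0 Es muln_eq0 negb_or -!lt0n; apply/andP; split; lia.
  have := supp _ (sklead_neq0 nz_b); rewrite Es -subn1 dvdn_subr ?dvdn_mulr //.
    by rewrite dvdn1; apply/negP; rewrite neq_ltn n_gt1 orbT.
  by rewrite muln_gt0; apply/andP; split; lia.
apply: cpoly_of_comm => //; apply: cyc_inj.
- apply/sksize_leqP => -[|i] le_i; rewrite skcoef_Xr // skcoef_nil //.
  exact: leq_trans sz_b' le_i.
- apply/sksize_leqP => -[|i] le_i; rewrite skcoef_Xl // skcoef_nil ?rmorph0 //.
  exact: leq_trans sz_b' le_i.
by move=> v; rewrite !(sactM actV) -!Eb comm.
Qed.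

(** A bicommutant argument. Since Z is commutative, multiplication by z is Z-linear, so
    interpolation on a basis realises it by an element of R; that element commutes with R on V and
    is therefore central. *)
Let Z_cpoly z : Z z -> exists P, forall v, act (vpoly v) z = act (cpoly P) v.
Proof.
move=> Zz; have [vs fr full] := zbasis.
have [a Ea] := interpolation (fun v => act (vpoly v) z) fr.
have Eaz w : act a w = act (vpoly w) z.
  have: w \in zspan vs by rewrite full inE.
  elim: (vs) Ea w => [|v ws IH] Ea w /=.
    by rewrite inE => /eqP->; rewrite (sact0r actV) vpoly0 (sact0l actV).
  case/imset2P=> z' u Zz' su ->; rewrite (sactDr actV) vpolyD (sactDl actV) -(IH _ u) //.
    rewrite -Zact // Ea ?mem_head // !Zact // ; congr (_ + _); congr act.
    exact: Z_comm.
  by move=> v' sv'; apply: Ea; rewrite inE sv' orbT.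
have [|P EP] := @central_action a; last by exists P => v; rewrite -EP Eaz.
by move=> b v; rewrite !Eaz Zact.
Qed.

(** An equivariant [d] is determined by [d e], and f (d e) = d (f e) = d 0 = 0 places [d e] in Z. *)
Lemma cyc_commutant (d : V -> V) : d 0 = 0 -> (forall a v, d (act a v) = act a (d v)) ->
  exists P, forall v, d v = act (cpoly P) v.
Proof.
move=> d0 dact; have Zd : Z (d e) by apply/ZP; rewrite -dact act_f_e.
have [P EP] := Z_cpoly Zd; exists P => v.
by rewrite -EP -dact act_e.
Qed.

Lemma sksize_cpoly_leq P : (size P <= s)%N -> (sksize (cpoly P) <= n * s)%N.
Proof.
have [-> | nz_P] := eqVneq P 0; first by rewrite rmorph0 sksize0.
move=> sP; rewrite sksize_cpoly //.
have : (n * (size P).-1 + n <= n * s)%N.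
  by rewrite -mulnSr prednK ?leq_mul2l ?sP ?orbT // size_poly_gt0.
lia.
Qed.

Let act_cP_mod P v : act (cpoly P) v = act (cpoly (P %% F)) v.
Proof.
rewrite {1}(divp_eq P F) rmorphD rmorphM (sactDl actV) (sactM actV) cyc_F.
by rewrite (sact0r actV) add0r.
Qed.

Let card_Z : #|Z| = (#|K| ^ s)%N.
Proof.
pose h (P : {poly_s K}) : V := act (cpoly P) e.
have h_inj : injective h.
  move=> P Q hPQ; apply: val_inj; apply: cpoly_inj.
  apply: cyc_inj; rewrite ?sksize_cpoly_leq ?size_npoly // => v.
  rewrite -[v]act_e -!(sactM actV) !cpoly_central // !(sactM actV).
  by congr act.
rewrite -card_npoly -(card_imset _ h_inj).
apply: eq_card => z; apply/idP/imsetP => [Zz | [P _ ->]].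
  have [P EP] := Z_cpoly Zz.
  have sz : (size (P %% F)%R <= s)%N by rewrite -ltnS -szF ltn_modp monic_neq0.
  exists (NPoly (sz : (P %% F) \is a poly_of_size s)) => //.
  by rewrite /h -act_cP_mod -EP Zeact.
by apply/ZP; rewrite -(sactM actV) -cpoly_central // (sactM actV) act_f_e (sact0r actV).
Qed.

(* With t = dim_E V, density identifies R/RF(X^n) with V^t: t s = n r and
   n (n s) = (n r) t over K. *)
Lemma cyc_degree : r = s.
Proof.
have [vs fr full] := zbasis; set t := size vs.
have cV1 : #|V| = (#|Z| ^ t)%N by rewrite -card_zspan // full cardsT.
have vs_span v : v \in vs -> v \in zspan vs.
  elim: (vs) => //= w ws IH; rewrite inE => /orP[/eqP-> | /IH]; last exact: zspan_cons.
  by have := zspan_head w ws Ze; rewrite act_e.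
have vs_uniq : uniq vs.
  elim: (vs) fr => //= w ws IH /andP[nsw /IH->]; rewrite andbT; apply: contra nsw.
  elim: (ws) => //= w' ws' IH'; rewrite inE => /orP[/eqP-> | /IH']; last exact: zspan_cons.
  by have := zspan_head w' ws' Ze; rewrite act_e.
pose h (a : {poly_(n * s) L}) := [ffun i : 'I_t => act (a : {poly L}) vs`_i].
have h_inj : injective h.
  move=> a b hab; apply: val_inj; apply: (cyc_inj (size_npoly a) (size_npoly b)) => v.
  apply/eqP; rewrite -subr_eq0 -(sactBl actV); apply/eqP.
  apply: (@zspan_ann _ vs); last by rewrite full inE.
  move=> w /(nthP 0)[i lt_i <-]; rewrite (sactBl actV); apply/eqP; rewrite subr_eq0.
  by have := congr1 (fun g : {ffun 'I_t -> V} => g (Ordinal lt_i)) hab; rewrite !ffunE /= => ->.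
have h_surj g : exists a : {poly_(n * s) L}, h a = g.
  (* The value prescribed at a basis vector is read off from its position in [vs], unambiguous since
     [vs] is duplicate-free; the default 0 is never reached. *)
  have [a Ea] := interpolation (fun v => oapp g 0 (insub (index v vs))) fr.
  have [b sz_b Eb] := reduce a; exists (NPoly (sz_b : (b : {poly L}) \is a poly_of_size _)).
  apply/ffunP => i; rewrite ffunE /= -Eb Ea ?mem_nth // index_uniq //.
  by rewrite valK.
have cV2 : (#|L| ^ (n * s) = #|V| ^ t)%N.
  rewrite -card_npoly -[in RHS](card_ord t) -card_ffun -(card_codom h_inj).
  by apply: eq_card => g; rewrite [RHS]inE; have [a <-] := h_surj g; apply: codom_f.
have q_gt1 : (1 < #|K|)%N by apply: finNzRing_gt1.
have cV : #|V| = (#|K| ^ (n * r))%N by rewrite card_npoly cardL expnM.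
move: cV1; rewrite cV card_Z -expnM => /(expnI q_gt1) E1.
move: cV2; rewrite cV cardL -!expnM => /(expnI q_gt1) E2.
have Et : n = t by apply/eqP; rewrite -(eqn_exp2r _ _ (isT : 0 < 2)%N); apply/eqP; nia.
by apply/eqP; rewrite -(eqn_pmul2l (ltnW n_gt1)) E1 -Et mulnC.
Qed.

End Commutant.

Variable Q0 : nat.
Hypothesis sigma_pow : forall x, sigma x = x ^+ Q0.
Variable f : R.
Hypotheses (f_monic : (f : {poly L}) \is monic) (szf : sksize f = s.+1).
Hypotheses (f_irr : irreducible_elt f) (f_dvd : right_divisor f (cpoly F)).
Local Notation V := {poly_s L}.
Local Notation vpoly := (@vpoly L sigma _).
Local Notation act := (cyc_act f (r:=s)).
Local Notation e := (rmod f s 1).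
Implicit Types (v w : V) (c : R).

Let actV : skew_action act := cyc_action f_monic szf.

Let act_inj a b : (sksize a <= n * s)%N -> (sksize b <= n * s)%N ->
  (forall v, act a v = act b v) -> a = b.
Proof. exact: (cyc_inj f_monic szf f_irr f_dvd). Qed.

Let actF v : act (cpoly F) v = 0. Proof. exact: cyc_F. Qed.

Let X_inj : injective (act X). Proof. exact: (sactX_inj actV actF). Qed.

Let e_neq0 : e != 0. Proof. exact: vone_neq0. Qed.

Let Vneq0 : exists v : V, v != 0. Proof. by exists e. Qed.

(** * The semilinear shape of an autotopism *)

Section Autotopism.

Variables (phi gam eta : {perm V}).
Hypothesis phiD : forall v w, phi (v + w) = phi v + phi w.
Hypothesis gamD : forall v w, gam (v + w) = gam v + gam w.
Hypothesis etaD : forall v w, eta (v + w) = eta v + eta w.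
Hypothesis isot : forall v w, phi (act (vpoly v) w) = act (vpoly (gam v)) (eta w).

(** Defined on all of R, but it represents [gam] faithfully only for sizes at most [s], where [npol]
    does not truncate; hence the size conditions below. *)
Let G a : R := vpoly (gam (npol a)).

Let szG a : (sksize (G a) <= s)%N. Proof. exact: sksize_vpoly. Qed.

Let G_D a b : G (a + b) = G a + G b.
Proof. by rewrite /G npolD gamD. Qed.

Let G_0 : G 0 = 0.
Proof. by apply: (addrI (G 0)); rewrite -G_D !addr0. Qed.

Let G_N a : G (- a) = - G a.
Proof. by apply: (addrI (G a)); rewrite -G_D !subrr G_0. Qed.

Let G_B a b : G (a - b) = G a - G b.
Proof. by rewrite G_D G_N. Qed.

Let G_inj a b : (sksize a <= s)%N -> (sksize b <= s)%N -> G a = G b -> a = b.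
Proof.
move=> sa sb /vpoly_inj/perm_inj Eab.
by rewrite -(npolK sa) -(npolK sb) Eab.
Qed.

Let G_surj c : (sksize c <= s)%N -> exists2 b, (sksize b <= s)%N & G b = c.
Proof.
move=> sc; exists (vpoly ((gam^-1)%g (npol c))); first exact: sksize_vpoly.
by rewrite /G vpolyK permKV npolK.
Qed.

Let isotG a v : (sksize a <= s)%N -> phi (act a v) = act (G a) (eta v).
Proof. by move=> sa; rewrite -isot npolK. Qed.

Let eta_surj w : exists v, w = eta v.
Proof. by exists ((eta^-1)%g w); rewrite permKV. Qed.

Let le_s2 : (s + s <= n * s)%N. Proof. by rewrite addnn -mul2n leq_mul2r n_gt1 orbT. Qed.

Let sz_mul a b i j : (sksize a <= i)%N -> (sksize b <= j)%N -> (sksize (a * b) <= i + j)%N.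
Proof.
move=> sa sb; have [->|nz_a] := eqVneq a 0; first by rewrite mul0r sksize0.
have [->|nz_b] := eqVneq b 0; first by rewrite mulr0 sksize0.
by rewrite sksize_mul //; lia.
Qed.

Let sz_CM x a i : (sksize a <= i)%N -> (sksize (C x * a) <= i)%N.
Proof.
by move=> sa; apply/sksize_leqP => j ij; rewrite skcoef_Cl skcoef_nil ?mulr0 ?(leq_trans sa).
Qed.

Let sz_MC x a i : (sksize a <= i)%N -> (sksize (a * C x) <= i)%N.
Proof.
by move=> sa; apply/sksize_leqP => j ij; rewrite skcoef_Cr skcoef_nil ?mul0r ?(leq_trans sa).
Qed.

Let sz_MX a i : (sksize a <= i)%N -> (sksize (a * X) <= i.+1)%N.
Proof.
by move=> sa; apply/sksize_leqP => -[|j] ij; rewrite skcoef_Xr // skcoef_nil ?(leq_trans sa).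
Qed.

Let sz_XM a i : (sksize a <= i)%N -> (sksize (X * a) <= i.+1)%N.
Proof.
move=> sa; apply/sksize_leqP => -[|j] ij; rewrite skcoef_Xl // skcoef_nil ?rmorph0 //.
exact: leq_trans sa _.
Qed.

Let act_injG a b : (sksize a <= s + s)%N -> (sksize b <= s + s)%N ->
  (forall v, act a (eta v) = act b (eta v)) -> a = b.
Proof.
move=> sa sb eq_ab; apply: act_inj; rewrite ?(leq_trans _ le_s2) // => w.
by have [v ->] := eta_surj w.
Qed.

Let act_neq0 (T : V -> V) : injective T -> T 0 = 0 -> T e != 0.
Proof. by move=> injT T0; rewrite -T0 (inj_eq injT) e_neq0. Qed.

Let szXs : (sksize (X ^+ s.-1) <= s)%N. Proof. by rewrite sksizeXn prednK // ltnW. Qed.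

Let sz1 : (sksize (1 : R) <= s)%N. Proof. by rewrite sksize1 ltnW. Qed.

(* The candidate for gamma(x) is c = gamma(gamma^-1(1) x); since X^(s-1) is in the
   image of gamma, X^(s-1) c has degree < s, so c is a constant. *)
Let right_scalar x : exists t,
  (forall v, eta (act (C x) v) = act (C t) (eta v)) /\
  (forall a, (sksize a <= s)%N -> G (a * C x) = G a * C t).
Proof.
have [b0 sb0 Gb0] := G_surj sz1.
pose c := G (b0 * C x).
have Ec v : eta (act (C x) v) = act c (eta v).
  by rewrite -isotG ?sz_MC // (sactM actV) isotG // Gb0 (sact1 actV).
have Gc a : (sksize a <= s)%N -> G (a * C x) = G a * c.
  move=> sa; apply: act_injG; rewrite ?sz_mul ?szG ?(leq_trans (szG _)) ?leq_addl // => v.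
  by rewrite -isotG ?sz_MC // (sactM actV) isotG // Ec (sactM actV).
have sc : (sksize c <= 1)%N.
  have [b sb Gb] := G_surj szXs; have := szG (b * C x); rewrite Gc // Gb.
  have [-> | nz_c] := eqVneq c 0; first by rewrite sksize0.
  by rewrite sksize_mul ?skXn_neq0 // sksizeXn; lia.
by exists (skcoef c 0); rewrite -(sksize_leq1 sc).
Qed.

(** Mirror image of [right_scalar], conjugating by phi instead of eta: the candidate is gamma(x
    gamma^-1(1)), again a constant by a degree comparison at the preimage of X^(s-1). *)
Let left_scalar x : exists t,
  forall a, (sksize a <= s)%N -> G (C x * a) = C t * G a.
Proof.
have [b0 sb0 Gb0] := G_surj sz1.
pose c := G (C x * b0).
have Ec w : act c w = phi (act (C x) ((phi^-1)%g w)).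
  have [v ->] := eta_surj w; rewrite -isotG ?sz_CM // (sactM actV); congr (phi (act _ _)).
  by apply: (@perm_inj _ phi); rewrite permKV isotG // Gb0 (sact1 actV).
have Gc a : (sksize a <= s)%N -> G (C x * a) = c * G a.
  move=> sa; apply: act_injG; rewrite ?sz_mul ?szG ?(leq_trans (szG _)) ?leq_addl // => v.
  by rewrite -isotG ?sz_CM // !(sactM actV) Ec -isotG // permK.
have sc : (sksize c <= 1)%N.
  have [b sb Gb] := G_surj szXs; have := szG (C x * b); rewrite Gc // Gb.
  have [-> | nz_c] := eqVneq c 0; first by rewrite sksize0.
  by rewrite sksize_mul ?skXn_neq0 // sksizeXn; lia.
by exists (skcoef c 0) => a sa; rewrite -(sksize_leq1 sc) Gc.
Qed.

Let sigma_neq_id : ~ forall x, sigma x = x.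
Proof.
move=> fix_x; have := sigma_order (i := 1) fix_x.
by rewrite dvdn1; case: (n) n_gt1 => [|[]].
Qed.

(* The first case is the one where W = gamma(deg < s - 1) contains 1. In the second
   case W is a complement of the constants, which forces X to be in W and all
   elements of W to vanish at 0. *)
Lemma autotopism_dichotomy : exists t2 : L -> L,
  (forall x v, eta (act (C x) v) = act (C (t2 x)) (eta v)) /\
  ((exists2 x, x != 0 & forall v, eta (act X v) = act (C x * X) (eta v)) \/
   (n = 2%N /\ exists2 x, x != 0 &
     forall v, act X (eta (act X v)) = act (C x) (eta v))).
Proof.
have [t2 t2P] := fin_all_exists right_scalar.
have [t1 G_l] := fin_all_exists left_scalar.
have eta_t x v : eta (act (C x) v) = act (C (t2 x)) (eta v) by case: (t2P x).
have G_r x a : (sksize a <= s)%N -> G (a * C x) = G a * C (t2 x) by case: (t2P x) => _; apply.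
exists t2; split=> //.
have t2_surj := semilin_surj actV Vneq0 etaD (@perm_inj _ eta) eta_t.
have t2_inj := semilin_inj actV Vneq0 etaD (@perm_inj _ eta) eta_t.
have t2_sigma x : t2 (sigma x) = sigma (t2 x).
  by rewrite !sigma_pow (semilinX actV Vneq0 etaD (@perm_inj _ eta) eta_t).
have t2_neq_id : ~ forall x, sigma (t2 x) = t2 x.
  move=> fix_t; apply: sigma_neq_id => y; have [x <-] := t2_surj y; exact: fix_t.
have t1_inj : injective t1.
  move=> x y Exy; apply: (@skewC_inj _ sigma).
  have : G (C x * 1) = G (C y * 1) by rewrite !G_l // Exy.
  by rewrite !mulr1; apply: G_inj; apply: leq_trans (sksizeC_leq _ _) _; apply: ltnW.
have t1_surj y : exists x, t1 x = y by exists (invF t1_inj y); rewrite f_invF.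
have etaX_neq0 : eta (act X e) != 0.
  apply: (act_neq0 (T := fun v => eta (act X v))) => [v w /perm_inj/X_inj //|].
  by rewrite (sact0r actV); apply: (addrI (eta 0)); rewrite -etaD !addr0.
have les1 : (s.-1 <= s)%N by apply: leq_pred.
have les1S : (s.-1.+1 <= s)%N by rewrite prednK // ltnW.
have GcX c v : (sksize c <= s.-1)%N -> act (G c) (eta (act X v)) = act (G (c * X)) (eta v).
  move=> sc; rewrite -isotG ?(leq_trans sc) // -(sactM actV) isotG //.
  exact: leq_trans (sz_MX sc) les1S.
have etaXC x v : eta (act X (act (C x) v)) = act (C (t2 (sigma x))) (eta (act X v)).
  by rewrite -(sactM actV) skX_C (sactM actV) eta_t.
have [/existsP[c1 /eqP Gc1] | no1] :=
    boolP [exists c : {poly_(s.-1) L}, G (vpoly c) == 1].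
  (* As gamma(c1) = 1, computing phi (c1 X v) in two ways gives eta X = a eta. It remains to show
     that [a] is a scalar times X. *)
  left; pose a := G (vpoly c1 * X).
  have Ea v : eta (act X v) = act a (eta v).
    by rewrite -GcX ?sksize_vpoly // Gc1 (sact1 actV).
  have Ga c : (sksize c <= s.-1)%N -> G c * a = G (c * X).
    move=> sc; apply: act_injG; rewrite ?sz_mul ?szG ?(leq_trans (szG _)) ?leq_addl // => v.
    by rewrite (sactM actV) -Ea GcX.
  (* By cardinality W cannot lie in the polynomials of degree < s - 2. An element of W of degree at
     least s - 2, times [a], still has degree < s; so [a] has degree at most 1. *)
  have [c sc big_c] : exists2 c, (sksize c <= s.-1)%N & (s.-2 < sksize (G c))%N.
    have [/existsP[c big_c] | ] :=
        boolP [exists c : {poly_(s.-1) L}, s.-2 < sksize (G (vpoly c))]%N.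
      by exists (vpoly c); rewrite ?sksize_vpoly.
    rewrite negb_exists => /forallP small.
    pose h (c : {poly_(s.-1) L}) : {poly_(s.-2) L} := npol (G (vpoly c)).
    have h_inj : injective h.
      move=> c c' /(congr1 vpoly).
      have szh (d : {poly_(s.-1) L}) : (sksize (G (vpoly d)) <= s.-2)%N by rewrite leqNgt small.
      rewrite (npolK (szh c)) (npolK (szh c')) => Ecc; apply: vpoly_inj.
      by apply: G_inj Ecc; rewrite (leq_trans (sksize_vpoly _)).
    have := leq_card h h_inj; rewrite !card_npoly leq_exp2l ?finNzRing_gt1 //.
    by have := s_gt1; lia.
  have sz_a : (sksize a <= 2)%N.
    have := szG (c * X); rewrite -Ga //.
    have nz_G : G c != 0 by rewrite -sksize_eq0; move: big_c; lia.
    have [-> | nz_a] := eqVneq a 0; first by rewrite sksize0.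
    by rewrite sksize_mul //; move: big_c s_gt1; lia.
  have a_comm x : a * C (t2 x) = C (t2 (sigma x)) * a.
    apply: act_injG; rewrite ?sz_MC ?sz_CM ?(leq_trans (szG _)) ?leq_addl // => v.
    by rewrite !(sactM actV) -eta_t -!Ea etaXC.
  (* A nonzero constant term in [a_comm] would make t2 (sigma x) = t2 x for all x, against sigma
     being nontrivial. *)
  have a0 : skcoef a 0 = 0.
    apply/eqP/negPn/negP => nz; apply: sigma_neq_id => x; apply: t2_inj; apply: (mulfI nz).
    by have := congr1 (skcoef^~ 0%N) (a_comm x); rewrite skcoef_Cl skcoef_Cr /= => ->; exact: mulrC.
  have Ea1 : a = C (skcoef a 1) * X.
    apply: skcoefP => -[|[|i]]; rewrite skcoef_Xr ?a0 ?skcoefC //=.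
    by rewrite skcoef_nil // (leq_trans sz_a).
  exists (skcoef a 1); last by move=> v; rewrite -Ea1.
  apply: contra etaX_neq0 => /eqP a10; rewrite Ea Ea1 a10 rmorph0 mul0r.
  by rewrite (sact0l actV).
(* W is stable under left scalars because t1 is onto, so a nonzero constant in W would bring 1 into
   W. *)
right; have W_const c x : (sksize c <= s.-1)%N -> G c = C x -> x = 0.
  move=> sc Gc; apply/eqP/negPn/negP => nz_x; case/negP: no1.
  have [y Ey] := t1_surj x^-1; apply/existsP.
  exists (NPoly (sz_CM y sc : (C y * c : {poly L}) \is a poly_of_size s.-1)).
  by rewrite /= G_l ?(leq_trans sc) // Ey Gc -rmorphM mulVf // rmorph1.
(* By cardinality, W and the constants together fill all sizes up to [s], so X = w + l with w in W;
   the constant l is then shown to vanish. *)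
have [c1 sc1 Gc1] : exists2 c, (sksize c <= s.-1)%N & G c = X.
  pose h (p : {poly_(s.-1) L} * L) : V := npol (G (vpoly p.1) + C p.2).
  have sz_h (p : {poly_(s.-1) L} * L) : (sksize (G (vpoly p.1) + C p.2) <= s)%N.
    by apply: sksizeD; [apply: szG | apply: leq_trans (sksizeC_leq _ _) _; apply: ltnW].
  have h_inj : injective h.
    move=> [c l] [c' l'] /(congr1 vpoly).
    rewrite (npolK (sz_h (c, l))) (npolK (sz_h (c', l'))) /= => Ecl.
    have E : G ((vpoly c) - (vpoly c')) = C (l' - l).
      by rewrite G_B rmorphB; apply/eqP; rewrite subr_eq addrAC eq_sym subr_eq addrC Ecl addrC.
    have szc : (sksize ((vpoly c) - (vpoly c')) <= s.-1)%N.
      by apply: sksizeB; apply: sksize_vpoly.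
    have /eqP := W_const _ _ szc E; rewrite subr_eq0 => /eqP El.
    move: Ecl; rewrite El => /addIr/G_inj Ec; congr (_, _).
    by apply: val_inj; apply: Ec; rewrite (leq_trans (sksize_vpoly _)).
  have cardE : (#|V| <= #|{: {poly_(s.-1) L} * L}|)%N.
    by rewrite card_prod !card_npoly -expnSr prednK // ltnW.
  have [h' _ hK] := inj_card_bij h_inj cardE.
  pose p := h' (npol X); have Ep : G (vpoly p.1) + C p.2 = X.
    have := hK (npol X); move/(congr1 vpoly).
    by rewrite !npolK // sksizeX.
  have l0 : p.2 = 0.
    (* With t1 y = sigma (t2 z), the X-terms of the images of [C y * c] and [c * C z] cancel. The
       constant l (t2 z - sigma (t2 z)) remains in W, hence is 0 for every z. *)
    apply/eqP/negPn/negP => nz_l; apply: t2_neq_id => z.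
    have [y Ey] := t1_surj (sigma (t2 z)); pose c : R := vpoly p.1.
    have sc : (sksize c <= s.-1)%N by apply: sksize_vpoly.
    have sc' : (sksize c <= s)%N by apply: leq_trans les1.
    have Gc : G c = X - C p.2 by rewrite -Ep addrK.
    have E : G (C y * c - c * C z) = C (p.2 * (t2 z - sigma (t2 z))).
      rewrite G_B G_l // G_r // Gc Ey mulrBr mulrBl skX_C -!rmorphM opprB.
      by rewrite addrC addrA subrK -rmorphB mulrBr [sigma _ * _]mulrC.
    have szE : (sksize (C y * c - c * C z) <= s.-1)%N.
      by apply: sksizeB; [apply: sz_CM | apply: sz_MC].
    have /eqP := W_const _ _ szE E; rewrite mulf_eq0 (negPf nz_l) subr_eq0.
    by move=> /eqP.
  by exists (vpoly p.1); rewrite ?sksize_vpoly // -[RHS]Ep l0 rmorph0 addr0.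
pose a := G (c1 * X).
have Ea v : act X (eta (act X v)) = act a (eta v) by rewrite /a -GcX // Gc1.
(* Moving X past gamma(c) twists its coefficients by sigma into [ws]; composing with X eta X = a eta
   then yields X gamma(c X) = ws a. *)
have Ga c : (sksize c <= s.-1)%N -> exists ws : R,
    [/\ X * G c = ws * X, (sksize ws <= s)%N, forall i, skcoef ws i = sigma (skcoef (G c) i)
      & X * G (c * X) = ws * a].
  move=> sc; have [ws [Ews sws cws]] := skX_twist (G c).
  have sws' : (sksize ws <= s)%N by apply: leq_trans sws _.
  exists ws; split=> //.
  apply: act_injG => [||v].
  - by apply: leq_trans (sz_XM (szG _)) _; rewrite -addn1 leq_add2l ltnW.
  - by apply: sz_mul => //; apply: szG.
  by rewrite (sactM actV) -GcX // -(sactM actV) Ews !(sactM actV) Ea.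
(* Otherwise a = X a2, and cancelling X gives eta X = a2 eta. Then gamma^-1(a2) = gamma^-1(1) X, so
   gamma^-1(1) has degree < s - 1 and W contains 1. *)
have nz_a0 : skcoef a 0 != 0.
  apply/negP => /eqP a0.
  pose a2 : R := \poly_(i < s) iter n.-1 sigma (skcoef a i.+1).
  have Ea2 : a = X * a2.
    apply: skcoefP => -[|i]; rewrite skcoef_Xl ?a0 //.
    rewrite /skcoef coef_poly; case: ltnP => [_ | le_si].
      by rewrite -iterS prednK ?sigma_n // ltnW.
    by rewrite rmorph0 -[_`_i.+1]/(skcoef a i.+1) skcoef_nil // (leq_trans (szG _)) // ltnW.
  have [b sb Gb] := G_surj (size_poly _ _ : (sksize a2 <= s)%N).
  have [b0 sb0 Gb0] := G_surj sz1.
  have Eb : b = b0 * X.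
    apply: act_inj => [||v].
    - by rewrite (leq_trans _ le_s2) // (leq_trans sb) // leq_addr.
    - rewrite (leq_trans _ le_s2) // (leq_trans (sz_MX sb0)) // -addn1 leq_add2l; exact: ltnW.
    apply: (@perm_inj _ phi); rewrite (sactM actV) !isotG // Gb Gb0 (sact1 actV).
    by apply: X_inj; rewrite Ea -(sactM actV) -Ea2.
  case/negP: no1; apply/existsP.
  have sb0' : (sksize b0 <= s.-1)%N.
    have [-> | nz_b0] := eqVneq b0 0; first by rewrite sksize0.
    by move: sb; rewrite Eb sksize_mul ?skX_neq0 // sksizeX; lia.
  by exists (NPoly (sb0' : (b0 : {poly L}) \is a poly_of_size s.-1)); rewrite /= Gb0.
have W_low c : (sksize c <= s.-1)%N -> skcoef (G c) 0 = 0.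
  move=> sc; have [ws [_ _ cws Ews]] := Ga c sc.
  have := congr1 (skcoef^~ 0%N) Ews; rewrite skcoef_Xl skcoef_mul big_ord1 subnn /= cws.
  move/esym/eqP; rewrite mulf_eq0 (negPf nz_a0) orbF fmorph_eq0.
  by move/eqP.
(* W has the cardinality of the polynomials of degree < s vanishing at 0, so it contains X^(s-1). In
   X gamma(c X) = ws a this makes ws = X^(s-1), which bounds the degree of [a] by 1. *)
have [c sc Gc] : exists2 c, (sksize c <= s.-1)%N & G c = X ^+ s.-1.
  pose h (c : {poly_(s.-1) L}) : {poly_(s.-1) L} := mk_npoly _ (fun i => skcoef (G (vpoly c)) i.+1).
  have hE (c : {poly_(s.-1) L}) i : (i < s.-1)%N -> (h c : {poly L})`_i = skcoef (G (vpoly c)) i.+1.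
    by move=> lt_i; rewrite coef_poly lt_i.
  have h_inj : injective h.
    move=> c c' Ecc; apply: val_inj; apply: G_inj; rewrite ?(leq_trans (sksize_vpoly _)) //.
    apply: skcoefP => -[|i]; first by rewrite !W_low ?sksize_vpoly.
    have [lt_i | le_i] := ltnP i s.-1; first by rewrite -!hE // Ecc.
    by rewrite !skcoef_nil // (leq_trans (szG _)) //; move: le_i; lia.
  have sX : (size ('X^(s.-2) : {poly L}) <= s.-1)%N by rewrite size_polyXn; move: s_gt1; lia.
  pose c := invF h_inj (NPoly (sX : 'X^(s.-2) \is a poly_of_size s.-1)).
  exists (vpoly c); first exact: sksize_vpoly.
  apply: skcoefP => -[|i]; rewrite skcoefXn.
    by rewrite W_low ?sksize_vpoly //; case: (s) s_gt1 => [|[|]].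
  have [lt_i | le_i] := ltnP i s.-1.
    by rewrite -hE // f_invF /= coefXn; congr (_%:R); move: s_gt1 lt_i; lia.
  by rewrite skcoef_nil ?(leq_trans (szG _)) ?gtn_eqF //; move: le_i s_gt1; lia.
have sz_a : (sksize a <= 2)%N.
  have [ws [Ews _ _ E]] := Ga c sc.
  have Ew : ws = X ^+ s.-1.
    by apply: (skmulIr (skX_neq0 sigma)); rewrite -Ews Gc -exprS -exprSr.
  have := sz_XM (szG (c * X)); rewrite E Ew.
  have nz_a : a != 0 by apply: contra nz_a0 => /eqP->; rewrite skcoef0.
  by rewrite sksize_mul ?skXn_neq0 // sksizeXn; move: s_gt1; lia.
have a_comm x : a * C (t2 x) = C (sigma (t2 (sigma x))) * a.
  apply: act_injG; rewrite ?sz_MC ?sz_CM ?(leq_trans (szG _)) ?leq_addl // => v.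
  by rewrite !(sactM actV) -eta_t -!Ea etaXC -!(sactM actV) skX_C.
(* The constant term of [a_comm] gives sigma^2 = 1, hence n = 2; its linear term would then give
   sigma = 1 unless it vanishes. *)
have sigma2 x : sigma (sigma x) = x.
  apply: t2_inj; apply: (mulfI nz_a0).
  have := congr1 (skcoef^~ 0%N) (a_comm x); rewrite skcoef_Cl skcoef_Cr /= => ->.
  by rewrite !t2_sigma mulrC.
have n2 : n = 2%N.
  by apply/eqP; rewrite eqn_leq n_gt1 andbT; apply: dvdn_leq => //; apply: sigma_order.
have a1 : skcoef a 1 = 0.
  apply/eqP/negPn/negP => nz; apply: t2_neq_id => x; apply: (mulfI nz).
  have := congr1 (skcoef^~ 1%N) (a_comm x); rewrite skcoef_Cl skcoef_Cr /= => ->.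
  by rewrite t2_sigma sigma2 mulrC.
have Ea1 : a = C (skcoef a 0).
  apply: skcoefP => -[|[|i]]; rewrite skcoefC ?a1 //=.
  by rewrite skcoef_nil // (leq_trans sz_a).
by split=> //; exists (skcoef a 0) => // v; rewrite -Ea1 Ea.
Qed.

(** With c = gamma(1) one has phi = c eta and gamma(X^(s-1)) = c (x X)^(s-1). The right side has
    degree < s, so [c] is a constant. *)
Lemma autotopism_phi_scalar x : x != 0 ->
    (forall v, eta (act X v) = act (C x * X) (eta v)) ->
  exists2 y, y != 0 & forall v, phi v = act (C y) (eta v).
Proof.
move=> nz_x etaX; pose c := G 1.
have Ephi v : phi v = act c (eta v) by rewrite -isotG // (sact1 actV).
have etaXi i v : eta (act (X ^+ i) v) = act ((C x * X) ^+ i) (eta v).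
  elim: i v => [|i IH] v; first by rewrite !expr0 !(sact1 actV).
  by rewrite exprSr exprSr (sactM actV) IH etaX !(sactM actV).
have nz_c : c != 0.
  apply: contra e_neq0 => /eqP c0; rewrite -(inj_eq (@perm_inj _ phi)) !Ephi c0.
  by rewrite !(sact0l actV).
have sz_c : (sksize c <= 1)%N.
  have nz_p : (C x * X) ^+ s.-1 != 0.
    rewrite skew_powCX skmul_eq0 negb_or skXn_neq0 andbT -(rmorph0 C).
    by rewrite (inj_eq (@skewC_inj _ _)) skew_norm_neq0.
  have sz_p : sksize ((C x * X) ^+ s.-1) = s.
    have nz_N : C (skew_norm sigma s.-1 x) != 0.
      by rewrite -(rmorph0 C) (inj_eq (@skewC_inj _ _)) skew_norm_neq0.
    have sz_N : sksize (C (skew_norm sigma s.-1 x)) = 1%N.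
      by apply/eqP; rewrite eqn_leq sksizeC_leq lt0n sksize_eq0.
    by rewrite skew_powCX sksize_mul ?skXn_neq0 // sz_N sksizeXn /= prednK // ltnW.
  have E : G (X ^+ s.-1) = c * (C x * X) ^+ s.-1.
    apply: act_injG => [||v].
    - by rewrite (leq_trans (szG _)) ?leq_addr.
    - by apply: sz_mul; rewrite ?szG ?sz_p.
    by rewrite -isotG // Ephi etaXi (sactM actV).
  by have := szG (X ^+ s.-1); rewrite E sksize_mul // sz_p; move: s_gt1; lia.
exists (skcoef c 0) => [|v]; last by rewrite -(sksize_leq1 sz_c).
by apply: contra nz_c => /eqP c0; rewrite (sksize_leq1 sz_c) c0 rmorph0.
Qed.

End Autotopism.

(** * The action of E on V *)

Variables (E : finFieldType) (kE : {rmorphism K -> E}) (u : E).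
Hypotheses (u_root : root (map_poly kE F) u) (cardE : #|E| = (#|K| ^ s)%N).
Implicit Types (k : K).

Definition evE P : E := (map_poly kE P).[u].

Fact evE_is_zmod_morphism : zmod_morphism evE.
Proof. by move=> P Q; rewrite /evE rmorphB hornerD hornerN. Qed.

Fact evE_is_monoid_morphism : monoid_morphism evE.
Proof. by split=> [|P Q]; rewrite /evE ?rmorph1 ?hornerC // rmorphM hornerM. Qed.

HB.instance Definition _ := GRing.isZmodMorphism.Build {poly K} E evE evE_is_zmod_morphism.
HB.instance Definition _ := GRing.isMonoidMorphism.Build {poly K} E evE evE_is_monoid_morphism.

Lemma evE_C k : evE k%:P = kE k. Proof. by rewrite /evE map_polyC hornerC. Qed.
Lemma evE_X : evE 'X = u. Proof. by rewrite /evE map_polyX hornerX. Qed.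
Lemma evE_F : evE F = 0. Proof. exact/eqP. Qed.

Lemma evE_eq0 P : (evE P == 0) = (F %| P).
Proof.
apply/eqP/idP => [P0 | /dvdpP[Q ->]]; last by rewrite rmorphM /= evE_F mulr0.
apply: contraT; rewrite -irreducible_poly_coprime // => /Bezout_eq1_coprimepP[[U W] /= EUW].
have /eqP := congr1 evE EUW.
by rewrite rmorphD !rmorphM rmorph1 /= evE_F P0 !mulr0 addr0 eq_sym oner_eq0.
Qed.

Lemma u_neq0 : u != 0.
Proof.
apply: contra irred_coef0_neq0 => /eqP u0.
by have := evE_F; rewrite /evE u0 horner_coef0 coef_map => /eqP; rewrite fmorph_eq0.
Qed.

Lemma act_cpoly_evE P Q v : evE P = evE Q -> act (cpoly P) v = act (cpoly Q) v.
Proof.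
move=> /eqP; rewrite -subr_eq0 -rmorphB evE_eq0 => /dvdpP[D EPQ].
apply/eqP; rewrite -subr_eq0 -(sactBl actV) -rmorphB EPQ rmorphM (sactM actV).
by rewrite actF (sact0r actV).
Qed.

(** Evaluation at u is injective in degree < s because F is the minimal polynomial of u; the two
    sides have q^s elements. *)
Lemma evE_surj x : exists2 P : {poly K}, (size P <= s)%N & evE P = x.
Proof.
pose h (P : {poly_s K}) := evE P.
have h_inj : injective h.
  move=> P Q /eqP; rewrite -subr_eq0 -rmorphB evE_eq0 => dvF.
  apply: val_inj; apply/eqP; rewrite -subr_eq0; apply: contraT => nz.
  have := dvdp_leq nz dvF; rewrite szF ltnNge.
  by rewrite (leq_trans (size_polyD _ _)) // geq_max size_polyN !size_npoly.
have cE : (#|E| <= #|{poly_s K}|)%N by rewrite cardE card_npoly.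
have [h' _ hK] := inj_card_bij h_inj cE.
by exists (h' x : {poly K}); [apply: size_npoly | apply: hK].
Qed.

(* E acts on V through representatives in K[X^n]. *)
Definition polE (x : E) : {poly K} := odflt 0 [pick P : {poly_s K} | evE (P : {poly K}) == x].

Lemma polEK x : evE (polE x) = x.
Proof.
have [P sP EP] := evE_surj x; rewrite /polE; case: pickP => [Q /eqP // | no].
by have := no (NPoly (sP : P \is a poly_of_size s)); rewrite /= EP eqxx.
Qed.

Definition Eact (x : E) (v : V) : V := act (cpoly (polE x)) v.

Lemma Eact_evE P v : Eact (evE P) v = act (cpoly P) v.
Proof. by apply: act_cpoly_evE; rewrite polEK. Qed.

Lemma Eact_kE k v : Eact (kE k) v = act (C (kappa k)) v.
Proof. by rewrite -evE_C Eact_evE cpolyC. Qed.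

Lemma Eact_u v : Eact u v = act (X ^+ n) v.
Proof. by rewrite -evE_X Eact_evE cpolyX. Qed.

Lemma EactDl x y v : Eact (x + y) v = Eact x v + Eact y v.
Proof. by rewrite -(polEK x) -(polEK y) -rmorphD !Eact_evE rmorphD (sactDl actV). Qed.

Lemma EactM x y v : Eact (x * y) v = Eact x (Eact y v).
Proof. by rewrite -(polEK x) -(polEK y) -rmorphM !Eact_evE rmorphM (sactM actV). Qed.

Lemma Eact1 v : Eact 1 v = v.
Proof. by rewrite -[1](rmorph1 evE) Eact_evE rmorph1 (sact1 actV). Qed.

Lemma EactDr x v w : Eact x (v + w) = Eact x v + Eact x w.
Proof. exact: (sactDr actV). Qed.

Lemma Eact0r x : Eact x 0 = 0.
Proof. exact: (sact0r actV). Qed.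

Lemma Eact0l v : Eact 0 v = 0.
Proof. by apply: (addrI (Eact 0 v)); rewrite -EactDl !addr0. Qed.

Lemma Eact_act x a v : Eact x (act a v) = act a (Eact x v).
Proof. by rewrite /Eact -!(sactM actV) cpoly_central. Qed.

Lemma Eact_inj x : x != 0 -> injective (Eact x).
Proof. by move=> nz_x v w /(congr1 (Eact x^-1)); rewrite -!EactM mulVf // !Eact1. Qed.

Lemma Eact_scalar_inj x y v : v != 0 -> Eact x v = Eact y v -> x = y.
Proof.
move=> nz_v Exy; apply/eqP; rewrite -subr_eq0; apply: contraLR nz_v => nz_xy.
rewrite negbK; apply/eqP; apply: (Eact_inj nz_xy); rewrite Eact0r.
apply: (addIr (Eact y v)); rewrite -EactDl subrK add0r //.
Qed.

Section SemilinearOverE.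

Variable eta : {perm V}.
Hypothesis etaD : forall v w, eta (v + w) = eta v + eta w.

Let eta0 : eta 0 = 0.
Proof. by apply: (addrI (eta 0)); rewrite -etaD !addr0. Qed.

Let etae_neq0 : eta e != 0. Proof. by rewrite -eta0 (inj_eq (@perm_inj _ eta)). Qed.

Definition semiE (rho : E -> E) := forall x v, eta (Eact x v) = Eact (rho x) (eta v).

Variable rho : E -> E.
Hypothesis eta_rho : semiE rho.

Lemma semiE_uniq x y : (forall v, eta (Eact x v) = Eact y (eta v)) -> rho x = y.
Proof. by move=> Exy; apply: (Eact_scalar_inj etae_neq0); rewrite -eta_rho Exy. Qed.

Lemma semiE_D x y : rho (x + y) = rho x + rho y.
Proof. by apply: semiE_uniq => v; rewrite !EactDl etaD !eta_rho. Qed.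

Lemma semiE_M x y : rho (x * y) = rho x * rho y.
Proof. by apply: semiE_uniq => v; rewrite !EactM !eta_rho. Qed.

Lemma semiE_1 : rho 1 = 1.
Proof. by apply: semiE_uniq => v; rewrite !Eact1. Qed.

End SemilinearOverE.

(** For the norm N of x, x sigma(N) = N sigma^n(x) = N x, so N is fixed by sigma. *)
Lemma skew_norm_fixed x : exists k, skew_norm sigma n x = kappa k.
Proof.
have [-> | nz_x] := eqVneq x 0.
  exists 0; rewrite rmorph0; case: (n) n_gt1 => // i _.
  by rewrite skew_normS mul0r.
apply: sigma_fixed; apply: (mulfI nz_x); rewrite -skew_normS.
by rewrite /skew_norm big_ord_recr /= sigma_n mulrC.
Qed.

Section DichotomySemilinear.

Variables (eta : {perm V}) (t2 : L -> L).
Hypothesis etaD : forall v w, eta (v + w) = eta v + eta w.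
Hypothesis eta_t : forall x v, eta (act (C x) v) = act (C (t2 x)) (eta v).

Lemma semilin_K k : exists k', t2 (kappa k) = kappa k'.
Proof.
apply: sigma_fixed; have tX := semilinX actV Vneq0 etaD (@perm_inj _ eta) eta_t.
by rewrite sigma_pow -tX -sigma_pow sigma_fixK.
Qed.

Lemma eta_twistX x : (forall v, eta (act X v) = act (C x * X) (eta v)) ->
  forall i v, eta (act (X ^+ i) v) = act (C (skew_norm sigma i x) * X ^+ i) (eta v).
Proof.
move=> etaX i v; rewrite -skew_powCX.
elim: i v => [|i IH] v; first by rewrite !expr0 !(sact1 actV).
by rewrite exprSr exprSr (sactM actV) IH etaX !(sactM actV).
Qed.

Lemma eta_u_plus x k : (forall v, eta (act X v) = act (C x * X) (eta v)) ->
  skew_norm sigma n x = kappa k -> forall v, eta (Eact u v) = Eact (kE k * u) (eta v).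
Proof.
by move=> etaX Ec v; rewrite Eact_u (eta_twistX etaX) Ec EactM Eact_kE Eact_u (sactM actV).
Qed.

(** X^2 eta X^2 = X x eta X = sigma(x) X eta X = sigma(x) x eta, and X^2 acts as u; hence u eta u =
    k eta. *)
Lemma eta_u_minus x k : n = 2%N -> (forall v, act X (eta (act X v)) = act (C x) (eta v)) ->
  skew_norm sigma n x = kappa k -> forall v, eta (Eact u v) = Eact (kE k / u) (eta v).
Proof.
move=> n2 etaX Ec v.
have nz_u := u_neq0.
apply: (Eact_inj nz_u); rewrite -EactM mulrC divfK //.
rewrite Eact_kE -Ec !Eact_u n2 !expr2 !(sactM actV) etaX.
rewrite -(sactM actV) skX_C (sactM actV) etaX -(sactM actV) -rmorphM.
congr (act (C _) _).
by rewrite !skew_normS /skew_norm big_ord0 rmorph1 mulr1 mulrC.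
Qed.

(** E = K[u], and eta is already semilinear over K through [t2]; prescribing its behaviour at u
    extends this by induction on polynomials. *)
Lemma semiE_exists y : (forall v, eta (Eact u v) = Eact y (eta v)) ->
  exists2 rho : E -> E, semiE eta rho & rho u = y.
Proof.
move=> eta_u.
have exP P : exists z, forall v, eta (act (cpoly P) v) = Eact z (eta v).
  elim/poly_ind: P => [|P k [z Ez]].
    exists 0 => v; rewrite rmorph0 (sact0l actV) Eact0l.
    by apply: (addrI (eta 0)); rewrite -etaD !addr0.
  have [k' Ec'] := semilin_K k.
  exists (z * y + kE k') => v; rewrite rmorphD rmorphM (sactDl actV) (sactM actV) etaD Ez.
  rewrite EactDl EactM cpolyX -Eact_u eta_u; congr (_ + _).
  by rewrite cpolyC eta_t Ec' Eact_kE.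
have [rho rhoP] := fin_all_exists (fun x => exP (polE x)).
exists rho => [x v|]; first by rewrite rhoP.
by apply: (semiE_uniq etaD (rho := rho)) => // x v; rewrite rhoP.
Qed.

End DichotomySemilinear.

Hypothesis sigma_gal : forall t : L -> L, (forall x y, t (x + y) = t x + t y) ->
  (forall x y, t (x * y) = t x * t y) -> (forall k, t (kappa k) = kappa k) ->
  exists j : 'I_n, forall x, t x = iter j sigma x.
Hypothesis hilbert90 : forall x, skew_norm sigma n x = 1 -> exists2 y, y != 0 & x = y / sigma y.

(* F(X^n) = f g, and by faithfulness some y = g v0 is nonzero; it is killed by f,
   so v |-> (vpoly v) y is an isomorphism for the two actions. *)
Lemma skolem_noether (act' : R -> V -> V) :
    skew_action act' -> (forall v, act' (cpoly F) v = 0) ->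
  exists eta : {perm V}, (forall v w, eta (v + w) = eta v + eta w) /\
    forall a v, eta (act a v) = act' a (eta v).
Proof.
move=> actV' actF'; have [g Eg] := f_dvd.
have nz_f := f_neq0 szf.
(* Centrality of F(X^n) = g f gives (f g) f = f (g f) = F(X^n) f, and f cancels. Thus f kills every
   vector g v0. *)
have fg : f * g = cpoly F.
  apply: (skmulIr nz_f); rewrite -mulrA -Eg -cpoly_central //.
have nzF : cpoly F != 0 by rewrite cpoly_eq0 ?monic_neq0.
have nz_g : g != 0 by apply: contra nzF => /eqP g0; rewrite Eg g0 mul0r.
have sz_g : (sksize g <= n * s)%N.
  have := sksize_mul nz_g nz_f; rewrite -Eg szf sksize_cF.
  by move: s_gt1; lia.
have [/existsP[v0 nz_y] | ] := boolP [exists v, act' g v != 0]; last first.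
  rewrite negb_exists => /forallP g0; case/eqP: nz_g.
  apply: (sact_faithful actV' actF' Vneq0 sz_g).
  by move=> v; apply/eqP/negPn.
set y := act' g v0 in nz_y.
have fy : act' f y = 0 by rewrite -(sactM actV') fg actF'.
pose h v := act' (vpoly v) y.
have h_act a v : h (act a v) = act' a (h v).
  have [c Ec] := rmodP f_monic szf (a * vpoly v).
  by rewrite /h -(sactM actV') [in RHS]Ec (sactDl actV') (sactM actV') fy (sact0r actV') add0r.
have hB v w : h (v - w) = h v - h w by rewrite /h vpolyB (sactBl actV').
have h_inj : injective h.
  move=> v w /eqP; rewrite -subr_eq0 -hB => /eqP hvw; apply/eqP; rewrite -subr_eq0.
  apply: contraT => nz_vw; have [a Ea] := cyc_simple f_monic szf f_irr nz_vw.
  have := h_act a (v - w); rewrite Ea hvw (sact0r actV') /h vpoly_one // (sact1 actV').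
  by move/eqP; rewrite (negPf nz_y).
exists (perm h_inj); split=> [v w | a v]; rewrite !permE //.
by rewrite /h vpolyD (sactDl actV').
Qed.

Definition autot (phi gam eta : {perm V}) : Prop :=
  [/\ forall v w, phi (v + w) = phi v + phi w, forall v w, gam (v + w) = gam v + gam w,
      forall v w, eta (v + w) = eta v + eta w &
      forall v w, phi (act (vpoly v) w) = act (vpoly (gam v)) (eta w)].

Let skcoef_vD v w i : skcoef (vpoly (v + w)) i = skcoef (vpoly v) i + skcoef (vpoly w) i.
Proof. by rewrite vpolyD skcoefD. Qed.

Let vpoly_expand v : vpoly v = \sum_(i < s) C (skcoef (vpoly v) i) * X ^+ i.
Proof. by rewrite {1}(skexpand_leq (sksize_vpoly v)). Qed.

Let act_mk (h : nat -> L) w : act (vpoly (mk_npoly s h)) w =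
  \sum_(i < s) act (C (h i)) (act (X ^+ i) w).
Proof.
rewrite vpoly_expand (sact_suml actV); apply: eq_bigr => i _.
by rewrite (sactM actV) /skcoef coef_poly ltn_ord.
Qed.

Let mk_npolyE (h : nat -> L) i : (i < s)%N -> skcoef (vpoly (mk_npoly s h)) i = h i.
Proof. by move=> lt_i; rewrite /skcoef coef_poly lt_i. Qed.

Let vP v w : (forall i, (i < s)%N -> skcoef (vpoly v) i = skcoef (vpoly w) i) -> v = w.
Proof.
move=> Evw; apply: (@vpoly_inj _ sigma); apply: skcoefP => i; case: (ltnP i s) => [/Evw // | le_i].
by rewrite !skcoef_nil // (leq_trans (sksize_vpoly _)).
Qed.

(** * Autotopisms over a given automorphism of E *)

Section BasePoint.

Variables (tau : {rmorphism L -> L}) (rho : {rmorphism E -> E}) (tauK : K -> K).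
Hypotheses (tau_K : forall k, tau (kappa k) = kappa (tauK k)).
Hypotheses (rho_K : forall k, rho (kE k) = kE (tauK k)).

Let tau_sigma y : tau (sigma y) = sigma (tau y).
Proof. by rewrite !sigma_pow rmorphXn. Qed.

(* x' is the operator through which X acts in the twisted module structure:
   x X in the plus case, X^-1 x in the minus case. *)
Section TwistedOperator.

Variable x' : V -> V.
Hypotheses (x'D : forall v w, x' (v + w) = x' v + x' w).
Hypotheses (x'C : forall y v, x' (act (C (tau y)) v) = act (C (tau (sigma y))) (x' v)).
Hypothesis x'_n : forall v, iter n x' v = Eact (rho u) v.

Let act' : R -> V -> V := op_act (fun y => act (C (tau y))) x'.

Let actV' : skew_action act'.
Proof.
apply: op_act_action => //.
- by move=> y z v; rewrite !rmorphD (sactDl actV).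
- by move=> y v w; rewrite (sactDr actV).
- by move=> y z v; rewrite !rmorphM (sactM actV).
- by move=> v; rewrite !rmorph1 (sact1 actV).
Qed.

Let act'X i v : act' (X ^+ i) v = iter i x' v.
Proof.
elim: i => [|i IH]; first by rewrite expr0 (sact1 actV').
rewrite exprS (sactM actV') IH /act' op_actX //.
- by move=> y z w; rewrite !rmorphD (sactDl actV).
- by move=> w; rewrite !rmorph1 (sact1 actV).
Qed.

Let act'C y v : act' (C y) v = act (C (tau y)) v.
Proof. by rewrite /act' op_actC // => z t w; rewrite !rmorphD (sactDl actV). Qed.

(** When L acts through [tau] and X through [x'], the central element P(X^n) acts as rho(P(u)). So
    F(X^n) acts as 0 and the twisted module is isomorphic to V. *)
Lemma base_eta : exists eta : {perm V},
  [/\ forall v w, eta (v + w) = eta v + eta w, semiE eta rho &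
      forall v w, eta (act (vpoly v) w) =
        \sum_(i < s) act (C (tau (skcoef (vpoly v) i))) (iter i x' (eta w))].
Proof.
have actP P v : act' (cpoly P) v = Eact (rho (evE P)) v.
  elim/poly_ind: P => [|P k IH]; first by rewrite !rmorph0 (sact0l actV') Eact0l.
  rewrite !rmorphD !rmorphM /= (sactDl actV') EactDl evE_C cpolyC act'C tau_K rho_K Eact_kE.
  congr (_ + _); rewrite cpoly_central // (sactM actV') cpolyX act'X IH x'_n.
  by rewrite evE_X -EactM mulrC.
have actF' v : act' (cpoly F) v = 0.
  by rewrite actP (_ : evE F = 0) ?rmorph0 ?Eact0l //; apply: evE_F.
have [eta [etaD eta_act]] := skolem_noether actV' actF'; exists eta; split=> // [x v | v w].
  by rewrite eta_act actP polEK.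
rewrite eta_act /act' (@op_act_widen _ _ _ _ _ _ s) ?sksize_vpoly // => y z w'.
by rewrite !rmorphD (sactDl actV).
Qed.

End TwistedOperator.

(** Let X act as x X, whose n-th power is N(x) u = rho u. The intertwiner eta carries v to the sum
    of tau(v_i) (x X)^i, a polynomial of degree < s again, so phi = eta is admissible and the
    coefficients of gamma are tau(v_i) times partial norms. *)
Lemma base_point_plus x k : k != 0 -> rho u = kE k * u -> skew_norm sigma n x = kappa k ->
  exists phi gam eta, autot phi gam eta /\ semiE eta rho.
Proof.
move=> nz_k rho_u norm_x.
have nz_x : x != 0.
  apply: contra nz_k => /eqP x0; move: norm_x; rewrite x0; case: (n) n_gt1 => // i _.
  by rewrite skew_normS mul0r => /esym/eqP; rewrite fmorph_eq0.
pose x' v := act (C x * X) v.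
have itx' i v : iter i x' v = act (C (skew_norm sigma i x) * X ^+ i) v.
  rewrite -skew_powCX; elim: i => [|i IH] /=; first by rewrite expr0 (sact1 actV).
  by rewrite IH /x' -(sactM actV) -exprS.
have [|y v|v|eta [etaD eta_rho eta_act]] := @base_eta x'.
- by move=> v w; rewrite /x' (sactDr actV).
- by rewrite /x' -!(sactM actV) -mulrA skX_C !mulrA -!rmorphM tau_sigma mulrC.
- by rewrite itx' norm_x (sactM actV) rho_u EactM Eact_kE Eact_u.
pose h v : V := mk_npoly s (fun i => tau (skcoef (vpoly v) i) * skew_norm sigma i x).
have h_inj : injective h.
  move=> v w hvw; apply: vP => i lt_i; apply: (fmorph_inj tau).
  apply: (mulIf (skew_norm_neq0 sigma i nz_x)).
  by have := congr1 (fun v => skcoef (vpoly v) i) hvw; rewrite !mk_npolyE.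
exists eta, (perm h_inj), eta; split=> //; split=> // v w.
  rewrite !permE; apply: vP => i lt_i; rewrite skcoef_vD !mk_npolyE //.
  by rewrite skcoef_vD rmorphD mulrDl.
rewrite eta_act permE act_mk; apply: eq_bigr => i _.
by rewrite itx' rmorphM !(sactM actV).
Qed.

(* phi = X^(s-1) eta clears the negative powers of X. *)
Lemma base_point_minus x k : n = 2%N -> k != 0 -> rho u = kE k / u ->
    skew_norm sigma n x = kappa k ->
  exists phi gam eta, autot phi gam eta /\ semiE eta rho.
Proof.
move=> n2 nz_k rho_u norm_x.
have nz_x : x != 0.
  apply: contra nz_k => /eqP x0; move: norm_x; rewrite x0 n2.
  by rewrite skew_normS mul0r => /esym/eqP; rewrite fmorph_eq0.
pose x' v := invF X_inj (act (C x) v).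
have Xx' v : act X (x' v) = act (C x) v by apply: f_invF.
have Xx'i i v : act (X ^+ i) (iter i x' v) = act (C (skew_norm sigma i x)) v.
  elim: i v => [|i IH] v.
    by rewrite /skew_norm big_ord0 rmorph1 expr0.
  rewrite iterS exprSr (sactM actV) Xx' -(sactM actV) skXn_C (sactM actV) IH -(sactM actV) -rmorphM.
  by congr (act (C _) v); rewrite /skew_norm big_ord_recr /= mulrC.
have [|y v|v|eta [etaD eta_rho eta_act]] := @base_eta x'.
- by move=> v w; apply: X_inj; rewrite (sactDr actV) !Xx' (sactDr actV).
(* The operator X^-1 x is semilinear for the inverse of sigma, which equals sigma because n = 2. *)
- apply: X_inj; rewrite Xx' -(sactM actV) -[in RHS](sactM actV) skX_C [in RHS](sactM actV) Xx'.
  rewrite -(sactM actV) -!rmorphM; congr (act (C _) _).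
  by rewrite tau_sigma -[sigma (sigma _)]/(iter 2 sigma (tau y)) -n2 sigma_n mulrC.
- apply: (Eact_inj u_neq0); rewrite Eact_u Xx'i norm_x rho_u -EactM.
  by rewrite mulrC divfK ?u_neq0 // Eact_kE.
(* Since X^i (X^-1 x)^i is the partial norm N_i(x), the product X^(s-1) tau(v_i) (X^-1 x)^i is a
   monomial of degree j = s - 1 - i; its coefficient is the one given here. *)
pose h v : V := mk_npoly s (fun j => iter s.-1 sigma (tau (skcoef (vpoly v) (s.-1 - j))) *
   iter j sigma (skew_norm sigma (s.-1 - j) x)).
have h_inj : injective h.
  move=> v w hvw; apply: vP => i lt_i; apply: (fmorph_inj tau).
  have lt_j : (s.-1 - i < s)%N by rewrite (leq_ltn_trans (leq_subr _ _)) // prednK // ltnW.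
  have Ei : (s.-1 - (s.-1 - i) = i)%N by rewrite subKn // -ltnS prednK // ltnW.
  apply: (@iter_sigma_inj s.-1).
  have nz_N : iter (s.-1 - i) sigma (skew_norm sigma i x) != 0.
    by rewrite iter_sigma_eq0 skew_norm_neq0.
  apply: (mulIf nz_N).
  by have := congr1 (fun v => skcoef (vpoly v) (s.-1 - i)) hvw; rewrite !mk_npolyE // Ei.
have phi_inj : injective (fun v => act (X ^+ s.-1) (eta v)).
  move=> v w; elim: (s.-1) => [|i IH]; first by rewrite !(sact1 actV) => /perm_inj.
  by rewrite exprS !(sactM actV) => /X_inj.
exists (perm phi_inj), (perm h_inj), eta; split=> //; split=> // v w; rewrite !permE.
- by rewrite etaD (sactDr actV).
- apply: vP => i lt_i; rewrite skcoef_vD !mk_npolyE //.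
  by rewrite skcoef_vD rmorphD iter_sigmaD mulrDl.
rewrite eta_act act_mk (sact_sumr actV).
rewrite [RHS](reindex_inj rev_ord_inj) /=; apply: eq_bigr => i _.
have -> : (s - i.+1 = s.-1 - i)%N by rewrite -subn1 -subnDA add1n.
have le_i : (i <= s.-1)%N by rewrite -ltnS prednK // ltnW.
rewrite subKn // -(sactM actV) skXn_C (sactM actV) [in RHS]rmorphM [in RHS](sactM actV).
congr (act _ _); rewrite -[in X ^+ s.-1](subnK le_i) exprD (sactM actV) Xx'i.
by rewrite -!(sactM actV) skXn_C.
Qed.

End BasePoint.

Hypothesis u_nexc : n = 2%N -> forall k, u * u != kE k.

Let norm_neq0 x k : x != 0 -> skew_norm sigma n x = kappa k -> k != 0.
Proof.
move=> nz_x Ek; apply: contraTneq (skew_norm_neq0 sigma n nz_x) => k0.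
by rewrite Ek k0 rmorph0 eqxx.
Qed.

Lemma autot_semiE phi gam eta : autot phi gam eta -> exists2 rho, semiE eta rho &
  (exists2 k, k != 0 & rho u = kE k * u) \/
  (n = 2%N /\ exists2 k, k != 0 & rho u = kE k / u).
Proof.
case=> phiD gamD etaD isot.
have [t2 [eta_t [[x nz_x etaX] | [n2 [x nz_x etaX]]]]] := autotopism_dichotomy gamD etaD isot.
  have [k Ek] := skew_norm_fixed x.
  have eta_u v : eta (Eact u v) = Eact (kE k * u) (eta v) by eapply eta_u_plus; eassumption.
  have [rho semi rho_u] : exists2 rho, semiE eta rho & rho u = kE k * u.
    by eapply semiE_exists; eassumption.
  by exists rho => //; left; exists k => //; apply: norm_neq0 Ek.
have [k Ek] := skew_norm_fixed x.
have eta_u v : eta (Eact u v) = Eact (kE k / u) (eta v) by eapply eta_u_minus; eassumption.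
have [rho semi rho_u] : exists2 rho, semiE eta rho & rho u = kE k / u.
  by eapply semiE_exists; eassumption.
by exists rho => //; right; split=> //; exists k => //; apply: norm_neq0 Ek.
Qed.

(** * Autotopisms that are linear over E *)

Definition kernel_op y (j : nat) (eps : E) v : V := act (C y * X ^+ j) (Eact eps v).

Lemma kernel_op0 y j eps : kernel_op y j eps 0 = 0.
Proof. by rewrite /kernel_op Eact0r (sact0r actV). Qed.

Lemma kernel_op_inj y j eps : y != 0 -> eps != 0 -> injective (kernel_op y j eps).
Proof.
move=> nz_y nz_eps v w; rewrite /kernel_op !(sactM actV) => /(sactC_inj actV nz_y).
have Xi : injective (act (X ^+ j)).
  elim: j => [|j IH] v' w'; first by rewrite !expr0 !(sact1 actV).
  by rewrite exprS !(sactM actV) => /X_inj/IH.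
by move/Xi/(Eact_inj nz_eps).
Qed.

(* T = y X^j has the same semilinearity as eta over L and over X, so T^-1 eta lies
   in the commutant. *)
Lemma kernel_form phi gam eta : autot phi gam eta -> semiE eta id ->
  exists z y (j : 'I_n) eps, [/\ z != 0, y != 0, eps != 0,
    forall v, eta v = kernel_op y j eps v & forall v, phi v = act (C z) (eta v)].
Proof.
move=> aut semi; have [phiD gamD etaD isot] := aut.
have [t2 [eta_t dich]] := autotopism_dichotomy gamD etaD isot.
have eta0 : eta 0 = 0 by apply: (addrI (eta 0)); rewrite -etaD !addr0.
have etae : eta e != 0 by rewrite -eta0 (inj_eq (@perm_inj _ eta)).
have t2K k : t2 (kappa k) = kappa k.
  by apply: (sact_scalar_inj actV etae); rewrite -eta_t -Eact_kE semi Eact_kE.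
have [j Ej] := sigma_gal (semilinD actV Vneq0 etaD (@perm_inj _ eta) eta_t)
  (semilinM actV Vneq0 etaD (@perm_inj _ eta) eta_t) t2K.
have [x nz_x etaX] : exists2 x, x != 0 & forall v, eta (act X v) = act (C x * X) (eta v).
  (* In the second case eta sends multiplication by u to k / u, and E-linearity would force u^2 = k
     in K. *)
  case: dich => // -[n2 [x nz_x etaX]].
  have [k Ek] := skew_norm_fixed x.
  have eta_u v : eta (Eact u v) = Eact (kE k / u) (eta v) by eapply eta_u_minus; eassumption.
  have Eu' : u = kE k / u by apply: (Eact_scalar_inj etae); rewrite -eta_u semi.
  by have /eqP[] := u_nexc n2 k; rewrite {1}Eu' divfK ?u_neq0.
have [k Ek] := skew_norm_fixed x.
have eta_u v : eta (Eact u v) = Eact (kE k * u) (eta v) by eapply eta_u_plus; eassumption.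
have k1 : k = 1.
  apply: (fmorph_inj kE); apply: (mulIf u_neq0); rewrite rmorph1 mul1r.
  by apply: (Eact_scalar_inj etae); rewrite -eta_u semi.
have [y nz_y Ey] : exists2 y, y != 0 & x = y / sigma y by apply: hilbert90; rewrite Ek k1 rmorph1.
have nz_sy : sigma y != 0 by rewrite fmorph_eq0.
pose T := kernel_op y j 1.
have T_inj : injective T by apply: kernel_op_inj => //; apply: oner_neq0.
have TE v : T v = act (C y * X ^+ j) v by rewrite /T /kernel_op Eact1.
have T_C (c : L) v : T (act (C c) v) = act (C (iter j sigma c)) (T v).
  by rewrite !TE -!(sactM actV) -mulrA skXn_C !mulrA -!rmorphM mulrC.
have T_X v : T (act X v) = act (C x * X) (T v).
  rewrite !TE -!(sactM actV) -!mulrA -exprSr [X * _]mulrA skX_C -mulrA -exprS mulrA -rmorphM.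
  by rewrite Ey divfK.
pose d v := invF T_inj (eta v).
have Td v : T (d v) = eta v by apply: f_invF.
have dC (c : L) v : d (act (C c) v) = act (C c) (d v).
  by apply: (T_inj); rewrite T_C !Td eta_t Ej.
have dX v : d (act X v) = act X (d v) by apply: (T_inj); rewrite T_X !Td etaX.
have dD v w : d (v + w) = d v + d w.
  by apply: (T_inj); rewrite Td TE (sactDr actV) -!TE !Td etaD.
have d0 : d 0 = 0 by apply: (addrI (d 0)); rewrite -dD !addr0.
have d_act a v : d (act a v) = act a (d v).
  have dXi i w : d (act (X ^+ i) w) = act (X ^+ i) (d w).
    elim: i w => [|i IH] w; first by rewrite expr0 !(sact1 actV).
    by rewrite exprS !(sactM actV) dX IH.
  rewrite [a]skexpand !(sact_suml actV) (big_morph d dD d0).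
  by apply: eq_bigr => i _; rewrite !(sactM actV) dC dXi.
have [P EP] : exists P, forall v, d v = act (cpoly P) v by eapply cyc_commutant; eassumption.
have [z nz_z Ez] : exists2 z, z != 0 & forall v, phi v = act (C z) (eta v).
  exact: (autotopism_phi_scalar isot nz_x etaX).
exists z, y, j, (evE P); split=> //.
  apply: contra etae => /eqP ev0.
  by rewrite -Td EP -Eact_evE ev0 Eact0l TE (sact0r actV).
by move=> v; rewrite /kernel_op Eact_evE -EP -TE Td.
Qed.

Lemma kernel_autot z y j eps : z != 0 -> y != 0 -> eps != 0 ->
  exists phi gam eta, [/\ autot phi gam eta, semiE eta id,
    forall v, eta v = kernel_op y j eps v & forall v, phi v = act (C z) (eta v)].
Proof.
move=> nz_z nz_y nz_eps.
have eta_inj := @kernel_op_inj y j eps nz_y nz_eps.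
pose eta : {perm V} := perm eta_inj.
have phi_inj : injective (fun v => act (C z) (eta v)).
  by move=> v w /(sactC_inj actV nz_z)/perm_inj.
(* These are the coefficients of z T a T^-1 for T = y X^j: conjugation by T turns a_i X^i into y
   sigma^j(a_i) X^i y^-1. The factor [eps] commutes with R and drops out. *)
pose h v : V := mk_npoly s (fun i => z * (y * iter j sigma (skcoef (vpoly v) i) / iter i sigma y)).
have nz_iy i : iter i sigma y != 0 by rewrite iter_sigma_eq0.
have h_inj : injective h.
  move=> v w hvw; apply: vP => i lt_i; apply: (@iter_sigma_inj j).
  have := congr1 (fun v => skcoef (vpoly v) i) hvw; rewrite !mk_npolyE //.
  by move/(mulfI nz_z)/(mulIf (invr_neq0 (nz_iy i)))/(mulfI nz_y).
exists (perm phi_inj), (perm h_inj), eta; split=> [|x v||v]; last by rewrite permE.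
- split=> v w; rewrite !permE.
  + by rewrite /kernel_op EactDr !(sactDr actV).
  + apply: vP => i lt_i; rewrite vpolyD skcoefD !mk_npolyE //.
    by rewrite vpolyD skcoefD iter_sigmaD mulrDr mulrDl mulrDr.
  + by rewrite /kernel_op EactDr (sactDr actV).
  rewrite /kernel_op Eact_act; move: (Eact eps w) => w'; rewrite -!(sactM actV); congr (act _ _).
  apply: skcoefP => i; rewrite -!mulrA [vpoly _ * (_ * _)]mulrA !skcoef_Cl skcoef_Xnl skcoef_Xnr.
  case: ltnP => _; first by rewrite !mulr0.
  rewrite skcoef_Cr; case: (ltnP (i - j) s) => [lt_i | le_i].
    by rewrite mk_npolyE // -!mulrA mulVf ?mulr1.
  by rewrite !skcoef_nil ?(leq_trans (sksize_vpoly _)) // iter_sigma0 !mulr0 mul0r.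
- by rewrite !permE /kernel_op [RHS]Eact_act; congr (act _ _); rewrite -!EactM mulrC.
- by move=> v; rewrite permE.
Qed.

(** * Counting the autotopisms *)

Section Count.

(** Semilinearity over L recovers j. After X^j is cancelled, y' / y in L and eps / eps' in E are the
    same operator; by faithfulness the constant y' / y is a central polynomial, hence in K. *)
Lemma kernel_op_eq (y y' : L) (j j' : 'I_n) (eps eps' : E) :
    y != 0 -> y' != 0 -> eps != 0 -> eps' != 0 ->
    (forall v, kernel_op y j eps v = kernel_op y' j' eps' v) ->
  j = j' /\ exists2 k, k != 0 & y' = kappa k * y /\ eps' = eps / kE k.
Proof.
move=> nz_y nz_y' nz_eps nz_eps' Eop.
have opC (z : L) (i : nat) (d : E) (c : L) v :
    kernel_op z i d (act (C c) v) = act (C (iter i sigma c)) (kernel_op z i d v).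
  rewrite /kernel_op Eact_act; move: (Eact d v) => w.
  by rewrite -!(sactM actV) -mulrA skXn_C !mulrA -!rmorphM mulrC.
have nz_op : kernel_op y j eps e != 0.
  by rewrite -(kernel_op0 y j eps) (inj_eq (kernel_op_inj nz_y nz_eps)).
have Ej : j = j'.
  suff : j = j' %[mod n] by rewrite !modn_small // => /val_inj.
  apply: iter_sigma_eqmod => c.
  by apply: (sact_scalar_inj actV nz_op); rewrite -opC Eop opC -Eop.
split=> //; rewrite -{}Ej in Eop.
have Xj_inj : injective (act (X ^+ j)).
  elim: (j : nat) => [|i IH] v w; first by rewrite !expr0 !(sact1 actV).
  by rewrite exprS !(sactM actV) => /X_inj/IH.
have E1' w : act (C y) (Eact eps w) = act (C y') (Eact eps' w).
  have := Eop (invF Xj_inj w); rewrite /kernel_op !(sactM actV).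
  by rewrite -!Eact_act f_invF.
have Ew w : act (C (y' / y)) w = Eact (eps / eps') w.
  have := E1' (Eact eps'^-1 w); rewrite -!EactM mulfV // Eact1 => E2.
  by rewrite mulrC rmorphM (sactM actV) -E2 -(sactM actV) -rmorphM mulVf // rmorph1 (sact1 actV).
have [P sP EP] : exists2 P : {poly K}, (size P <= s)%N & evE P = eps / eps'.
  by eapply evE_surj; eassumption.
have EC : C (y' / y) = cpoly P.
  apply: act_inj => [||v].
  - apply: leq_trans (sksizeC_leq _ _) _; rewrite muln_gt0 n_gt0; exact: ltnW.
  - by eapply sksize_cpoly_leq; eassumption.
  by rewrite Ew -EP Eact_evE.
have [k Ek] := skewC_eq_cpoly EC.
have Ek' : eps / eps' = kE k by apply: (Eact_scalar_inj e_neq0); rewrite -Ew Ek Eact_kE.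
exists k; last by split; rewrite -?Ek -?Ek' ?divfK // invf_div mulrC divfK.
apply/eqP => k0; move/eqP: Ek'; rewrite k0 rmorph0 mulf_eq0 invr_eq0.
by rewrite (negPf nz_eps) (negPf nz_eps').
Qed.

Lemma kernel_op_scale (y : L) (j : nat) (eps : E) k v : k != 0 ->
  kernel_op (kappa k * y) j (eps / kE k) v = kernel_op y j eps v.
Proof.
move=> nz_k; rewrite /kernel_op; have nz_k' : kE k != 0 by rewrite fmorph_eq0.
rewrite rmorphM -mulrA (sactM actV) -Eact_kE Eact_act; congr (act _ _).
by rewrite -EactM mulrC divfK.
Qed.

Local Notation T3 := ({perm V} * {perm V} * {perm V})%type.
Local Notation PT := (L * L * 'I_n * E)%type.
Variable A : {set T3}.
Hypothesis A_autot : forall phi gam eta, (phi, gam, eta) \in A <-> autot phi gam eta.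

(** As an operator, gamma(v) is phi v eta^-1, and the action is faithful in degree < s. *)
Lemma autot_gam_uniq phi gam gam' eta : autot phi gam eta -> autot phi gam' eta -> gam = gam'.
Proof.
case=> _ _ _ isot [_ _ _ isot']; apply/permP => v; apply: (@vpoly_inj _ sigma).
have le_sns : (s <= n * s)%N by rewrite leq_pmull.
apply: act_inj; rewrite ?(leq_trans (sksize_vpoly _)) // => w.
by rewrite -[w](permKV eta) -isot isot'.
Qed.

Definition kernel : {set T3} :=
  [set t in A | [forall x : E, forall v : V, t.2 (Eact x v) == Eact x (t.2 v)]].

Lemma kernelP phi gam eta :
  reflect (autot phi gam eta /\ semiE eta id) ((phi, gam, eta) \in kernel).
Proof.
rewrite inE; apply: (iffP andP) => [[/A_autot aut /forallP h] | [/A_autot At semi]].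
  by split=> // x v; apply/eqP; move/forallP: (h x).
by split=> //; apply/forallP => x; apply/forallP => v; apply/eqP; apply: semi.
Qed.

(** Only phi and eta are constrained, since they determine gamma. *)
Definition kparam (p : PT) (t : T3) : bool :=
  let: (z, y, j, eps) := p in
  [forall v, t.2 v == kernel_op y j eps v] && [forall v, t.1.1 v == act (C z) (t.2 v)].

Definition kparams : {set PT} :=
  [set p : PT | [&& p.1.1.1 != 0, p.1.1.2 != 0 & p.2 != 0]].

Lemma kparamP (z y : L) (j : 'I_n) (eps : E) (phi gam eta : {perm V}) :
  reflect ((forall v, eta v = kernel_op y j eps v) /\ forall v, phi v = act (C z) (eta v))
    (kparam (z, y, j, eps) (phi, gam, eta)).
Proof.
apply: (iffP andP) => -[h1 h2]; split.
- by move=> v; apply/eqP; move/forallP: h1.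
- by move=> v; apply/eqP; move/forallP: h2.
- by apply/forallP => v; apply/eqP.
- by apply/forallP => v; apply/eqP.
Qed.

Lemma card_kparams : #|kparams| = ((#|L|.-1) ^ 2 * n * #|E|.-1)%N.
Proof.
have -> : kparams = setX (setX (setX [set~ 0] [set~ 0]) setT) [set~ 0].
  by apply/setP => -[[[z y] j] eps]; rewrite !inE /= andbT andbA.
by rewrite !cardsX !cardsC1 cardsT card_ord mulnn.
Qed.

(* Double counting of the pairs (parameters, kernel element): each parameter
   describes one element, and each element has #|K^*| parameters. *)
Lemma card_kernel : (#|kernel| * #|K|.-1 = (#|L|.-1) ^ 2 * n * #|E|.-1)%N.
Proof.
rewrite -card_kparams -[RHS]sum1_card.
have -> : (\sum_(p in kparams) 1 = \sum_(p in kparams) \sum_(t in kernel) kparam p t)%N.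
  apply: eq_bigr => -[[[z y] j] eps]; rewrite inE /= => /and3P[nz_z nz_y nz_eps].
  have [phi [gam [eta [aut semi Eeta Ephi]]]] : exists phi gam eta,
    [/\ autot phi gam eta, semiE eta id, forall v, eta v = kernel_op y j eps v
      & forall v, phi v = act (C z) (eta v)].
    by eapply kernel_autot; eassumption.
  have kt : (phi, gam, eta) \in kernel by apply/kernelP.
  rewrite (bigD1 (phi, gam, eta)) //= big1 ?addn0 =>
    [|[[phi' gam'] eta'] /andP[/kernelP[aut' _] neq]].
    by apply/esym/eqP; rewrite eqb1; apply/kparamP.
  apply/eqP; rewrite eqb0; apply: contra neq => /kparamP[Eeta' Ephi'].
  have Eq : eta' = eta by apply/permP => v; rewrite Eeta Eeta'.
  have Ep : phi' = phi by apply/permP => v; rewrite Ephi Ephi' Eq.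
  by rewrite Eq Ep (@autot_gam_uniq phi gam' gam eta) // -{1}Ep -{1}Eq.
rewrite exchange_big /= -sum_nat_const; apply: eq_bigr => -[[phi gam] eta] kt.
have /kernelP[aut semi] := kt.
have [z [y [j [eps [nz_z nz_y nz_eps Eeta Ephi]]]]] : exists z y (j : 'I_n) eps,
    [/\ z != 0, y != 0, eps != 0, forall v, eta v = kernel_op y j eps v
      & forall v, phi v = act (C z) (eta v)].
  by eapply kernel_form; eassumption.
rewrite -big_mkcondr /= sum1_card.
have -> : #|K|.-1 = #|[set~ 0 : K]| by rewrite cardsC1.
pose h k : PT := (z, kappa k * y, j, eps / kE k).
have h_inj : injective h by move=> k k' [/(mulIf nz_y)/fmorph_inj].
rewrite -(card_imset _ h_inj); apply: eq_card => -[[[z' y'] j'] eps'].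
rewrite [RHS]unfold_in; apply/esym; apply/andP/imsetP => [[pk /kparamP[Eeta' Ephi']] | [k]].
  move: pk; rewrite inE => /and3P[/= nz_z' nz_y' nz_eps'].
  have [|<- [k nz_k [-> ->]]] := kernel_op_eq nz_y nz_y' nz_eps nz_eps' (j := j) (j' := j').
    by move=> v; rewrite -Eeta.
  exists k; rewrite ?inE // /h; congr (_, _, _, _).
  have nz_ee : eta e != 0.
    by rewrite Eeta -(kernel_op0 y j eps) (inj_eq (kernel_op_inj nz_y nz_eps)).
  by apply: (sact_scalar_inj actV nz_ee); rewrite -Ephi Ephi'.
rewrite !inE => nz_k [-> -> -> ->].
split; first by rewrite /= nz_z mulf_neq0 ?fmorph_eq0 //= mulf_neq0 ?invr_neq0 ?fmorph_eq0.
by apply/kparamP; split=> // v; rewrite kernel_op_scale.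
Qed.

Variables (T : finType) (app : T -> E -> E) (H : {set T}).
Hypothesis app_inj : forall r r', app r =1 app r' -> r = r'.
Hypothesis app_ring : forall g : E -> E, {morph g : x y / x + y} ->
  {morph g : x y / x * y} -> g 1 = 1 -> exists r, app r =1 g.
Hypothesis app_extends : forall r,
  exists (tau : {rmorphism L -> L}) (rho : {rmorphism E -> E}) (tauK : K -> K),
  [/\ forall k, tau (kappa k) = kappa (tauK k),
      forall k, rho (kE k) = kE (tauK k) & app r =1 rho].
Hypothesis H_app : forall r, r \in H <->
  (exists2 k, k != 0 & app r u = kE k * u) \/
  (n = 2%N /\ exists2 k, k != 0 & app r u = kE k / u).
Hypothesis norm_surj : forall k, k != 0 -> exists x, skew_norm sigma n x = kappa k.

Let H_sound phi gam eta : autot phi gam eta ->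
  exists2 r, r \in H & semiE eta (app r).
Proof.
move=> aut; have [rho semi rho_u] := autot_semiE aut; have [_ _ etaD _] := aut.
have [r Er] : exists r, app r =1 rho.
  by apply: app_ring (semiE_D etaD semi) (semiE_M etaD semi) (semiE_1 etaD semi).
by exists r => [|x v]; [apply/H_app; rewrite Er | rewrite Er].
Qed.

(** A base point needs a companion [tau] of rho on L and an element x of norm k; these come from
    [app_extends] and [norm_surj]. *)
Let H_complete r : r \in H ->
  exists phi gam eta, autot phi gam eta /\ semiE eta (app r).
Proof.
have [tau [rho [tauK [tau_K rho_K Er]]]] := app_extends r.
suff W : r \in H -> exists phi gam eta, autot phi gam eta /\ semiE eta rho.
  move=> /W[phi [gam [eta [aut semi]]]]; exists phi, gam, eta; split=> // x v.
  by rewrite Er.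
move=> /H_app[[k nz_k] | [n2 [k nz_k]]]; rewrite Er => rho_u.
  have [x Ex] := norm_surj nz_k; exact: (base_point_plus tau_K rho_K nz_k rho_u Ex).
have [x Ex] := norm_surj nz_k; exact: (base_point_minus tau_K rho_K n2 nz_k rho_u Ex).
Qed.

(* The fibre over each r in H is a coset of the kernel. *)
Lemma card_autot : (#|A| * #|K|.-1 = #|H| * ((#|L|.-1) ^ 2 * n * #|E|.-1))%N.
Proof.
rewrite -card_kernel mulnA; congr (_ * _)%N.
pose fib r := [set t in A | [forall x : E, forall v : V, t.2 (Eact x v) == Eact (app r x) (t.2 v)]].
have fibP r phi gam eta :
    reflect (autot phi gam eta /\ semiE eta (app r)) ((phi, gam, eta) \in fib r).
  rewrite inE; apply: (iffP andP) => [[/A_autot aut /forallP h] | [/A_autot At semi]].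
    by split=> // x v; apply/eqP; move/forallP: (h x).
  by split=> //; apply/forallP => x; apply/forallP => v; apply/eqP; apply: semi.
have card_fib r : r \in H -> #|fib r| = #|kernel|.
  move=> /H_complete[phi [gam [eta [[phiD gamD etaD isot] semi]]]].
  pose h (t : T3) : T3 := (t.1.1 * phi, t.1.2 * gam, t.2 * eta)%g.
  have h_inj : injective h by move=> [[a b] c] [[a' b'] c'] [/mulIg-> /mulIg-> /mulIg->].
  rewrite -[RHS](card_imset _ h_inj); apply: eq_card => -[[phi' gam'] eta'].
  apply/fibP/imsetP => [[[phiD' gamD' etaD' isot'] semi'] |
      [[[phi1 gam1] eta1] /kernelP[[phiD1 gamD1 etaD1 isot1] semi1] [-> -> ->]]].
    exists (phi' * phi^-1, gam' * gam^-1, eta' * eta^-1)%g; last by rewrite /h /= !mulgKV.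
    have invD (g : {perm V}) : (forall v w, g (v + w) = g v + g w) ->
        forall v w, (g^-1)%g (v + w) = (g^-1)%g v + (g^-1)%g w.
      by move=> gD v w; apply: (@perm_inj _ g); rewrite gD !permKV.
    apply/kernelP; split; first split=> v w; rewrite ?permM.
    - by rewrite phiD' invD.
    - by rewrite gamD' invD.
    - by rewrite etaD' invD.
    - by apply: (@perm_inj _ phi); rewrite permKV isot isot' !permKV.
    by move=> x v; rewrite !permM; apply: (@perm_inj _ eta); rewrite permKV semi semi' permKV.
  split; first split=> v w; rewrite ?permM.
  - by rewrite phiD1 phiD.
  - by rewrite gamD1 gamD.
  - by rewrite etaD1 etaD.
  - by rewrite isot1 isot.
  by move=> x v; rewrite !permM semi1 semi.
rewrite -sum_nat_const -(eq_bigr _ card_fib).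
have -> : (\sum_(r in H) #|fib r| = \sum_(r in H) \sum_(t in A) (t \in fib r))%N.
  apply: eq_bigr => r _; rewrite -sum1_card big_mkcond [RHS]big_mkcond.
  by apply: eq_bigr => t _; rewrite inE; case: (t \in A); case: [forall x, _].
rewrite -sum1_card exchange_big /=; apply: eq_bigr => -[[phi gam] eta] /A_autot aut.
have [r rH semi] := H_sound aut.
have [_ _ etaD _] := aut.
rewrite (bigD1 r) //= big1 ?addn0 => [|r' /andP[_ neq]].
  by apply/esym/eqP; rewrite eqb1; apply/fibP.
apply/eqP; rewrite eqb0; apply: contra neq => /fibP[_ semi']; apply/eqP/app_inj => x.
have eta0 : eta 0 = 0 by apply: (addrI (eta 0)); rewrite -etaD !addr0.
have etae : eta e != 0 by rewrite -eta0 (inj_eq (@perm_inj _ eta)).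
by apply: (Eact_scalar_inj etae); rewrite -semi semi'.
Qed.

End Count.

End CyclicAlgebra.

(** Stated for bare functions, because the automorphisms induced by eta on L and E are only obtained
    pointwise. *)
Lemma gal_of_ring_morphism (k : fieldType) (M : splittingFieldType k) (g : M -> M) :
    {morph g : x y / x + y} -> {morph g : x y / x * y} ->
    (forall c : k, g c%:A = c%:A) ->
  exists2 x : gal_of {:M}, x \in 'Gal({:M} / 1)%g & forall a, x a = g a.
Proof.
move=> gD gM gC.
have g1 : g 1 = 1 by rewrite -(scale1r 1) gC.
have g0 : g 0 = 0 by apply: (addrI (g 0)); rewrite -gD !addr0.
have gB : zmod_morphism g.
  move=> x y; rewrite gD; congr (_ + _); apply: (addrI (g y)).
  by rewrite -gD !subrr.
have gZ : scalable g by move=> c x; rewrite -mulr_algl gM gC mulr_algl.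
pose fA := GRing.isZmodMorphism.Build _ _ g gB.
pose fM := GRing.isMonoidMorphism.Build _ _ g (conj g1 gM).
pose fZ := GRing.isScalable.Build _ _ _ _ g gZ.
pose f : {lrmorphism _ -> _} := HB.pack g fA fM fZ.
have /kAut_to_gal[x galx Dx] : kAut 1 {:M} (linfun f).
  rewrite kAutfE; apply/kHomP_tmp; split=> [x /vlineP[c ->] | x y _ _]; rewrite !lfunE /=.
    exact: gC.
  exact: gM.
by exists x => // a; rewrite -Dx ?memvf ?lfunE.
Qed.

Lemma mem_gal1 (k : fieldType) (M : splittingFieldType k) (r : gal_of {:M}) :
  r \in 'Gal({:M} / 1)%g.
Proof.
rewrite gal_kHom ?sub1v //; apply/kHomP_tmp.
by split=> [_ /vlineP[c ->] | x y _ _]; rewrite ?linearZ ?rmorph1 ?rmorphM.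
Qed.

Lemma gal_power_map (k : finFieldType) (M : splittingFieldType k) (r : gal_of {:M}) :
  exists i, forall x, r x = x ^+ (#|k| ^ i).
Proof.
have [al gen_al al_pow] := finField_galois_generator (sub1v {:M}).
have := mem_gal1 r; rewrite (eqP gen_al) => /cycleP[i ->]; exists i.
elim: i => [|i IH] x; first by rewrite gal_id expn0 expr1.
by rewrite expgSr galM ?memvf // IH al_pow ?memvf // dimv1 expn1 -exprM expnSr.
Qed.

Lemma frobenius_power (R : comNzRingType) (p i : nat) : p \in [pchar R] ->
  exists phi : {rmorphism R -> R}, forall x, phi x = x ^+ (p ^ i).
Proof.
move=> pR; elim: i => [|i [phi Ephi]]; first by exists idfun => x; rewrite expn0 expr1.
exists (pFrobenius_aut pR \o phi) => x /=.
by rewrite Ephi pFrobenius_autE -exprM expnSr.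
Qed.

(** * Cyclic extensions of finite fields *)

Section CyclicExtension.

Variables (K : finFieldType) (L : fieldExtType K) (n : nat).
Hypothesis dimL : \dim {:L} = n.
Local Notation LL := (finvect_type L).
Variable sigma : gal_of {:LL}.
Hypothesis sigma_gen : generator 'Gal({:LL} / 1)%g sigma.
Local Notation sig := (gal_rmorphism sigma).
Local Notation kap := (in_alg LL).

Lemma card_finvect : #|LL| = (#|K| ^ n)%N.
Proof.
rewrite -dimL -(card_vspace (fullv : {vspace LL})).
by apply: eq_card => x; rewrite memvf.
Qed.

Let galGal : galois 1 {:LL}.
Proof. exact/finField_galois/sub1v. Qed.

Let galE : 'Gal({:LL} / 1)%g = <[sigma]>%g.
Proof. exact/eqP. Qed.

Lemma iter_gal i x : iter i sig x = (sigma ^+ i)%g x.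
Proof.
elim: i => [|i IH] /=; first by rewrite gal_id.
by rewrite expgSr galM ?memvf // IH.
Qed.

Lemma gal_fixK c : sig (kap c) = kap c.
Proof. by rewrite /= linearZ rmorph1. Qed.

Lemma gal_order_dim : #[sigma]%g = n.
Proof.
rewrite orderE -galE; have := galois_dim galGal.
by rewrite dimv1 divn1 => <-.
Qed.

Lemma gal_fixed x : sig x = x -> exists c, x = kap c.
Proof.
move=> sx; suff : x \in 1%VS by move=> /vlineP[c ->]; exists c.
rewrite -(galois_fixedField galGal).
apply/fixedFieldP; rewrite ?memvf // => y; rewrite galE => /cycleP[i ->].
rewrite -iter_gal; elim: i => //= i ->; exact: sx.
Qed.

Lemma gal_iter_n x : iter n sig x = x.
Proof. by rewrite iter_gal -gal_order_dim expg_order gal_id. Qed.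

Lemma gal_iter_order i : (forall x, iter i sig x = x) -> (n %| i)%N.
Proof.
move=> fix_i; rewrite -gal_order_dim order_dvdn; apply/gal_eqP => x _.
by rewrite -iter_gal fix_i gal_id.
Qed.

Lemma gal_expr : exists Q, forall x, sig x = x ^+ Q.
Proof.
have [i Ei] := @gal_power_map _ LL sigma.
by exists (#|K| ^ i)%N.
Qed.

Lemma gal_ring_morphism (t : LL -> LL) : (forall x y, t (x + y) = t x + t y) ->
  (forall x y, t (x * y) = t x * t y) -> (forall k, t (kap k) = kap k) ->
  exists j : 'I_n, forall x, t x = iter j sig x.
Proof.
move=> tD tM tK; have [x galx Ex] := gal_of_ring_morphism tD tM tK.
move: galx; rewrite galE => /cyclePmin[j lt_j Ej].
rewrite gal_order_dim in lt_j; exists (Ordinal lt_j) => y /=.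
by rewrite iter_gal -Ej Ex.
Qed.

Lemma skew_norm_galNorm x : skew_norm sig n x = galNorm 1 {:LL} x.
Proof.
rewrite /galNorm galE /skew_norm.
have -> : <[sigma]>%g = [set (sigma ^+ (i : nat))%g | i : 'I_n].
  apply/setP => y; apply/idP/imsetP => [/cyclePmin[i] | [i _ ->]]; last exact: mem_cycle.
  by rewrite gal_order_dim => lt_i ->; exists (Ordinal lt_i).
rewrite big_imset /= => [|i j _ _ /eqP].
  by apply: eq_bigr => i _; rewrite iter_gal.
by rewrite eq_expg_mod_order gal_order_dim !modn_small // => /eqP/val_inj.
Qed.

Lemma skew_norm_hilbert90 x : skew_norm sig n x = 1 ->
  exists2 y, y != 0 & x = y / sig y.
Proof.
rewrite skew_norm_galNorm => /eqP/(Hilbert's_theorem_90 sigma_gen (memvf x))[y [_ nz_y] Ex].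
by exists y.
Qed.

(** The norm is a product over the whole Galois group, so Frobenius may replace sigma as generator;
    the exponent is 1 + q + ... + q^(n-1). *)
Lemma skew_norm_expr : exists2 M, forall x, skew_norm sig n x = x ^+ M &
  (M * #|K|.-1)%N = (#|K| ^ n).-1.
Proof.
have [al gen_al al_pow] := finField_galois_generator (sub1v {:LL}).
exists (\sum_(i < n) #|K| ^ i)%N => [x|]; last by rewrite predn_exp mulnC.
have galE' : 'Gal({:LL} / 1)%g = <[al]>%g by apply/eqP.
have ord_al : #[al]%g = n by rewrite orderE -galE' galE -orderE gal_order_dim.
rewrite skew_norm_galNorm /galNorm galE'.
have -> : <[al]>%g = [set (al ^+ (i : nat))%g | i : 'I_n].
  apply/setP => y; apply/idP/imsetP => [/cyclePmin[i] | [i _ ->]]; last exact: mem_cycle.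
  by rewrite ord_al => lt_i ->; exists (Ordinal lt_i).
rewrite big_imset /= => [|i j _ _ /eqP]; last first.
  by rewrite eq_expg_mod_order ord_al !modn_small // => /eqP/val_inj.
rewrite expr_sum; apply: eq_bigr => i _; elim: (i : nat) => [|j IH].
  by rewrite gal_id expn0 expr1.
rewrite expgSr galM ?memvf // IH al_pow ?memvf // dimv1 expn1 -exprM.
by rewrite expnSr.
Qed.

(** The unit group of L is cyclic of order M (q - 1). Writing c = h^i for a generator h, the
    relation c^(q-1) = 1 forces M to divide i, and the norm is the M-th power. *)
Lemma skew_norm_surj (c : K) : c != 0 -> exists x, skew_norm sig n x = kap c.
Proof.
move=> nz_c; have [M normE EM] := skew_norm_expr.
have /cyclicP[h Eh] : cyclic [set: {unit LL}] by apply: field_unit_group_cyclic.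
have ord_h : #[h]%g = (M * #|K|.-1)%N by rewrite orderE -Eh card_finField_unit card_finvect EM.
have nz_kc : kap c != 0 by rewrite fmorph_eq0.
have : finField_unit nz_kc \in <[h]>%g by rewrite -Eh inE.
case/cycleP=> i Ei.
have q_gt1 : (0 < #|K|.-1)%N by rewrite -ltnS prednK ?finNzRing_gt1 // ltnW ?finNzRing_gt1.
have cq1 : kap c ^+ #|K|.-1 = 1.
  rewrite -rmorphXn (_ : c ^+ #|K|.-1 = 1) ?rmorph1 //.
  apply: (mulfI nz_c); rewrite -exprS prednK ?expf_card ?mulr1 //.
  exact: ltnW (finNzRing_gt1 K).
have : (M * #|K|.-1 %| i * #|K|.-1)%N.
  rewrite -ord_h order_dvdn expgM -Ei; apply/eqP/val_inj.
  by rewrite FinRing.val_unitX.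
rewrite dvdn_pmul2r // => /dvdnP[j Ej].
by exists (val (h ^+ j)%g); rewrite normE -FinRing.val_unitX -expgM -Ej -Ei.
Qed.

End CyclicExtension.

(** * Transfer to the definitions of the theorem *)

Lemma count_in_rat (a h q n s : nat) : (1 < q)%N ->
    (a * q.-1 = h * ((q ^ n).-1 ^ 2 * n * (q ^ s).-1))%N ->
  a%:R = h%:R * n%:R * ((q%:R ^+ s - 1) * (q%:R ^+ n - 1) ^+ 2 / (q%:R - 1)) :> rat.
Proof.
move=> q_gt1 E; have pred_natr m : (0 < m)%N -> m.-1%:R = m%:R - 1 :> rat.
  by move=> m_gt0; rewrite -[in RHS](prednK m_gt0) -addn1 natrD addrK.
have q_gt0 := ltnW q_gt1.
have nz_q : q%:R - 1 != 0 :> rat.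
  by rewrite -pred_natr // Num.Theory.pnatr_eq0 -lt0n -ltnS prednK.
apply: (mulIf nz_q); rewrite mulrA divfK //.
have := congr1 (fun m : nat => m%:R : rat) E.
by rewrite /= !natrM !pred_natr ?expn_gt0 ?q_gt0 // !natrX => ->; ring.
Qed.

Lemma Fp_linearP (p : nat) (S : finZmodType) (g : {perm S}) :
  reflect (forall v w, g (v + w) = g v + g w) (Fp_linear p g).
Proof.
apply: (iffP andP) => [[/forallP h _] v w | gD].
  by apply/eqP; move/forallP: (h v).
have gMn v i : g (v *+ i) = g v *+ i.
  elim: i => [|i IH]; last by rewrite !mulrS gD IH.
  by apply: (addrI (g 0)); rewrite -gD !addr0.
by split; apply/forallP => v; apply/forallP => w; apply/eqP.
Qed.

Lemma autotopismsP (K : finFieldType) (L : fieldExtType K) (sigma : gal_of {:finvect_type L})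
    (p s : nat) (f : skewpoly (gal_rmorphism sigma))
    (phi gam eta : {perm {poly_s (finvect_type L)}}) :
  (phi, gam, eta) \in autotopisms p (@cyclic_mul K L sigma s f) <-> autot f phi gam eta.
Proof.
rewrite inE; split=> [/and4P[] | [phiD gamD etaD isot]].
  move=> /Fp_linearP phiD /Fp_linearP gamD /Fp_linearP etaD /forallP isot.
  by split=> // v w; apply/eqP; move/forallP: (isot v); apply.
apply/and4P; split; [exact/Fp_linearP | exact/Fp_linearP | exact/Fp_linearP | ].
by apply/forallP => v; apply/forallP => w; apply/eqP; apply: isot.
Qed.

Section AbsoluteAutomorphisms.

Variables (p : nat) (K : finFieldType) (E : fieldExtType K).
Hypothesis pcharK : p \in [pchar K].
Local Notation EE := (finvect_type E).
Local Notation abs := (absolute_field E pcharK).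

Definition absolute_app (r : gal_of {:abs}) (x : EE) : EE := r (x : abs).

Let AutFpE : AutFp E pcharK = setT.
Proof. by apply/setP => r; rewrite in_setT; apply: (@mem_gal1 _ abs r). Qed.

Lemma absolute_app_inj r r' : absolute_app r =1 absolute_app r' -> r = r'.
Proof. by move=> Err; apply/eqP/gal_eqP => x _; apply: Err. Qed.

Lemma absolute_app_ring (g : EE -> EE) :
    {morph g : x y / x + y} -> {morph g : x y / x * y} -> g 1 = 1 ->
  exists r, absolute_app r =1 g.
Proof.
move=> gD gM g1.
have gn i : g i%:R = i%:R.
  elim: i => [|i IH]; first by apply: (addrI (g 0)); rewrite -gD !addr0.
  by rewrite -addn1 natrD gD IH g1.
have gC (c : 'F_p) : (g : abs -> abs) c%:A = c%:A.
  have -> : (c%:A : abs) = (c : nat)%:R by rewrite -[c in LHS]natr_Zp scaler_nat.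
  exact: gn.
by have [r _ Er] := @gal_of_ring_morphism _ abs g gD gM gC; exists r.
Qed.

Lemma absolute_app_frobenius r : exists i, forall x, absolute_app r x = x ^+ (p ^ i).
Proof.
have [i Ei] := @gal_power_map _ abs r.
by exists i => x; rewrite /absolute_app Ei card_Fp // (pcharf_prime pcharK).
Qed.

Lemma absolute_app_HF n (u : EE) r : r \in HF pcharK n u <->
  (exists2 k : K, k != 0 & absolute_app r u = k%:A * u) \/
  (n = 2%N /\ exists2 k : K, k != 0 & absolute_app r u = k%:A / u).
Proof.
have HplusP : r \in Hplus pcharK u <-> exists2 k : K, k != 0 & absolute_app r u = k%:A * u.
  rewrite inE AutFpE in_setT; split=> [/existsP[k /andP[nz_k /eqP Ek]] | [k nz_k Ek]].
    by exists k; rewrite ?mulr_algl.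
  by apply/existsP; exists k; rewrite nz_k -mulr_algl; apply/eqP.
have HminusP : r \in Hminus pcharK u <-> exists2 k : K, k != 0 & absolute_app r u = k%:A / u.
  rewrite inE AutFpE in_setT; split=> [/existsP[k /andP[nz_k /eqP Ek]] | [k nz_k Ek]].
    by exists k; rewrite ?mulr_algl.
  by apply/existsP; exists k; rewrite nz_k -mulr_algl; apply/eqP.
rewrite /HF; case: eqP => [n2 | nn2].
  by rewrite inE; split=> [/orP[/HplusP | /HminusP] | [/HplusP-> // | [_ /HminusP->]]];
    rewrite ?orbT; [left | right |].
by split=> [/HplusP | [/HplusP | [] //]]; first by left.
Qed.

End AbsoluteAutomorphisms.

Theorem corollary6p14
  (p q n s : nat) (K : finFieldType) (L E : fieldExtType K)
  (pcharK : p \in [pchar K]) (cardK : #|K| = q)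
  (n_ge2 : (2 <= n)%N) (s_ge2 : (2 <= s)%N)
  (dimL : \dim {: L} = n) (dimE : \dim {: E} = s)
  (sigma : gal_of {: finvect_type L})
  (sigma_gen : generator 'Gal({: finvect_type L} / 1)%g sigma)
  (F : {poly K}) (F_monic : F \is monic) (F_irr : irreducible_poly F)
  (sizeF : size F = s.+1)
  (F_exc : ~ [/\ n = 2%N, s = 2%N & exists2 nu : K, nu != 0 & F = 'X^2 - nu%:P])
  (f : skewpoly (gal_rmorphism sigma))
  (f_monic : (f : {poly finvect_type L}) \is monic)
  (f_irr : irreducible_elt f)
  (f_dvd : right_divisor f (skew_eval_Xn n sigma F))
  (u : finvect_type E) (u_root : root (map_poly (in_alg (finvect_type E)) F) u) :
  #|autotopisms p (@cyclic_mul K L sigma s f)|%:R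
  = #|HF pcharK n u|%:R * n%:R
    * ((q%:R ^+ s - 1) * (q%:R ^+ n - 1) ^+ 2 / (q%:R - 1)) :> rat.
Proof.
pose LL := finvect_type L; pose EE := finvect_type E.
pose sig := gal_rmorphism sigma.
pose kap : {rmorphism K -> LL} := in_alg LL.
pose kE : {rmorphism K -> EE} := in_alg EE.
have n_gt1 : (1 < n)%N := n_ge2.
have fixK c : sig (kap c) = kap c by apply: gal_fixK.
have fixed x : sig x = x -> exists c, x = kap c by apply: gal_fixed.
have sign x : iter n sig x = x by apply: gal_iter_n.
have sigo i : (forall x, iter i sig x = x) -> (n %| i)%N by apply: gal_iter_order.
have [Q sigQ] := gal_expr sigma.
have cardL : #|LL| = (#|K| ^ n)%N by apply: card_finvect.
have cardE : #|EE| = (#|K| ^ s)%N by apply: card_finvect.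
have f_dvd' : right_divisor f (cpoly n fixK F).
  by rewrite cpolyE.
(* The degree of f is not given; it follows by comparing cardinalities, applied with r the actual
   degree. *)
have szf : sksize f = s.+1.
  have szf' : sksize f = (sksize f).-1.+1.
    by rewrite prednK // lt0n sksize_eq0; apply: monic_neq0.
  by rewrite szf' (cyc_degree n_gt1 fixed sign sigo F_monic F_irr s_ge2 sizeF cardL
    f_monic szf' f_irr f_dvd').
have u_nexc : n = 2%N -> forall k, u * u != kE k.
  move=> n2 k; apply/eqP => uuk.
  have nz_u : u != 0 by apply: (u_neq0 F_irr s_ge2 sizeF u_root).
  have nz_k : k != 0.
    by apply: contraNneq nz_u => k0; move/eqP: uuk; rewrite k0 rmorph0 mulf_eq0 orbb.
  (* If u^2 = k then F divides Y^2 - k; as s >= 2 and both are monic they agree, which is the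
     excluded case. *)
  have dvF : F %| 'X^2 - k%:P.
    rewrite -(evE_eq0 F_irr (kE := kE) u_root) /evE rmorphB /= map_polyXn map_polyC /=.
    by rewrite !hornerE ?hornerXn expr2 subr_eq0; apply/eqP.
  have sz2 : size ('X^2 - k%:P) = 3%N by rewrite size_XnsubC.
  have nz2 : 'X^2 - k%:P != 0 :> {poly K} by rewrite -size_poly_eq0 sz2.
  have s2 : s = 2%N.
    by have := dvdp_leq nz2 dvF; rewrite sz2 sizeF ltnS => les; apply/eqP; rewrite eqn_leq les.
  apply: F_exc; split=> //; exists k => //.
  have eqF : F %= 'X^2 - k%:P by rewrite -dvdp_size_eqp // sz2 sizeF s2.
  have mon2 : 'X^2 - k%:P \is monic by apply: monicXnsubC.
  by move: eqF; rewrite eqp_monic // => /eqP.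
have extends (r : gal_of {: absolute_field E pcharK}) :
    exists (tau : {rmorphism LL -> LL}) (rho : {rmorphism EE -> EE}) (tauK : K -> K),
    [/\ forall k, tau (kap k) = kap (tauK k), forall k, rho (kE k) = kE (tauK k)
      & absolute_app r =1 rho].
  (* The exponent p^i of [r] defines ring endomorphisms of L and E that restrict to the same map on
     K. *)
  have [i Ei] := absolute_app_frobenius r.
  have [|tau Etau] := @frobenius_power LL p i; first by rewrite pchar_lalg.
  have [|rho Erho] := @frobenius_power EE p i; first by rewrite pchar_lalg.
  exists tau, rho, (fun k => k ^+ (p ^ i)); split=> [k | k | x].
  - by rewrite Etau rmorphXn.
  - by rewrite Erho rmorphXn.
  by rewrite Ei Erho.
apply: count_in_rat; first by rewrite -cardK finNzRing_gt1.
rewrite -cardK -cardL -cardE.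
exact: (card_autot n_gt1 fixed sign sigo F_monic F_irr s_ge2 sizeF cardL sigQ
  f_monic szf f_irr f_dvd' u_root cardE (gal_ring_morphism dimL sigma_gen)
  (skew_norm_hilbert90 dimL sigma_gen) u_nexc (@autotopismsP K L sigma p s f)
  (@absolute_app_inj p K E pcharK) (@absolute_app_ring p K E pcharK) extends
  (@absolute_app_HF p K E pcharK n u) (skew_norm_surj dimL sigma_gen)).
Qed.
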